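(* Let $\lambda>0$. Let $K\subset\mathbb{S}^2$ be a $\lambda$-concave body and $S\subset\mathbb{S}^2$ be a $\lambda$-sausage. If $|K|=|S|$, then the circumradii satisfy $R(K)\leq R(S)$. Moreover, equality $R(K)=R(S)$ holds if and only if $K$ is a $\lambda$-sausage.
   Context: $\mathbb{S}^2$ is the unit $2$-sphere. A convex body is a compact, geodesically convex set with non-empty interior, and $|K|$ denotes its area. A convex body $K\subset\mathbb{S}^2$ is $\lambda$-concave if the geodesic curvature $k$ of $\partial K$ with respect to the inward normal satisfies $\lambda\geq k(p)\geq0$ at each $p\in\partial K$, where for non-smooth boundary this is understood in the barrier sense: for each $p\in\partial K$ there exist a neighborhood $U_p$ of $p$ and a closed geodesic disk $D$ bounded by a circle of geodesic curvature $\lambda$ passing through $p$ such that $U_p\cap D\subset K$. A $\lambda$-sausage is a convex body that is the geodesic convex hull of two circles of geodesic curvature equal to $\lambda$. The circumradius $R(K)$ is the radius of the smallest geodesic disk containing $K$. *)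

(* Defs.v *)
From HB Require Import structures.
From mathcomp Require Import all_boot all_order all_algebra.
From mathcomp Require Import all_classical all_reals all_analysis.

Set Implicit Arguments.
Unset Strict Implicit.
Unset Printing Implicit Defensive.

Import Order.TTheory GRing.Theory Num.Theory.
Import numFieldNormedType.Exports.

Local Open Scope classical_set_scope.
Local Open Scope ring_scope.

(* The library norm on 'rV[R]_3 is the sup norm, so the Euclidean structure is
   given by [dot]; only the topology of 'rV[R]_3 is taken from the library.
   Subsets of the sphere are subsets of 'rV[R]_3 contained in [sphere]. *)
Definition dot (R : realType) (x y : 'rV[R]_3) : R := \sum_(i < 3) x 0 i * y 0 i.

Definition sphere (R : realType) : set 'rV[R]_3 := [set x | dot x x = 1].
Arguments sphere {R}.

Definition gdist (R : realType) (x y : 'rV[R]_3) : R := acos (dot x y).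

Definition geodesic_disk (R : realType) (c : 'rV[R]_3) (r : R) : set 'rV[R]_3 :=
  [set x | sphere x /\ gdist c x <= r].

Definition geodesic_circle (R : realType) (c : 'rV[R]_3) (r : R) :
    set 'rV[R]_3 :=
  [set x | sphere x /\ gdist c x = r].

(* Unit-speed geodesic (great circle) issued from [x] with velocity [v], for
   [x] on the sphere and [v] a unit vector orthogonal to [x]. It is minimizing
   exactly on the parameter intervals of length at most pi. *)
Definition geodesic (R : realType) (x v : 'rV[R]_3) (t : R) : 'rV[R]_3 :=
  cos t *: x + sin t *: v.

(* Any two points of [K] are joined by a minimizing geodesic contained in [K];
   this geodesic is unique unless the two points are antipodal. *)
Definition geodesically_convex (R : realType) (K : set 'rV[R]_3) : Prop :=
  K `<=` sphere /\
  forall x y, K x -> K y ->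
    exists (v : 'rV[R]_3) (l : R),
      [/\ dot v v = 1, dot x v = 0, 0 <= l <= pi, geodesic x v l = y &
          forall t, 0 <= t <= l -> K (geodesic x v t)].

Definition geodesic_hull (R : realType) (A : set 'rV[R]_3) : set 'rV[R]_3 :=
  \bigcap_(K in [set K | geodesically_convex K /\ A `<=` K]) K.

(* Interior and boundary relative to the sphere. As the sphere is closed, the
   closures may be taken in 'rV[R]_3. *)
Definition sphere_interior (R : realType) (K : set 'rV[R]_3) : set 'rV[R]_3 :=
  [set p | sphere p /\ \forall x \near p, sphere x -> K x].

Definition sphere_boundary (R : realType) (K : set 'rV[R]_3) : set 'rV[R]_3 :=
  closure K `&` closure (sphere `\` K).

Definition convex_body (R : realType) (K : set 'rV[R]_3) : Prop :=
  [/\ compact K, geodesically_convex K & sphere_interior K !=set0].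

(* Geodesic curvature at time [t] of a regular curve [g] on the sphere, with
   respect to a unit normal [nu] (tangent to the sphere at [g t], orthogonal to
   the curve): the component of the acceleration along [nu], for an arbitrary
   parametrization. *)
Definition geodesic_curvature (R : realType) (g : R -> 'rV[R]_3)
    (nu : 'rV[R]_3) (t : R) : R :=
  dot (derive1 (derive1 g) t) nu / dot (derive1 g t) (derive1 g t).

Definition orthonormal_frame (R : realType) (c u v : 'rV[R]_3) : Prop :=
  [/\ dot c c = 1, dot u u = 1 & dot v v = 1] /\
  [/\ dot c u = 0, dot c v = 0 & dot u v = 0].

Definition circle_curve (R : realType) (c u v : 'rV[R]_3) (r t : R) :
    'rV[R]_3 :=
  cos r *: c + sin r *: (cos t *: u + sin t *: v).

(* Unit vector tangent to the sphere at [p] and pointing towards [c]. *)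
Definition inward_normal (R : realType) (c p : 'rV[R]_3) : 'rV[R]_3 :=
  (sin (gdist c p))^-1 *: (c - dot c p *: p).

(* [geodesic_circle c r], the boundary of [geodesic_disk c r], is a
   nondegenerate circle which has geodesic curvature [k] everywhere with respect
   to the inward normal of that disk. *)
Definition circle_of_curvature (R : realType) (k : R) (c : 'rV[R]_3) (r : R) :
    Prop :=
  [/\ sphere c, 0 < r < pi &
      forall (u v : 'rV[R]_3) (t : R), orthonormal_frame c u v ->
        geodesic_curvature (circle_curve c u v r)
          (inward_normal c (circle_curve c u v r t)) t = k].

(* The lower curvature bound 0 is convexity; the upper bound [lambda] is the
   barrier condition, imposed at every boundary point. *)
Definition lambda_concave (R : realType) (lambda : R) (K : set 'rV[R]_3) :
    Prop :=
  convex_body K /\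
  forall p, sphere_boundary K p ->
    exists (c : 'rV[R]_3) (r : R) (U : set 'rV[R]_3),
      [/\ circle_of_curvature lambda c r, geodesic_circle c r p,
          nbhs p U & U `&` geodesic_disk c r `<=` K].

(* The two circles are allowed to coincide. *)
Definition lambda_sausage (R : realType) (lambda : R) (S : set 'rV[R]_3) :
    Prop :=
  convex_body S /\
  exists (c1 c2 : 'rV[R]_3) (r1 r2 : R),
    [/\ circle_of_curvature lambda c1 r1, circle_of_curvature lambda c2 r2 &
        S = geodesic_hull (geodesic_circle c1 r1 `|` geodesic_circle c2 r2)].

(* [phi] is the colatitude and [theta] the longitude; the area element of the
   unit sphere in these coordinates is sin phi dphi dtheta. *)
Definition spherical_point (R : realType) (phi theta : R) : 'rV[R]_3 :=
  \row_(i < 3) [:: sin phi * cos theta; sin phi * sin theta; cos phi]`_i.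

Definition area (R : realType) (K : set 'rV[R]_3) : \bar R :=
  (\int[lebesgue_measure]_(theta in `[0%R, (2 * pi)%R])
     \int[lebesgue_measure]_(phi in `[0%R, pi])
       (sin phi * \1_K (spherical_point phi theta))%:E)%E.

Definition circumradius (R : realType) (K : set 'rV[R]_3) : R :=
  inf [set r : R | 0 <= r /\ exists2 c, sphere c & K `<=` geodesic_disk c r].

(* Main.v *)
(* Let r be the radius of the circles of geodesic curvature lambda. Call a vector
   n dual to K if n.x >= 0 on K. Blaschke's rolling argument turns the local
   barrier condition into a global one: if n0 is a unit dual vector vanishing at
   p in K, the disk of radius r with center y = cos r p + sin r n0 lies in K,
   that is, n.y >= sin r |n| for every dual n.

   Let c be the circumcenter of K and a + r its circumradius. The points of K at
   distance a + r from c are seen from c in directions which do not lie in an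
   open half circle, so that they divide the full turn into sectors of angles
   2 b_i <= pi. By rolling, K contains around each such direction the sector of
   angle b_i of the sausage of circumradius a + r, measured from its long axis.
   The angular density of the area of a sausage decreases from the long to the
   short axis, so its integral G over [0, b] satisfies G b >= (2 b / pi) G (pi / 2),
   with strict inequality if a > 0 and 0 < b < pi / 2. Summing over three sectors
   with b_1 + b_2 + b_3 = pi, the area of K is at least that of the sausage of
   the same circumradius, and areas of sausages increase with the circumradius.
   In the equality case K has two opposite contact directions, hence contains
   the sausage of the same area and is equal to it.

   The area does not depend on the orthonormal frame used in its definition:
   rotations about the pole shift the longitude, and two orthogonal poles are
   exchanged through the orthogonal projection to the plane they span. *)

(* The body has no regularity, so rolling is carried out on its dual cone. The barrier condition
   says that near a boundary vector b the dual lies in a circular cone of angular radius pi/2 - r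
   through b ([dual_local]), and rolling says that it does so globally. The passage is a continuity
   argument in the style of Tietze and Nakajima: lenses between two vectors of the dual, bounded by
   arcs of circles of radius larger than pi/2 - r, cannot leave the dual, since the first arc to
   touch its boundary from inside would contradict the local inclusion; if a dual vector n lay
   outside the cone at b, the lens from b to n would leave that cone arbitrarily near b. The sweep
   starts from endpoints interior to the dual, whence the vectors positive on all of K. These exist
   only if K has no antipodal points; otherwise K is a hemisphere or the sphere, and its area
   exceeds that of every sausage other than the sphere. Membership is tested throughout by
   separating vectors, which replaces computations of hulls and of the exact shape of slices. *)
From HB Require Import structures.
Require Import Defs.
From mathcomp Require Import all_boot all_order all_algebra.
From mathcomp Require Import all_classical all_reals all_analysis.
From mathcomp Require Import measurable_realfun.
From mathcomp Require Import ring lra.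
Import Order.TTheory GRing.Theory Num.Theory.
Import numFieldNormedType.Exports.
Local Open Scope classical_set_scope.
Local Open Scope ring_scope.

Set Implicit Arguments.
Unset Strict Implicit.
Unset Printing Implicit Defensive.

(** * Vector algebra *)

Section VectorAlgebra.
Context {R : realType}.
Implicit Types (x y z n c u v : 'rV[R]_3) (a b t : R).

Definition i0 : 'I_3 := @Ordinal 3 0 isT.
Definition i1 : 'I_3 := @Ordinal 3 1 isT.
Definition i2 : 'I_3 := @Ordinal 3 2 isT.

Definition vec3 a b t : 'rV[R]_3 := \row_(i < 3) [:: a; b; t]`_i.

Definition cross x y : 'rV[R]_3 :=
  vec3 (x 0 i1 * y 0 i2 - x 0 i2 * y 0 i1)
       (x 0 i2 * y 0 i0 - x 0 i0 * y 0 i2)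
       (x 0 i0 * y 0 i1 - x 0 i1 * y 0 i0).

Definition nrm x : R := Num.sqrt (dot x x).
Definition unitv x : 'rV[R]_3 := (nrm x)^-1 *: x.

Lemma dotE x y :
  dot x y = x 0 i0 * y 0 i0 + x 0 i1 * y 0 i1 + x 0 i2 * y 0 i2.
Proof.
rewrite /dot !big_ord_recl big_ord0 addr0 addrA.
by congr (_ * _ + _ * _ + _ * _); congr (_ 0 _); apply/val_inj.
Qed.

Lemma vec3P x y : x 0 i0 = y 0 i0 -> x 0 i1 = y 0 i1 -> x 0 i2 = y 0 i2 ->
  x = y.
Proof.
move=> h0 h1 h2; apply/rowP => -[[|[|[|//]]] p].
- by rewrite (_ : Ordinal p = i0)//; apply/val_inj.
- by rewrite (_ : Ordinal p = i1)//; apply/val_inj.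
- by rewrite (_ : Ordinal p = i2)//; apply/val_inj.
Qed.

Lemma forall_ord3 (P : 'I_3 -> Prop) : P i0 -> P i1 -> P i2 -> forall i, P i.
Proof.
move=> h0 h1 h2 [[|[|[|//]]] p].
- by rewrite (_ : Ordinal p = i0)//; apply/val_inj.
- by rewrite (_ : Ordinal p = i1)//; apply/val_inj.
- by rewrite (_ : Ordinal p = i2)//; apply/val_inj.
Qed.

Lemma dotC x y : dot x y = dot y x.
Proof. by rewrite !dotE; ring. Qed.

Lemma dotDl x y z : dot (x + y) z = dot x z + dot y z.
Proof. by rewrite !dotE !mxE; ring. Qed.

Lemma dotDr x y z : dot z (x + y) = dot z x + dot z y.
Proof. by rewrite !dotE !mxE; ring. Qed.

Lemma dotBl x y z : dot (x - y) z = dot x z - dot y z.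
Proof. by rewrite !dotE !mxE; ring. Qed.

Lemma dotBr x y z : dot z (x - y) = dot z x - dot z y.
Proof. by rewrite !dotE !mxE; ring. Qed.

Lemma dotNl x y : dot (- x) y = - dot x y.
Proof. by rewrite !dotE !mxE; ring. Qed.

Lemma dotNr x y : dot x (- y) = - dot x y.
Proof. by rewrite !dotE !mxE; ring. Qed.

Lemma dotZl a x y : dot (a *: x) y = a * dot x y.
Proof. by rewrite !dotE !mxE; ring. Qed.

Lemma dotZr a x y : dot x (a *: y) = a * dot x y.
Proof. by rewrite !dotE !mxE; ring. Qed.

Lemma dot0l x : dot 0 x = 0.
Proof. by rewrite !dotE !mxE; ring. Qed.

Lemma dot0r x : dot x 0 = 0.
Proof. by rewrite !dotE !mxE; ring. Qed.

Definition dot_lin := (dotDl, dotDr, dotBl, dotBr, dotNl, dotNr, dotZl, dotZr).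

Lemma dot_ge0 x : 0 <= dot x x.
Proof. by rewrite dotE -!expr2 !addr_ge0// sqr_ge0. Qed.

Lemma dot_eq0 x : (dot x x == 0) = (x == 0).
Proof.
apply/eqP/eqP => [|->]; last by rewrite dot0l.
rewrite dotE -!expr2 => /eqP.
rewrite paddr_eq0 ?addr_ge0 ?sqr_ge0// paddr_eq0 ?sqr_ge0//.
rewrite !sqrf_eq0 => /andP[/andP[/eqP h0 /eqP h1] /eqP h2].
by apply: vec3P; rewrite ?mxE.
Qed.

Lemma dot_gt0 x : (0 < dot x x) = (x != 0).
Proof. by rewrite lt_def dot_ge0 andbT dot_eq0. Qed.

Lemma dot_crossl x y : dot (cross x y) x = 0.
Proof. by rewrite dotE !mxE /=; ring. Qed.

Lemma dot_crossr x y : dot (cross x y) y = 0.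
Proof. by rewrite dotE !mxE /=; ring. Qed.

Lemma crossC x y : cross x y = - cross y x.
Proof. by apply: vec3P; rewrite !mxE/=; ring. Qed.

Lemma dot_cross_cross x y u v :
  dot (cross x y) (cross u v) = dot x u * dot y v - dot x v * dot y u.
Proof. by rewrite !dotE !mxE /=; ring. Qed.

Lemma cauchy_schwarz x y : dot x y ^+ 2 <= dot x x * dot y y.
Proof.
rewrite -subr_ge0 -[X in 0 <= X](_ : dot (cross x y) (cross x y) = _).
  exact: dot_ge0.
by rewrite dot_cross_cross (dotC y x) expr2.
Qed.

Lemma dot_unit_le1 x y : dot x x = 1 -> dot y y = 1 -> dot x y <= 1.
Proof.
move=> hx hy; have := cauchy_schwarz x y; rewrite hx hy mulr1.
by rewrite -[leRHS](expr1n _ 2) => h; apply: le_trans (ler_norm _) _; rewrite -[leRHS]normr1 -ler_sqr ?nnegrE// !real_normK ?num_real.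
Qed.

Lemma dot_unit_geN1 x y : dot x x = 1 -> dot y y = 1 -> -1 <= dot x y.
Proof.
move=> hx hy; have := @dot_unit_le1 (- x) y.
by rewrite !dot_lin opprK => /(_ hx hy); rewrite lerNl.
Qed.

Lemma dot_unit_eq1 x y : dot x x = 1 -> dot y y = 1 -> dot x y = 1 -> x = y.
Proof.
move=> hx hy hxy; apply/eqP; rewrite -subr_eq0 -dot_eq0 !dot_lin hx hy.
by rewrite (dotC y) hxy; lra.
Qed.

Lemma dot_unit_eqN1 x y : dot x x = 1 -> dot y y = 1 -> dot x y = -1 -> x = - y.
Proof.
by move=> hx hy hxy; apply: dot_unit_eq1 => //; rewrite !dot_lin ?opprK// hxy opprK.
Qed.

Lemma nrm_ge0 x : 0 <= nrm x. Proof. exact: sqrtr_ge0. Qed.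

Lemma nrm_sqr x : nrm x ^+ 2 = dot x x.
Proof. by rewrite sqr_sqrtr// dot_ge0. Qed.

Lemma nrm_gt0 x : (0 < nrm x) = (x != 0).
Proof. by rewrite sqrtr_gt0 dot_gt0. Qed.

Lemma nrm1 x : dot x x = 1 -> nrm x = 1.
Proof. by rewrite /nrm => ->; rewrite sqrtr1. Qed.

Lemma nrmZ a x : 0 <= a -> nrm (a *: x) = a * nrm x.
Proof.
by move=> a0; rewrite /nrm !dot_lin mulrA -expr2 sqrtrM ?sqr_ge0// sqrtr_sqr ger0_norm.
Qed.

Lemma le_nrm x a : 0 <= a -> (nrm x <= a) = (dot x x <= a ^+ 2).
Proof. by move=> a0; rewrite -nrm_sqr ler_sqr ?nnegrE ?nrm_ge0. Qed.

Lemma dot_le_nrm x y : dot x y <= nrm x * nrm y.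
Proof.
apply: le_trans (ler_norm _) _.
rewrite -ler_sqr ?nnegrE ?mulr_ge0 ?nrm_ge0// exprMn !nrm_sqr real_normK ?num_real//.
exact: cauchy_schwarz.
Qed.

Lemma nrmD x y : nrm (x + y) <= nrm x + nrm y.
Proof.
rewrite le_nrm ?addr_ge0 ?nrm_ge0// !dot_lin -!nrm_sqr (dotC y).
have := dot_le_nrm x y; lra.
Qed.

Lemma unitvE x : x = nrm x *: unitv x.
Proof.
have [->|x0] := eqVneq x 0; first by rewrite /unitv !scaler0.
by rewrite /unitv scalerA divff ?scale1r// gt_eqF// nrm_gt0.
Qed.

Lemma unitv1 x : x != 0 -> dot (unitv x) (unitv x) = 1.
Proof.
move=> x0; have n0 : nrm x != 0 by rewrite gt_eqF// nrm_gt0.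
by rewrite !dot_lin -nrm_sqr; field.
Qed.

Lemma unitv_id x : dot x x = 1 -> unitv x = x.
Proof. by move=> /nrm1; rewrite /unitv => ->; rewrite invr1 scale1r. Qed.

Lemma unit_neq0 x : dot x x = 1 -> x != 0.
Proof. by move=> h; rewrite -dot_eq0 h oner_eq0. Qed.

Lemma dot_unitvr_ge0 n x : x != 0 -> (0 <= dot n (unitv x)) = (0 <= dot n x).
Proof. by move=> x0; rewrite dotZr pmulr_rge0// invr_gt0 nrm_gt0. Qed.

Lemma dot_unitvr_gt0 n x : x != 0 -> (0 < dot n (unitv x)) = (0 < dot n x).
Proof. by move=> x0; rewrite dotZr pmulr_rgt0// invr_gt0 nrm_gt0. Qed.

Lemma unitvZ a x : 0 < a -> unitv (a *: x) = unitv x.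
Proof.
move=> a0; rewrite /unitv nrmZ ?ltW// scalerA invfM mulrAC mulVf ?mul1r//.
by rewrite gt_eqF.
Qed.

(** It is enough that a vector orthogonal to the whole frame vanishes: multiplied by the triple
    product of the frame, whose square is 1, it becomes a combination of its three zero
    coordinates. *)
Lemma frame_expand u v c x : orthonormal_frame c u v ->
  x = dot x u *: u + dot x v *: v + dot x c *: c.
Proof.
move=> [[hc hu hv] [hcu hcv huv]].
have key : forall y, dot y u = 0 -> dot y v = 0 -> dot y c = 0 -> y = 0.
  move=> y yu yv yc.
  have hw : cross u v != 0.
    by rewrite -dot_eq0 dot_cross_cross hu hv huv mul0r subr0 mulr1 oner_eq0.
  have e : dot (cross u v) (cross u v) = 1.
    by rewrite dot_cross_cross hu hv huv (dotC v) huv; ring.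
  have e2 : dot c (cross u v) ^+ 2 = 1.
    (* Gram determinant *)
    have : dot c (cross u v) ^+ 2 =
      dot c c * (dot u u * dot v v - dot u v ^+ 2) -
      dot c u * (dot c u * dot v v - dot u v * dot c v) +
      dot c v * (dot c u * dot u v - dot u u * dot c v).
      by rewrite !dotE !mxE /=; ring.
    by rewrite hc hu hv hcu hcv huv => ->; ring.
  have gr : dot y y * dot c (cross u v) ^+ 2 = 0.
    have : dot c (cross u v) *: y = dot y c *: cross u v + dot y u *: cross v c
       + dot y v *: cross c u.
      by apply: vec3P; rewrite !mxE /= !dotE !mxE /=; ring.
    rewrite yu yv yc !scale0r !addr0 => /(congr1 (fun z => dot z z)).
    by rewrite !dot_lin dot0l => <-; ring.
  by apply/eqP; rewrite -dot_eq0 -[dot y y]mulr1 -e2 gr.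
apply/eqP; rewrite -subr_eq0; apply/eqP/key; rewrite !dot_lin ?hc ?hu ?hv.
- by rewrite (dotC v) hcu huv; ring.
- by rewrite hcv huv; ring.
- by rewrite (dotC u) (dotC v) hcu hcv; ring.
Qed.

Lemma frame_dot u v c x y : orthonormal_frame c u v ->
  dot x y = dot x u * dot y u + dot x v * dot y v + dot x c * dot y c.
Proof.
move=> F; rewrite {1}(frame_expand x F) !dot_lin !(dotC _ y); ring.
Qed.

(** Parallel or zero arguments are allowed, and a second argument 0 leaves a single orthogonality
    condition. In the degenerate cases a cross product with the first or second coordinate vector
    works, as both vanish only for the zero vector. *)
Lemma exists_perp c u : exists2 v, dot v v = 1 & dot c v = 0 /\ dot u v = 0.
Proof.
have [cu0|cu0] := eqVneq (cross c u) 0; last first.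
  exists (unitv (cross c u)); first exact: unitv1.
  by rewrite !dotZr !(dotC _ (cross _ _)) dot_crossl dot_crossr !mulr0.
have : exists2 v, v != 0 & dot c v = 0 /\ dot u v = 0.
  have [->|c0] := eqVneq c 0.
    have [->|u0] := eqVneq u 0.
      exists (vec3 1 0 0); last by rewrite !dot0l.
      by rewrite -dot_eq0 dotE !mxE/=; apply/eqP; lra.
    have [h|h] := eqVneq (cross u (vec3 1 0 0)) 0; last first.
      by exists (cross u (vec3 1 0 0)); rewrite // dot0l dotC dot_crossl.
    exists (cross u (vec3 0 1 0)); last by rewrite dot0l dotC dot_crossl.
    apply: contra u0 => /eqP h'; apply/eqP/vec3P.
    - by move/(congr1 (fun z : 'rV[R]_3 => z 0 i2)): h'; rewrite !mxE/=; lra.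
    - by move/(congr1 (fun z : 'rV[R]_3 => z 0 i2)): h; rewrite !mxE/=; lra.
    - by move/(congr1 (fun z : 'rV[R]_3 => z 0 i1)): h; rewrite !mxE/=; lra.
  have uE : dot c c *: u = dot c u *: c.
    have : cross c (cross c u) = 0 by rewrite cu0; apply: vec3P; rewrite !mxE/= ; ring.
    move=> h; apply/eqP; rewrite -subr_eq0 -oppr_eq0 -h; apply/eqP.
    by apply: vec3P; rewrite !mxE/= !dotE; ring.
  have uv w : dot c w = 0 -> dot u w = 0.
    move=> cw; apply/eqP; rewrite -(mulrI_eq0 _ (@mulfI _ (dot c c) _)) ?dot_eq0//.
    by rewrite -dotZl uE dotZl cw mulr0.
  have [h|h] := eqVneq (cross c (vec3 1 0 0)) 0; last first.
    by exists (cross c (vec3 1 0 0)); rewrite ?uv // dotC dot_crossl.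
  exists (cross c (vec3 0 1 0)); last by rewrite uv // dotC dot_crossl.
  apply: contra c0 => /eqP h'; apply/eqP/vec3P.
  - by move/(congr1 (fun z : 'rV[R]_3 => z 0 i2)): h'; rewrite !mxE/=; lra.
  - by move/(congr1 (fun z : 'rV[R]_3 => z 0 i2)): h; rewrite !mxE/=; lra.
  - by move/(congr1 (fun z : 'rV[R]_3 => z 0 i1)): h; rewrite !mxE/=; lra.
move=> [v v0 [cv uv]]; exists (unitv v); first exact: unitv1.
by rewrite !dotZr cv uv mulr0.
Qed.

Lemma exists_frame c u : dot c c = 1 -> dot u u = 1 -> dot c u = 0 ->
  exists v, orthonormal_frame c u v.
Proof.
by move=> c1 u1 cu; have [v v1 [cv uv]] := exists_perp c u; exists v.
Qed.

End VectorAlgebra.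

(** * Topology of the sphere and circles of given curvature *)

Section Topology.
Context {R : realType}.
Implicit Types (x y z n c u v : 'rV[R]_3) (a b t : R) (K : set 'rV[R]_3).

Lemma cvg_dot {T : Type} (F : set_system T) {FF : Filter F} (f g : T -> 'rV[R]_3)
    x y : f @ F --> x -> g @ F --> y ->
  dot (f t) (g t) @[t --> F] --> dot x y.
Proof.
move=> fx gy.
have co (h : T -> 'rV[R]_3) z i : h @ F --> z -> h t 0 i @[t --> F] --> z 0 i.
  by move=> hz; exact: (cvg_comp _ _ hz (@coord_continuous R 1 3 0 i z)).
rewrite dotE; under eq_fun do rewrite dotE.
by apply: cvgD; [apply: cvgD|]; apply: cvgM; exact: co.
Qed.

Lemma dot_continuous n : continuous (dot n).
Proof. by move=> x; exact: (@cvg_dot _ (nbhs x) _ (cst n) id n x (cvg_cst _) cvg_id). Qed.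

Lemma closed_halfspace n a : closed [set x | a <= dot n x].
Proof. exact: (continuous_closedP _).1 (@dot_continuous n) _ (@closed_ge R a). Qed.

Lemma closed_dot_eq n a : closed [set x | dot n x = a].
Proof. exact: (continuous_closedP _).1 (@dot_continuous n) _ (@closed_eq R a). Qed.

Lemma open_dot_gt n a : open [set x | a < dot n x].
Proof.
exact: (continuousP _).1 (@dot_continuous n) _ (@open_gt R a).
Qed.

Lemma closed_sphere : closed (@sphere R).
Proof.
have c : continuous (fun x : 'rV[R]_3 => dot x x).
  by move=> x; exact: (@cvg_dot _ (nbhs x) _ id id x x cvg_id cvg_id).
exact: (continuous_closedP _).1 c _ (@closed_eq R 1).
Qed.

(** The topology comes from the sup norm; this comparison puts a Euclidean ball inside every
    neighborhood. *)
Lemma mx_norm_le_nrm x : `|x| <= nrm x.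
Proof.
rewrite /Num.Def.normr/= mx_normrE; apply: bigmax_le; first exact: nrm_ge0.
move=> [i j] _ /=; rewrite (ord1 i).
rewrite -ler_sqr ?nnegrE ?nrm_ge0// real_normK ?num_real// nrm_sqr dotE.
move: j; apply: forall_ord3; rewrite -!expr2.
- by rewrite -addrA lerDl addr_ge0 ?sqr_ge0.
- by rewrite addrAC lerDr addr_ge0 ?sqr_ge0.
- by rewrite lerDr addr_ge0 ?sqr_ge0.
Qed.

Lemma compact_sphere : compact (@sphere R).
Proof.
apply: bounded_closed_compact; last exact: closed_sphere.
exists 1; split=> [|M M1 x sx]; first exact: num_real.
by rewrite /= (le_trans (mx_norm_le_nrm x))// nrm1// ltW.
Qed.

Lemma compact_sub_sphere K : K `<=` sphere -> closed K -> compact K.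
Proof. by move=> Ks cK; exact: subclosed_compact cK compact_sphere Ks. Qed.

Lemma compact_closed_rV K : compact K -> closed K.
Proof. by apply: compact_closed; exact: norm_hausdorff. Qed.

Lemma nbhs_dot_ball x (U : set 'rV[R]_3) : nbhs x U ->
  exists2 e, 0 < e & forall y, dot (y - x) (y - x) < e ^+ 2 -> U y.
Proof.
move=> /nbhs_ballP[e /= e0 eU]; exists e => // y ye; apply: eU.
rewrite -ball_normE /ball_ /= distrC; apply: le_lt_trans (mx_norm_le_nrm _) _.
by rewrite -ltr_sqr ?nnegrE ?nrm_ge0 ?ltW// nrm_sqr.
Qed.

Lemma dot_ball_nbhs x e : 0 < e -> nbhs x [set y | dot (y - x) (y - x) < e].
Proof.
move=> e0.
have : dot (y - x) (y - x) @[y --> x] --> dot (x - x) (x - x).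
  have cB : (fun y : 'rV[R]_3 => y - x) @ nbhs x --> x - x.
    by apply: (@cvgB _ _ _ (nbhs x) _ id (cst x) x x cvg_id); exact: (cvg_cst x).
  exact: (@cvg_dot _ (nbhs x) _ _ _ _ _ cB cB).
rewrite subrr dot0l => /(_ _ (lt_nbhsl e0)); exact.
Qed.

Lemma unitv_cvg {T : Type} (F : set_system T) {FF : Filter F} (f : T -> 'rV[R]_3) x :
  x != 0 -> f @ F --> x -> unitv (f t) @[t --> F] --> unitv x.
Proof.
move=> x0 fx; apply: cvgZ => //; apply: cvgV; first by rewrite gt_eqF// nrm_gt0.
exact: (cvg_comp _ _ (cvg_dot fx fx) (@sqrt_continuous R _)).
Qed.

End Topology.

Section Curvature.
Context {R : realType}.
Implicit Types (x y z n c u v : 'rV[R]_3) (a b t r lambda : R).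

Lemma derive1_rV3 (g h : R -> 'rV[R]_3) :
  (forall t i, is_derive t 1 (fun s => g s 0 i) (h t 0 i)) -> derive1 g = h.
Proof.
move=> gh; apply/funext => t; rewrite derive1E.
have dg : derivable g t 1.
  by apply/derivable_mxP => i j; rewrite (ord1 i); apply: ex_derive.
rewrite derive_mx//; apply/rowP => j; rewrite mxE.
by apply: derive_val.
Qed.

Lemma circle_curve_sphere c u v r t : orthonormal_frame c u v ->
  dot (circle_curve c u v r t) (circle_curve c u v r t) = 1 /\
  dot c (circle_curve c u v r t) = cos r.
Proof.
move=> [[hc hu hv] [hcu hcv huv]]; rewrite /circle_curve !dot_lin hc hu hv.
rewrite (dotC u c) (dotC v c) (dotC v u) hcu hcv huv; split; last by ring.
have := cos2Dsin2 r; have := cos2Dsin2 t => e1 e2.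
transitivity (cos r ^+ 2 + sin r ^+ 2 * (cos t ^+ 2 + sin t ^+ 2)).
  by ring.
by rewrite e1 mulr1.
Qed.

Lemma circle_curve_curvature c u v r t : orthonormal_frame c u v -> 0 < r < pi ->
  geodesic_curvature (circle_curve c u v r)
    (inward_normal c (circle_curve c u v r t)) t = cos r / sin r.
Proof.
move=> F /andP[r0 rpi]; have [e1 e2] := circle_curve_sphere r t F.
have sr : 0 < sin r by rewrite sin_gt0_pi// r0.
rewrite /geodesic_curvature.
have -> : derive1 (circle_curve c u v r) =
    (fun t => sin r *: (cos t *: v - sin t *: u)).
  apply: derive1_rV3 => s i; rewrite /circle_curve.
  under eq_fun do rewrite !mxE.
  rewrite !mxE; apply: is_derive_eq; rewrite !scaler0 ?add0r ?addr0.
  by rewrite /GRing.scale/=; ring.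
have -> : derive1 (fun t => sin r *: (cos t *: v - sin t *: u)) =
    (fun t => sin r *: (- sin t *: v - cos t *: u)).
  apply: derive1_rV3 => s i.
  under eq_fun do rewrite !mxE.
  rewrite !mxE; apply: is_derive_eq; rewrite !scaler0 ?add0r ?addr0.
  by rewrite /GRing.scale/=; ring.
rewrite /inward_normal /gdist e2 cosK; last first.
  by rewrite in_itv/= !ltW.
case: F => [[hc hu hv] [hcu hcv huv]]; rewrite /circle_curve !dot_lin.
rewrite (dotC u c) (dotC v c) (dotC v u) ?hc hu hv hcu hcv huv.
rewrite !(mulr0, addr0, add0r, mulr1, subr0, sub0r, oppr0).
set A := (X in X / _); set B := (X in _ / X).
have -> : A = cos r * sin r * (cos t ^+ 2 + sin t ^+ 2).
  by rewrite /A; field; rewrite gt_eqF.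
have -> : B = sin r ^+ 2 * (cos t ^+ 2 + sin t ^+ 2) by rewrite /B; ring.
by rewrite cos2Dsin2 !mulr1; field; rewrite gt_eqF.
Qed.

(** The curvature is the cotangent of [r] in every frame, so a single frame already determines
    [lambda]. *)
Lemma circle_of_curvatureP lambda c r : circle_of_curvature lambda c r <->
  [/\ sphere c, 0 < r < pi & cos r = lambda * sin r].
Proof.
split=> -[sc rpi h]; split=> //.
  have [u u1 [cu _]] := exists_perp c 0.
  have [v F] := exists_frame sc u1 cu.
  have := h _ _ 0 F; rewrite circle_curve_curvature// => <-.
  by rewrite mulfVK// gt_eqF// sin_gt0_pi.
move=> u v t F; rewrite circle_curve_curvature// h mulfK// gt_eqF//.
exact: sin_gt0_pi.
Qed.

(** The cotangent is injective on the open interval from 0 to pi: the two equations make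
    [sin (r1 - r2)] vanish. *)
Lemma circle_of_curvature_radius lambda c1 c2 r1 r2 :
  circle_of_curvature lambda c1 r1 -> circle_of_curvature lambda c2 r2 ->
  r1 = r2.
Proof.
move=> /circle_of_curvatureP[_ r1pi e1] /circle_of_curvatureP[_ r2pi e2].
have s1 := sin_gt0_pi r1pi; have s2 := sin_gt0_pi r2pi.
have : sin (r1 - r2) = 0 by rewrite sinB e1 e2; ring.
case/andP: r1pi r2pi => [a1 a2] /andP[b1 b2].
case: (ltgtP r1 r2) => // r12; last first.
  by move=> /eqP; rewrite gt_eqF// sin_gt0_pi//; lra.
by move=> /eqP; rewrite -oppr_eq0 -sinN gt_eqF// sin_gt0_pi//; lra.
Qed.

Lemma curvature_radius_lt_pihalf lambda r : 0 < lambda -> 0 < r < pi ->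
  cos r = lambda * sin r -> r < pi / 2.
Proof.
move=> l0 rpi e; rewrite ltNge; apply/negP => h.
have : 0 < cos r by rewrite e mulr_gt0// sin_gt0_pi.
rewrite ltNge -cosN -(opprK r) cosN -[- - r](subrK (pi)) .
by have := cos_ge0_pihalf (x := pi - r); rewrite cosB cospi sinpi mul0r addr0 mulN1r oppr_ge0 opprK subrK => -> //; case/andP: rpi => ? ?; lra.
Qed.

End Curvature.

(** * Convex cones and separation *)

Section Convexity.
Context {R : realType}.
Implicit Types (x y z n c u v : 'rV[R]_3) (a b t r lambda : R) (K : set 'rV[R]_3).

Lemma acos_cos_sin (a b : R) : 0 <= b -> a ^+ 2 + b ^+ 2 = 1 ->
  [/\ 0 <= acos a <= pi, cos (acos a) = a & sin (acos a) = b].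
Proof.
move=> b0 ab.
have a1 : -1 <= a <= 1.
  rewrite -ler_norml -ler_sqr ?nnegrE// real_normK ?num_real// expr1n -ab.
  by rewrite lerDl sqr_ge0.
split; first by rewrite acos_ge0//= acos_lepi.
  by rewrite acosK// in_itv.
rewrite sin_acos// -{1}ab -[in X in Num.sqrt X](addrC (b ^+ 2)) addrK.
by rewrite sqrtr_sqr ger0_norm.
Qed.

Lemma sin_eq0_0pi t : 0 <= t <= pi -> sin t = 0 -> t = 0 \/ t = pi.
Proof.
move=> /andP[t0 tpi] st; have [->|t0'] := eqVneq t 0; first by left.
have [->|tpi'] := eqVneq t pi; first by right.
have : 0 < sin t by rewrite sin_gt0_pi// !lt_def t0 tpi t0' eq_sym tpi'.
by rewrite st ltxx.
Qed.

(** The positive multiples of [K] form a convex cone, up to the origin: arcs are traded for linear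
    combinations. Antipodal points are left unconstrained, so this is weaker than
    [geodesically_convex]. *)
Definition cone_closed K := forall x y a b, K x -> K y -> 0 <= a -> 0 <= b ->
  a *: x + b *: y != 0 -> K (unitv (a *: x + b *: y)).

(** The normalized combination lies on the great circle of the given geodesic, at an angle [t] from
    [x]. The sign of [sin (l - t)], proportional to [a * sin l], keeps [t] from exceeding [l]. *)
Lemma geodesically_convex_cone K : geodesically_convex K -> cone_closed K.
Proof.
move=> [Ks Kc] x y a b Kx Ky a0 b0 xy0.
have sx := Ks _ Kx; have sy := Ks _ Ky; rewrite /sphere/= in sx sy.
have [v [l [vv xv /andP[l0 lpi] yE Kl]]] := Kc _ _ Kx Ky.
move: xy0; set z := _ + _ => z0.
have zE : z = (a + b * cos l) *: x + (b * sin l) *: v.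
  by rewrite /z -yE /geodesic; apply: vec3P; rewrite !mxE; ring.
have sl : 0 <= sin l by rewrite sin_ge0_pi// l0.
set A := a + b * cos l in zE; set B := b * sin l in zE.
have B0 : 0 <= B by rewrite mulr_ge0.
have n0 : 0 < nrm z by rewrite nrm_gt0.
have nE : A ^+ 2 + B ^+ 2 = nrm z ^+ 2.
  by rewrite nrm_sqr zE !dot_lin vv sx (dotC v) xv; ring.
have [] := @acos_cos_sin (A / nrm z) (B / nrm z).
- by rewrite divr_ge0// ltW.
- by rewrite !expr_div_n -mulrDl nE divff// expf_neq0// gt_eqF.
set t := acos _ => /andP[t0 tpi] ct st.
have uE : unitv z = geodesic x v t.
  rewrite /geodesic ct st /unitv {2}zE scalerDr !scalerA.
  by rewrite ![(nrm z)^-1 * _]mulrC.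
rewrite uE; apply: Kl; rewrite t0/= leNgt; apply/negP => lt.
have h : 0 <= sin (l - t).
  rewrite sinB ct st.
  have -> : sin l * (A / nrm z) - cos l * (B / nrm z) = a * sin l / nrm z.
    by rewrite /A /B; field; rewrite gt_eqF.
  by rewrite divr_ge0 ?mulr_ge0// ltW.
have h' : sin (t - l) = 0.
  apply/eqP; rewrite eq_le sin_ge0_pi ?andbT; last by apply/andP; split; lra.
  by rewrite -opprB sinN oppr_le0.
have tl0 : 0 <= t - l <= pi by apply/andP; split; lra.
case: (sin_eq0_0pi tl0 h') => tl; first lra.
 have l00 : l = 0 by lra.
have : 0 <= cos t by rewrite ct /A l00 cos0 mulr1 divr_ge0 ?addr_ge0// ltW.
by have -> : t = pi; [lra|rewrite cospi; lra].
Qed.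

(** Distinct non-antipodal points are joined by the arc obtained from orthonormalization, whose
    points are combinations with the nonnegative weights [sin (l - t) / sin l] and [sin t / sin l].
    Antipodal points, on which [cone_closed] is silent, use the third hypothesis. *)
Lemma cone_geodesically_convex K : K `<=` sphere -> cone_closed K ->
  (forall x, K x -> K (- x) -> exists v, [/\ dot v v = 1, dot x v = 0 &
    forall t, 0 <= t <= pi -> K (geodesic x v t)]) ->
  geodesically_convex K.
Proof.
move=> Ks Kc Ka; split=> // x y Kx Ky.
have sx := Ks _ Kx; have sy := Ks _ Ky; rewrite /sphere/= in sx sy.
have [xy1|xy1] := eqVneq (dot x y) 1.
  have xy := dot_unit_eq1 sx sy xy1.
  have [v v1 [xv _]] := exists_perp x 0; exists v, 0; split=> //.
  - by rewrite lexx pi_ge0.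
  - by rewrite /geodesic cos0 sin0 scale0r scale1r addr0.
  - move=> t /le_anti <-.
    by rewrite /geodesic cos0 sin0 scale0r scale1r addr0.
have [xyN1|xyN1] := eqVneq (dot x y) (-1).
  have xy := dot_unit_eqN1 sx sy xyN1.
  have Kx' : K (- x) by rewrite xy opprK.
  have [v [v1 xv Kt]] := Ka _ Kx Kx'; exists v, pi; split=> //.
  - by rewrite pi_ge0 lexx.
  - by rewrite /geodesic cospi sinpi scale0r addr0 scaleN1r xy opprK.
have d1 : dot x y < 1 by rewrite lt_def eq_sym xy1 dot_unit_le1.
have dN1 : -1 < dot x y by rewrite lt_def xyN1 dot_unit_geN1.
have d2 : 0 < 1 - dot x y ^+ 2.
  by rewrite (_ : _ - _ = (1 - dot x y) * (1 + dot x y)); [apply: mulr_gt0; lra|ring].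
pose s := Num.sqrt (1 - dot x y ^+ 2).
have s0 : 0 < s by rewrite sqrtr_gt0.
have s2 : s ^+ 2 = 1 - dot x y ^+ 2 by rewrite sqr_sqrtr// ltW.
pose v := s^-1 *: (y - dot x y *: x).
have [] := @acos_cos_sin (dot x y) s; [exact: ltW|by rewrite s2; ring|].
set l := acos _ => lpi cl sl.
have yE : y = dot x y *: x + s *: v.
  by rewrite /v scalerA divff ?gt_eqF// scale1r addrC subrK.
have vv : dot v v = 1.
  rewrite /v !dot_lin sx sy (dotC y x).
  transitivity (s^-1 ^+ 2 * (1 - dot x y ^+ 2)); first by ring.
  by rewrite -s2 -exprMn mulVf ?expr1n// gt_eqF.
have xv : dot x v = 0 by rewrite /v !dot_lin sx mulr1 subrr mulr0.
clearbody v.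
exists v, l; split=> //; first by rewrite /geodesic cl sl -yE.
move=> t /andP[t0 tl].
have gE : geodesic x v t = (sin (l - t) / s) *: x + (sin t / s) *: y.
  rewrite sinB cl sl /geodesic [X in _ = _ + _ *: X]yE.
  apply: vec3P; rewrite !mxE; field; by rewrite gt_eqF.
have g1 : dot (geodesic x v t) (geodesic x v t) = 1.
  rewrite /geodesic !dot_lin sx vv (dotC v) xv.
  by rewrite -[RHS](cos2Dsin2 t); ring.
rewrite -(unitv_id g1) gE; apply: Kc => //.
- apply: divr_ge0 (ltW s0); apply: sin_ge0_pi.
  by case/andP: lpi => ? ?; apply/andP; split; lra.
- apply: divr_ge0 (ltW s0); apply: sin_ge0_pi.
  by case/andP: lpi => ? ?; apply/andP; split; lra.
- by rewrite -gE unit_neq0.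
Qed.

(** Extracts a first-order condition from a variation of size [e] whose error, after division by
    [e], is linear in [e]. *)
Lemma le0_of_quadratic (A B : R) : (forall e, 0 < e <= 1 -> A <= B * e) -> A <= 0.
Proof.
move=> h; rewrite leNgt; apply/negP => A0.
have B0 : 0 < B by have := h 1; rewrite ltr01 lexx mulr1 => /(_ isT); lra.
have := h (Num.min 1 (A / (B *+ 2))).
rewrite lt_min ltr01 divr_gt0 ?pmulrn_lgt0//= ge_min lexx/= => /(_ isT).
rewrite leNgt => /negP; apply.
apply: (@le_lt_trans _ _ (B * (A / (B *+ 2)))).
  by rewrite ler_pM2l// ge_min lexx orbT.
have -> : B * (A / (B *+ 2)) = A / 2.
  by rewrite -mulr_natr; field; rewrite gt_eqF.
lra.
Qed.

(* If [k] maximizes [dot x] over the convex set [K] and [dot x k = d > 0], then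
   [d k - x] is normal to a great circle separating [x] from [K]. *)
Lemma separation K x : compact K -> K `<=` sphere -> cone_closed K ->
  sphere x -> ~ K x ->
  exists n, (forall k, K k -> 0 <= dot n k) /\ dot n x < 0.
Proof.
move=> Kcp Ks Kc sx nKx; rewrite /sphere/= in sx.
have [K0|K0] := eqVneq K set0.
  exists (- x); split=> [k|]; first by rewrite K0.
  by rewrite dotNl sx oppr_lt0.
have K0' : K !=set0 by exact/set0P.
have [k0 + kmax] := EVT_max_rV K0' Kcp (continuous_subspaceT (@dot_continuous _ x)).
rewrite inE => Kk0.
have {}kmax k : K k -> dot x k <= dot x k0 by move=> Kk; apply: kmax; rewrite inE.
have sk0 := Ks _ Kk0; rewrite /sphere/= in sk0.
have [d0|d0] := leP (dot x k0) 0.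
  exists (- x); split=> [k Kk|]; last by rewrite dotNl sx oppr_lt0.
  by rewrite dotNl oppr_ge0 (le_trans (kmax _ Kk)).
set d := dot x k0 in d0 kmax.
exists (d *: k0 - x); split=> [k Kk|]; last first.
  rewrite !dot_lin sx (dotC k0) -/d.
  have d1 : d < 1.
    rewrite lt_def dot_unit_le1// andbT eq_sym; apply/eqP => d1.
    by apply: nKx; rewrite (dot_unit_eq1 sx sk0 d1).
  have : 0 < (1 - d) * (1 + d) by apply: mulr_gt0; lra.
  lra.
rewrite !dot_lin -[leRHS]opprK oppr_ge0 opprB.
have sk := Ks _ Kk; rewrite /sphere/= in sk.
apply: (@le0_of_quadratic _ (d / 2)) => e /andP[e0 e1].
(* Here [k] is antipodal to [k0] and the variation cannot be normalized, but the left-hand side is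
   then 0. *)
have [z0|z0] := eqVneq (k0 + e *: k) 0.
  have : dot (k0 + e *: k) x = 0 by rewrite z0 dot0l.
  rewrite !dot_lin (dotC k0) (dotC k) -/d => h1.
  have := congr1 (fun w : 'rV[R]_3 => dot w k0) z0; rewrite /= !dot_lin dot0l sk0 (dotC k) => h2.
  have : (dot x k - d * dot k0 k) * e = 0.
    transitivity ((d + e * dot x k) - d * (1 + e * dot k0 k)); first by ring.
    by rewrite h1 h2 mulr0 subrr.
  move/eqP; rewrite mulf_eq0 (gt_eqF e0) orbF => /eqP ->.
  by apply: mulr_ge0; lra.
have := kmax _ (Kc _ _ 1 e Kk0 Kk ler01 (ltW e0) _).
rewrite scale1r => /(_ z0); rewrite dotZr mulrC ler_pdivrMr ?nrm_gt0// !dot_lin -/d.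
have nle : nrm (k0 + e *: k) <= 1 + e * dot k0 k + e ^+ 2 / 2.
  have p : 0 <= 1 + e * dot k0 k + e ^+ 2 / 2.
    have := dot_unit_geN1 sk0 sk => h.
    have : e * (-1) <= e * dot k0 k by rewrite ler_pM2l.
    by have := sqr_ge0 e; lra.
  rewrite le_nrm// !dot_lin sk0 sk (dotC k).
  have := sqr_ge0 (e * dot k0 k + e ^+ 2 / 2); lra.
move=> h; have := le_trans h (ler_wpM2l (ltW d0) nle) => h'.
rewrite -(@ler_pM2r _ e)//.
have -> : d / 2 * e * e = d * (e ^+ 2 / 2) by ring.
lra.
Qed.

End Convexity.

(** * Rolling a disk inside a concave body *)

Section Rolling.
Context {R : realType}.
Implicit Types (x y z n c u v b d m : 'rV[R]_3) (a t r k : R) (K : set 'rV[R]_3).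

Definition dual_cone K : set 'rV[R]_3 := [set n | forall x, K x -> 0 <= dot n x].
Definition strict_dual K : set 'rV[R]_3 := [set n | forall x, K x -> 0 < dot n x].

(** The curvature bound enters the rest of the proof only through the radius [r], which is common to
    all barrier circles. *)
Definition inner_barrier r K := forall p, sphere_boundary K p ->
  exists c U, [/\ dot c c = 1, dot c p = cos r, nbhs p U &
    forall x, U x -> dot x x = 1 -> cos r <= dot c x -> K x].

Lemma cvg_line (F : set_system R) {FF : Filter F} x v :
  (t @[t --> F] --> (0 : R)) -> (x + t *: v) @[t --> F] --> x.
Proof.
move=> F0; have : (x + t *: v) @[t --> F] --> x + 0 *: v.
  by apply: cvgD; [exact: cvg_cst|exact: cvgZr_tmp].
by rewrite scale0r addr0.
Qed.

Lemma cvg_right0 : (t @[t --> (0:R)^'+] --> (0 : R)).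
Proof. by apply: cvg_at_right_filter; exact: cvg_id. Qed.

Lemma near_line x v (U : set 'rV[R]_3) : nbhs x U ->
  \forall t \near (0:R)^'+, U (x + t *: v).
Proof. by move=> xU; exact: (cvg_line v cvg_right0 xU). Qed.

Lemma near_unit_line x v (U : set 'rV[R]_3) : dot x x = 1 -> nbhs x U ->
  \forall t \near (0:R)^'+, U (unitv (x + t *: v)).
Proof.
move=> x1 xU; have : unitv (x + t *: v) @[t --> (0:R)^'+] --> unitv x.
  by apply: unitv_cvg; [exact: unit_neq0|exact: (cvg_line v cvg_right0)].
by rewrite (unitv_id x1); apply.
Qed.

Lemma ex_right (P : R -> Prop) e : 0 < e -> (\forall t \near (0:R)^'+, P t) ->
  exists t, [/\ 0 < t, t < e & P t].
Proof.
move=> e0 nP; have : \forall t \near (0:R)^'+, [/\ 0 < t, t < e & P t].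
  near=> t; split; near: t => //; [exact: nbhs_right_gt|exact: nbhs_right_lt].
by move=> /filter_ex.
Unshelve. all: by end_near.
Qed.

(** Any small step from [p] along [- n] leaves [K]. *)
Lemma supported_boundary K p n : K `<=` sphere -> K p -> dot n n = 1 ->
  dual_cone K n -> dot n p = 0 -> sphere_boundary K p.
Proof.
move=> Ks Kp n1 Kn np; have p1 := Ks _ Kp; rewrite /sphere/= in p1.
split; first exact: subset_closure.
move=> B /(near_unit_line (- n) p1)/(ex_right ltr01)[t [t0 t1 Bt]].
exists (unitv (p + t *: - n)); split=> //.
have z0 : p + t *: - n != 0.
  apply/eqP => /(congr1 (dot n)).
  rewrite !dot_lin np n1 dot0r; lra.
split; first exact: unitv1.
move=> /Kn; rewrite dot_unitvr_ge0// !dot_lin np n1; lra.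
Qed.

Lemma dual_interior K p b : K `<=` sphere -> sphere_interior K p ->
  dot b b = 1 -> dual_cone K b -> 0 < dot b p.
Proof.
move=> Ks [p1 Up] b1 Kb; rewrite /sphere/= in p1.
have Kp : K p by exact: (nbhs_singleton Up).
rewrite lt_def Kb// andbT; apply/eqP => bp.
have [t [t0 t1 /= Kt]] := ex_right ltr01 (near_unit_line (- b) p1 Up).
have z0 : p + t *: - b != 0.
  apply/eqP => /(congr1 (dot b)).
  rewrite !dot_lin bp b1 dot0r; lra.
have /Kb : K (unitv (p + t *: - b)) by apply: Kt; exact: unitv1.
rewrite dot_unitvr_ge0// !dot_lin bp b1; lra.
Qed.

(** By compactness [n] has a positive minimum [d] on [K], and a change of [n] by less than [d] in
    norm keeps it positive. *)
Lemma strict_dual_nbhs K n : K `<=` sphere -> compact K -> strict_dual K n ->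
  nbhs n (strict_dual K).
Proof.
move=> Ks Kc Kn; have [K0|K0] := eqVneq K set0.
  by apply: filterS filterT => z _ x; rewrite K0.
have /set0P K0' := K0.
have [k0 + kmin] := EVT_min_rV K0' Kc (continuous_subspaceT (@dot_continuous _ n)).
rewrite inE => Kk0; have d0 := Kn _ Kk0; set d := dot n k0 in d0.
have d20 : 0 < d ^+ 2 by rewrite exprn_gt0.
apply: filterS (dot_ball_nbhs n d20) => z /= zn x Kx.
have x1 := Ks _ Kx; rewrite /sphere/= in x1.
have : dot (n - z) x < d.
  apply: le_lt_trans (dot_le_nrm _ _) _.
  rewrite (nrm1 x1) mulr1 -ltr_sqr ?nnegrE ?nrm_ge0 ?ltW// nrm_sqr.
  by rewrite -[X in dot X _]opprB -[X in dot _ X]opprB !(dotNl, dotNr) opprK.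
have : d <= dot n x by apply: kmin; rewrite inE.
rewrite dotBl; lra.
Qed.

Section rolling.
Variables (K : set 'rV[R]_3) (r : R).
Hypotheses (Ks : K `<=` sphere) (Kcp : compact K).
Hypothesis Kbar : inner_barrier r K.
Hypothesis r_bnd : 0 < r < pi / 2.
Hypothesis Kint : sphere_interior K !=set0.

Let sg := sin r.
Let tau := cos r.

Let sg0 : 0 < sg. Proof. by rewrite sin_gt0_pihalf. Qed.

Let tau0 : 0 < tau.
Proof. by rewrite cos_gt0_pihalf//; case/andP: r_bnd => ? ?; apply/andP; split; lra. Qed.

Let ts : tau ^+ 2 + sg ^+ 2 = 1. Proof. exact: cos2Dsin2. Qed.

Local Ltac narrow := clear - K r Ks Kcp Kbar r_bnd Kint sg tau sg0 tau0 ts.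

(** The barrier condition does not tell where its disk is centered, but the support vector [n]
    forces it. If the center [c] were another one, moving from [p] along the difference of the
    tangential parts would enter the barrier disk to first order and leave the half-space of [n]. *)
Lemma barrier_center p n : K p -> dot n n = 1 -> dual_cone K n -> dot n p = 0 ->
  exists2 U, nbhs p U & forall x, U x -> dot x x = 1 ->
    tau <= dot (tau *: p + sg *: n) x -> K x.
Proof.
move=> Kp n1 Kn np; have p1 := Ks Kp; rewrite /sphere/= in p1.
have [c [U [c1 cp pU UK]]] := Kbar (supported_boundary Ks Kp n1 Kn np).
suff -> : tau *: p + sg *: n = c by exists U.
pose w := c - tau *: p.
have pw : dot p w = 0 by rewrite /w !dot_lin p1 dotC cp; rewrite -/tau; ring.
have ww : dot w w = sg ^+ 2.
  have -> : sg ^+ 2 = 1 - tau ^+ 2 by rewrite -ts; ring.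
  rewrite /w !dot_lin p1 c1 (dotC p) cp -/tau; ring.
have cE : c = tau *: p + w by rewrite addrC subrK.
rewrite cE; congr (_ + _); apply/eqP; rewrite eq_sym -subr_eq0 -dot_eq0.
clearbody w.
set v := w - sg *: n; apply/negPn/negP => v0'.
have v0 : 0 < dot v v by rewrite lt_def v0' dot_ge0.
have vvE : dot v v = 2 * sg * (sg - dot w n).
  by rewrite /v !dot_lin ww n1 (dotC n); ring.
have a0 : 0 < sg - dot w n by move: v0; rewrite vvE pmulr_rgt0// mulr_gt0.
have nv : dot n v = dot w n - sg by rewrite /v !dot_lin n1 (dotC n); ring.
have pv : dot p v = 0 by rewrite /v !dot_lin pw (dotC p n) np; ring.
have wv : dot w v = sg * (sg - dot w n) by rewrite /v !dot_lin ww; ring.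
clearbody v.
have [t [t0 t1 Ut]] := ex_right ltr01 (near_unit_line v p1 pU).
have nz : dot n (p + t *: v) < 0.
  rewrite !dot_lin np nv add0r; have : 0 < t * (sg - dot w n) by exact: mulr_gt0.
  lra.
have z0 : p + t *: v != 0 by apply: contraTN nz => /eqP ->; rewrite dot0r ltxx.
have : K (unitv (p + t *: v)).
  apply: UK => //; first exact: unitv1.
  rewrite dotZr mulrC ler_pdivlMr ?nrm_gt0//.
  have nle : nrm (p + t *: v) <= 1 + t ^+ 2 * dot v v / 2.
    have p0 : 0 <= t ^+ 2 * dot v v / 2.
      by rewrite divr_ge0// mulr_ge0 ?sqr_ge0 ?dot_ge0.
    rewrite le_nrm; last by lra.
    rewrite !dot_lin p1 (dotC v) pv.
    have := sqr_ge0 (t ^+ 2 * dot v v / 2); lra.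
  apply: le_trans (ler_wpM2l (ltW tau0) nle) _.
  have -> : dot c (p + t *: v) = tau + t * (sg * (sg - dot w n)).
    rewrite cE !dot_lin p1 (dotC w p) pw pv wv; ring.
  rewrite vvE.
  have -> : tau * (1 + t ^+ 2 * (2 * sg * (sg - dot w n)) / 2) =
     tau + t * (sg * (sg - dot w n)) * (t * tau) by field.
  rewrite lerD2l; apply: ler_piMr.
    by rewrite !mulr_ge0// ltW.
  by apply: mulr_ile1; [exact: ltW|exact: ltW|exact: ltW|exact: cos_le1].
by move=> /Kn; rewrite dot_unitvr_ge0// leNgt nz.
Qed.

(** A vector [n] is tested at the point [x n] of the disk about [c] where it is smallest. As [n]
    tends to [b] this point tends to [z], so it lies where the disk is known to be inside [K], and
    nonnegativity there is the claim. Geometrically, the dual lies near [b] in the circular cone of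
    angular radius pi/2 - r about [c]. *)
Lemma dual_local b z : K z -> dot b b = 1 -> dual_cone K b -> dot b z = 0 ->
  \forall n \near b, dual_cone K n -> sg * nrm n <= dot n (tau *: z + sg *: b).
Proof.
move=> Kz b1 Kb bz; have z1 := Ks Kz; rewrite /sphere/= in z1.
have [U zU UK] := barrier_center Kz b1 Kb bz.
set c := tau *: z + sg *: b in UK *.
have c1 : dot c c = 1.
  by rewrite /c !dot_lin z1 b1 (dotC z) bz -[RHS]ts; ring.
have bc : dot b c = sg by rewrite /c !dot_lin b1 bz; ring.
pose y n := n - dot n c *: c.
pose x n := tau *: c - sg *: unitv (y n).
have yb : y b = tau *: (tau *: b - sg *: z).
  rewrite /y bc /c; apply: vec3P; rewrite !mxE;
  rewrite -[X in X - _]mul1r -ts; ring.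
have yb0 : y b != 0.
  rewrite yb scaler_eq0 (gt_eqF tau0)/=; apply/eqP => /(congr1 (dot b)).
  by rewrite !dot_lin b1 bz dot0r; rewrite mulr1 mulr0 subr0 => /eqP; rewrite (gt_eqF tau0).
have xb : x b = z.
  have e : dot (tau *: b - sg *: z) (tau *: b - sg *: z) = 1.
    by rewrite !dot_lin b1 z1 (dotC z) bz -[RHS]ts; ring.
  rewrite /x yb unitvZ// unitv_id// /c; apply: vec3P; rewrite !mxE;
  rewrite -[RHS]mul1r -ts; ring.
have cy : y n @[n --> b] --> y b.
  apply: (@cvgB _ _ _ (nbhs b) _ id (fun n => dot n c *: c) b _ cvg_id).
  apply: (@cvgZr_tmp _ _ _ (nbhs b)).
  exact: (@cvg_dot _ _ (nbhs b) _ id (cst c) b c cvg_id (cvg_cst _)).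
have cx : x n @[n --> b] --> z.
  rewrite -xb; apply: (@cvgB _ _ _ (nbhs b) _ (cst (tau *: c))); first exact: (cvg_cst _).
  by apply: (@cvgZl_tmp _ _ _ (nbhs b)); exact: unitv_cvg.
have ny0 : \forall n \near b, y n != 0.
  have : open [set w : 'rV[R]_3 | w != 0].
    rewrite openE => w /= w0; have w20 : 0 < dot w w by rewrite dot_gt0.
    apply: filterS (dot_ball_nbhs w w20) => w' /=; apply: contraTN => /eqP ->.
    by rewrite sub0r !(dotNl, dotNr) opprK ltxx.
  by rewrite openE => /(_ _ yb0) /cy.
have nU : \forall n \near b, U (x n) by exact: cx.
apply: filterS2 ny0 nU => n yn0 Uxn Kn.
clear yb yb0 xb cy cx; clearbody c.
have cyn : dot c (y n) = 0 by rewrite /y !dot_lin c1 (dotC c); ring.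
have uy1 := unitv1 yn0.
have cuy : dot c (unitv (y n)) = 0 by rewrite dotZr cyn mulr0.
have x1 : dot (x n) (x n) = 1.
  rewrite /x; move: (unitv (y n)) uy1 cuy => u uy1 cuy.
  by rewrite !dot_lin c1 uy1 (dotC u) cuy -[RHS]ts; ring.
have cxn : dot c (x n) = tau by rewrite /x; move: (unitv (y n)) cuy => u cuy; rewrite !dot_lin c1 cuy; ring.
have /Kn : K (x n) by apply: UK => //; rewrite cxn.
have yy : dot (y n) (y n) = dot n n - dot n c ^+ 2.
  by rewrite /y !dot_lin c1 (dotC c); ring.
have nuy : dot n (unitv (y n)) = nrm (y n).
  have -> : dot n (unitv (y n)) = dot (y n) (unitv (y n)).
    by rewrite [X in _ = dot X _]/y dotBl dotZl cuy mulr0 subr0.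
  by rewrite dotZr -nrm_sqr expr2 mulrA mulVf ?mul1r// gt_eqF// nrm_gt0.
rewrite /x dotBr (dotZr tau) (dotZr sg) nuy => h.
have nc0 : 0 <= dot n c.
  have : 0 <= sg * nrm (y n) by rewrite mulr_ge0 ?nrm_ge0// ltW.
  by move=> h'; rewrite -(@pmulr_rge0 _ tau)//; lra.
rewrite -ler_sqr ?nnegrE ?mulr_ge0 ?nrm_ge0 ?(ltW sg0)// exprMn nrm_sqr.
have : (sg * nrm (y n)) ^+ 2 <= (tau * dot n c) ^+ 2.
  rewrite ler_sqr ?nnegrE ?mulr_ge0 ?nrm_ge0 ?(ltW sg0) ?(ltW tau0)//; lra.
rewrite !exprMn nrm_sqr yy (_ : tau ^+ 2 = 1 - sg ^+ 2); last by rewrite -ts addrK.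
lra.
Qed.

Lemma cvg_cross {T : Type} (F : set_system T) {FF : Filter F} (f g : T -> 'rV[R]_3)
    x y : f @ F --> x -> g @ F --> y ->
  cross (f t) (g t) @[t --> F] --> cross x y.
Proof.
move=> fx gy.
have co (h : T -> 'rV[R]_3) z i : h @ F --> z -> h t 0 i @[t --> F] --> z 0 i.
  by move=> hz; exact: (cvg_comp _ _ hz (@coord_continuous R 1 3 0 i z)).
have E u v : cross u v =
    (u 0 i1 * v 0 i2 - u 0 i2 * v 0 i1) *: vec3 1 0 0 +
    (u 0 i2 * v 0 i0 - u 0 i0 * v 0 i2) *: vec3 0 1 0 +
    (u 0 i0 * v 0 i1 - u 0 i1 * v 0 i0) *: vec3 0 0 1.
  by apply: vec3P; rewrite !mxE/=; ring.
rewrite E; under eq_fun do rewrite E.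
apply: cvgD; [apply: cvgD|]; apply: cvgZr_tmp; apply: cvgB; apply: cvgM; exact: co.
Qed.

(* Averaging the two points of the circle at angles [e] and [- e] from [z0]
   cancels the first order term, leaving only the comparison of the radii. *)
Lemma touching_circle d z0 x0 k : K x0 -> dot z0 z0 = 1 -> dual_cone K z0 ->
  dot z0 x0 = 0 -> dot d z0 = k -> 0 <= k -> k ^+ 2 < sg ^+ 2 * dot d d ->
  (\forall z \near z0, dot z z = 1 -> dot d z = k -> dual_cone K z) -> False.
Proof.
move=> Kx0 z01 Kz0 z0x0 dz0 k0 kD near_dual.
have D0 : 0 < dot d d.
  rewrite dot_gt0; apply: contraTN kD => /eqP ->.
  by rewrite dot0l mulr0 -leNgt sqr_ge0.
have nloc := dual_local Kx0 z01 Kz0 z0x0.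
set c := tau *: x0 + sg *: z0 in nloc.
have x01 : dot x0 x0 = 1 := Ks Kx0.
have c1 : dot c c = 1.
  by rewrite /c !dot_lin x01 z01 (dotC x0) z0x0 -[RHS]ts; ring.
have zc : dot z0 c = sg by rewrite /c !dot_lin z01 z0x0; ring.
clearbody c.
pose D := dot d d; pose w := (Num.sqrt D)^-1 *: cross d z0.
(* The circle cut out by the plane [dot d z = k], parametrized by rotation about [d] and passing
   through [z0] at 0. *)
pose g (e : R) := (k / D) *: d + cos e *: (z0 - (k / D) *: d) + sin e *: w.
have wd : dot w d = 0 by rewrite dotZl dot_crossl mulr0.
have wz : dot w z0 = 0 by rewrite dotZl dot_crossr mulr0.
have ww : dot w w = 1 - k ^+ 2 / D.
  rewrite /w dotZl dotZr dot_cross_cross z01 (dotC z0) dz0 -/D mulrA -expr2.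
  rewrite exprVn sqr_sqrtr ?(ltW D0)//.
  by rewrite mulr1 mulrBr mulVf ?gt_eqF// expr2 mulrC.
clearbody w.
have g1 e : dot (g e) (g e) = 1.
  have : dot (g e) (g e) = k ^+ 2 / D + (cos e ^+ 2 + sin e ^+ 2) * (1 - k ^+ 2 / D).
    rewrite /g !dot_lin ww wd wz (dotC d w) (dotC z0 w) wd wz z01 (dotC z0 d) dz0 -/D.
    by field; rewrite gt_eqF.
  by rewrite cos2Dsin2 mul1r addrC subrK.
have gd e : dot d (g e) = k.
  by rewrite /g !dot_lin (dotC d w) wd dz0 -/D; field; rewrite gt_eqF.
have cg (s : R) : g (s * e) @[e --> (0 : R)^'+] --> z0.
  have {1}-> : z0 = g 0 by rewrite /g cos0 sin0 scale0r addr0 scale1r addrC subrK.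
  have s0 : s * e @[e --> (0 : R)^'+] --> (0 : R).
    by rewrite -[X in _ --> X](mulr0 s); apply: cvgM; [exact: cvg_cst|exact: cvg_right0].
  have cs : cos (s * e) @[e --> (0 : R)^'+] --> cos (0:R).
    exact: (cvg_comp _ _ s0 (@continuous_cos R 0)).
  have sn : sin (s * e) @[e --> (0 : R)^'+] --> sin (0:R).
    exact: (cvg_comp _ _ s0 (@continuous_sin R 0)).
  by apply: cvgD; [apply: cvgD; [exact: cvg_cst|]|]; apply: cvgZr_tmp.
have gc (s : R) : \forall e \near (0 : R)^'+, sg <= dot (g (s * e)) c.
  have h1 : \forall e \near (0 : R)^'+, dot (g (s * e)) (g (s * e)) = 1 ->
      dot d (g (s * e)) = k -> dual_cone K (g (s * e)) by exact: (cg s _ near_dual).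
  have h2 : \forall e \near (0 : R)^'+, dual_cone K (g (s * e)) ->
      sg * nrm (g (s * e)) <= dot (g (s * e)) c by exact: (cg s _ nloc).
  apply: filterS2 h1 h2 => e /(_ (g1 _) (gd _)) dg /(_ dg).
  by rewrite (nrm1 (g1 _)) mulr1.
have pi0 : 0 < pi :> R := pi_gt0 R.
have [e [e0 epi [h1 h2]]] := ex_right pi0 (filterI (gc 1) (gc (-1))).
have ce : cos e < 1.
  rewrite -cos0 ltr_cos ?in_itv/= ?e0// ?lexx ?(ltW e0) ?(ltW epi) ?pi_ge0//.
move: h1 h2; rewrite mul1r mulN1r /g cosN sinN !dot_lin zc => h1 h2.
have h3 : sg * (1 - cos e) <= (k / D * dot d c) * (1 - cos e) by lra.
have {}h3 : sg <= k / D * dot d c by rewrite -(@ler_pM2r _ (1 - cos e))// subr_gt0.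
(* The right-hand side is the cosine of the radius of the circle, which was assumed smaller than
   [sg]. *)
have h4 : sg <= k / D * Num.sqrt D.
  apply: le_trans h3 _; apply: ler_wpM2l; first by rewrite divr_ge0// ltW.
  by apply: le_trans (dot_le_nrm _ _) _; rewrite (nrm1 c1) mulr1.
have : sg ^+ 2 <= (k / D * Num.sqrt D) ^+ 2.
  by rewrite ler_sqr ?nnegrE// ?(ltW sg0)// (le_trans (ltW sg0)).
rewrite exprMn sqr_sqrtr ?(ltW D0)// leNgt => /negP; apply.
rewrite expr_div_n -(@ltr_pM2r _ D)//.
by have -> : k ^+ 2 / D ^+ 2 * D * D = k ^+ 2; [field; rewrite gt_eqF|].
Qed.

(** Scaled so that its product with both [x] and [y] is 1: on the plane of [x] and [y], the chord
    between them is where this product is at least 1 for unit vectors. *)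
Definition lens_axis x y := (1 + dot x y)^-1 *: (x + y).
Definition lens_normal x y := (Num.sqrt (1 - dot x y ^+ 2))^-1 *: cross x y.

(* The half lens cut out by the plane through [n1], [n2] and the arc of a
   circle through [n1], [n2].  The arcs sweep it; the first one to leave
   [strict_dual K] touches the boundary of the dual from inside. *)
Lemma half_lens n1 n2 k z : dot n1 n1 = 1 -> dot n2 n2 = 1 ->
  -1 < dot n1 n2 < 1 -> strict_dual K n1 -> strict_dual K n2 -> 0 < k ->
  k ^+ 2 * (1 + dot n1 n2 - 2 * sg ^+ 2) < sg ^+ 2 * (1 + dot n1 n2) ->
  dot z z = 1 -> 0 <= dot (lens_normal n1 n2) z ->
  dot (lens_normal n1 n2) z <= k * (dot (lens_axis n1 n2) z - 1) ->
  dual_cone K z.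
Proof.
move=> n11 n21 /andP[gN1 g1] Kn1 Kn2 k0 kb.
set e := lens_axis n1 n2; set l := lens_normal n1 n2; set g := dot n1 n2 in gN1 g1 kb.
have g10 : 0 < 1 + g by lra.
have g2 : 0 < 1 - g ^+ 2.
  by rewrite (_ : _ - _ = (1 - g) * (1 + g)); [apply: mulr_gt0; lra|ring].
have ee : dot e e = 2 / (1 + g).
  rewrite /e /lens_axis !dot_lin n11 n21 (dotC n2) -/g; field; lra.
have el : dot e l = 0.
  rewrite /e /lens_axis /l /lens_normal !dot_lin !(dotC _ (cross _ _)).
  by rewrite dot_crossl dot_crossr; ring.
have ll : dot l l = 1.
  rewrite /l /lens_normal dotZl dotZr dot_cross_cross n11 n21 (dotC n2) -/g.
  rewrite mulrA -expr2 exprVn sqr_sqrtr ?(ltW g2)// mulr1 -expr2 mulVf//.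
  by rewrite gt_eqF.
have e1 : 1 < dot e e by rewrite ee ltr_pdivlMr//; lra.
have ne : nrm e < dot e e.
  rewrite -nrm_sqr expr2 ltr_pMr ?nrm_gt0; last by rewrite -dot_gt0; lra.
  by rewrite -[1]sqrtr1 ltr_sqrt//; lra.
(* the chord of the lens lies in the strict dual *)
have chord y : dot y y = 1 -> dot l y = 0 -> 1 <= dot e y -> strict_dual K y.
  move=> y1 ly ey.
  have cy : dot (cross n1 n2) y = 0.
    move/eqP: ly; rewrite /l /lens_normal dotZl mulf_eq0 invr_eq0 gt_eqF ?sqrtr_gt0//.
    by move=> /eqP.
  pose s1 := (dot n1 y - g * dot n2 y) / (1 - g ^+ 2).
  pose s2 := (dot n2 y - g * dot n1 y) / (1 - g ^+ 2).
  have yE : y = s1 *: n1 + s2 *: n2.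
    have : dot (cross n1 n2) (cross n1 n2) *: y =
      (dot y n1 * dot n2 n2 - dot y n2 * dot n1 n2) *: n1 +
      (dot y n2 * dot n1 n1 - dot y n1 * dot n1 n2) *: n2 +
      dot (cross n1 n2) y *: cross n1 n2.
      by apply: vec3P; rewrite !dotE !mxE /=; ring.
    rewrite cy scale0r addr0 dot_cross_cross n11 n21 (dotC n2) -/g !(dotC y).
    move/(congr1 (fun v => (1 - g ^+ 2)^-1 *: v)).
    rewrite scalerDr !scalerA !mulr1 -expr2 mulVf ?gt_eqF// scale1r => {1}->.
    by congr (_ *: _ + _ *: _); rewrite /s1 /s2; ring.
  clearbody s1 s2.
  have es : dot e y = s1 + s2.
    by rewrite yE /e /lens_axis !dot_lin n11 n21 (dotC n2) -/g; field; lra.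
  have ys : s1 ^+ 2 + s2 ^+ 2 + 2 * s1 * s2 * g = 1.
    by rewrite -[RHS]y1 yE !dot_lin n11 n21 (dotC n2) -/g; ring.
  rewrite es in ey.
  have p12 : 0 <= s1 * s2.
    have : 0 <= 2 * (1 - g) * (s1 * s2).
      have : 1 <= (s1 + s2) ^+ 2 by rewrite -[1](expr1n _ 2) ler_sqr ?nnegrE// (le_trans ler01).
      by move: ys; narrow; lra.
    by rewrite pmulr_rge0//; move: g1; narrow; lra.
  have s10 : 0 <= s1.
    rewrite leNgt; apply/negP => s1n; have : s2 <= 0 by rewrite -(nmulr_rge0 _ s1n).
    by move: s1n ey; narrow; lra.
  have s20 : 0 <= s2.
    rewrite leNgt; apply/negP => s2n; have : s1 <= 0 by rewrite -(nmulr_lge0 _ s2n).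
    by move: s2n ey; narrow; lra.
  move=> x Kx; rewrite yE !dot_lin.
  have h1 := Kn1 _ Kx; have h2 := Kn2 _ Kx.
  have [s1p|s1n] := ltP 0 s1.
    by apply: ltr_wpDr; [apply: mulr_ge0 => //; exact: ltW|exact: mulr_gt0].
  by apply: ltr_wpDl; [apply: mulr_ge0 => //; exact: ltW|apply: mulr_gt0 => //; move: s1n ey; narrow; lra].
clearbody e l.
move=> z1 lz0 lz; apply: contrapT => nKz.
pose Y := [set y | [/\ dot y y = 1, ~ strict_dual K y, 0 <= dot l y &
   0 <= dot (k *: e - l) y - k]].
have Yz : Y z.
  split=> //; first by move=> h; apply: nKz => x /h/ltW.
  by rewrite !dot_lin subr_ge0 lerBrDr; move: lz; narrow; lra.
have Ycp : compact Y.
  apply: compact_sub_sphere; first by move=> y [].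
  have -> : Y = sphere `&` ~` (strict_dual K)^° `&` [set y | 0 <= dot l y] `&`
      [set y | k <= dot (k *: e - l) y].
    apply/seteqP; split=> y.
      move=> [y1 ny ly ky]; split; last by rewrite /= -subr_ge0.
      split=> //; split=> //; apply: contra_not ny; exact: interior_subset.
    move=> [[[y1 ny] ly]]; rewrite /= -subr_ge0 => ky; split=> //.
    by apply: contra_not ny => h; exact: strict_dual_nbhs.
  apply: closedI; last exact: closed_halfspace.
  apply: closedI; last exact: closed_halfspace.
  apply: closedI; first exact: closed_sphere.
  by apply: open_closedC; exact: open_interior.
have Ye y : Y y -> 0 < dot e y - 1 /\ 0 < dot l y.
  move=> [y1 ny ly]; rewrite !dot_lin => ky.
  have ey : 0 <= k * (dot e y - 1) by move: ky ly; narrow; lra.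
  rewrite pmulr_rge0// in ey.
  have l0 : 0 < dot l y.
    rewrite lt_def ly andbT; apply/eqP => l0; by apply: ny; apply: chord; rewrite // -subr_ge0.
  split=> //; rewrite lt_def ey andbT; apply/eqP => e0; move: ky.
  have -> : dot e y = 1 by apply/esym/eqP; rewrite -subr_eq0 -oppr_eq0 opprB e0.
  by move: l0; narrow; lra.
(* [f y] is the parameter of the arc through [n1], [n2] and [y]; its minimizer lies on the first arc
   that meets the complement of the strict dual. *)
pose f y := dot l y / (dot e y - 1).
have fcont : {within Y, continuous f}.
  apply: continuous_in_subspaceT => y /set_mem Yy.
  apply: (cvgM (@dot_continuous R l y)).
  apply: cvgV; first by rewrite gt_eqF// (Ye _ Yy).1.
  by apply: (cvgB (@dot_continuous R e y)); exact: (cvg_cst _).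
have [z0 + zmin] := EVT_min_rV (ex_intro _ z Yz) Ycp fcont.
rewrite inE => Yz0; have [ez0 lz0'] := Ye _ Yz0; have [z01 nz0 _ kz0] := Yz0.
pose k0' := f z0.
have k0'0 : 0 < k0' by rewrite divr_gt0.
have lk : dot l z0 = k0' * (dot e z0 - 1) by rewrite /k0' /f mulfVK// gt_eqF.
have k0'k : k0' <= k.
  by rewrite /k0' /f ler_pdivrMr//; move: kz0; rewrite !dot_lin; narrow; lra.
clearbody k0'.
(* The whole first arc stays in the dual: pushing one of its points along [e] lowers the parameter
   strictly, so by minimality the pushed point is in the strict dual, and the push can be made
   arbitrarily small. *)
have arc y : dot y y = 1 -> 0 < dot l y -> dot (k0' *: e - l) y = k0' -> dual_cone K y.
  move=> y1 ly dy.
  have lyE : dot l y = k0' * (dot e y - 1) by move: dy; rewrite !dot_lin; narrow; lra.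
  have ey : 0 < dot e y - 1 by rewrite -(pmulr_rgt0 _ k0'0) -lyE.
  have step t : 0 < t -> strict_dual K (y + t *: e).
    move=> t0; apply: contrapT => ns.
    have w0 : y + t *: e != 0.
      apply/eqP => /(congr1 (dot l)); rewrite !dot_lin (dotC l e) el dot0r mulr0 addr0 => l0.
      by move: ly; rewrite l0 ltxx.
    have wn := nrm_gt0 (y + t *: e); rewrite w0 in wn.
    set w := y + t *: e in ns w0 wn.
    have lw : dot l w = dot l y by rewrite /w !dot_lin (dotC l e) el; ring.
    have ew : dot e y - 1 < dot e w - nrm w.
      have : nrm w <= 1 + t * nrm e.
        by rewrite (le_trans (nrmD _ _))// (nrm1 y1) nrmZ// ltW.
      have : t * nrm e < t * dot e e by rewrite ltr_pM2l.
      by rewrite /w !dot_lin; narrow; lra.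
    clearbody w.
    have ew0 : 0 < dot e w / nrm w - 1.
      by rewrite subr_gt0 ltr_pdivlMr// mul1r -subr_gt0 (lt_trans ey).
    have Yw : Y (unitv w).
      split.
      - exact: unitv1.
      - apply: contra_not ns => h x Kx.
        by rewrite (unitvE w) dotZl mulr_gt0// h.
      - by rewrite dot_unitvr_ge0// lw ltW.
      rewrite (dotZr (nrm w)^-1) !dot_lin lw.
      have -> : (nrm w)^-1 * (k * dot e w - dot l y) - k =
         (nrm w)^-1 * (k * (dot e w - nrm w) - dot l y) by field; rewrite gt_eqF.
      rewrite mulr_ge0 ?invr_ge0 ?(ltW wn)// lyE subr_ge0.
      apply: (@le_trans _ _ (k * (dot e y - 1))).
        by rewrite ler_pM2r.
      by rewrite ler_pM2l// ltW.
    have := zmin (unitv w); rewrite inE => /(_ Yw).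
    have {1}-> : f z0 = k0' by rewrite /f lk mulfK// gt_eqF.
    rewrite /f !(dotZr (nrm w)^-1) leNgt => /negP; apply.
    have ew0' : 0 < (nrm w)^-1 * dot e w - 1 by rewrite mulrC.
    rewrite ltr_pdivrMr// lw lyE.
    have -> : (nrm w)^-1 * (k0' * (dot e y - 1)) = k0' * ((nrm w)^-1 * (dot e y - 1)).
      by ring.
    rewrite ltr_pM2l//.
    have -> : (nrm w)^-1 * dot e w - 1 = (nrm w)^-1 * (dot e w - nrm w).
      by field; rewrite gt_eqF.
    by rewrite ltr_pM2l// invr_gt0.
  move=> x Kx; rewrite leNgt; apply/negP => yx.
  have yx0 : 0 < - dot y x by rewrite oppr_gt0.
  have q0 : 0 < `|dot e x| + 1 by rewrite ltr_wpDl.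
  (* With a push of this size the product with [x] remains nonpositive, against [step]. *)
  have t0 : 0 < - dot y x / (`|dot e x| + 1) by rewrite divr_gt0.
  have := step _ t0 _ Kx; rewrite !dot_lin ltNge => /negP; apply.
  rewrite -[leRHS](subrr (dot y x)) lerD2l mulrAC ler_pdivrMr// ler_pM2l//.
  by have := ler_norm (dot e x); narrow; lra.
have Kz0 : dual_cone K z0.
  by apply: arc => //; rewrite !dot_lin lk; ring.
have [x0 Kx0 zx0] : exists2 x, K x & dot z0 x <= 0.
  apply: contrapT => h; apply: nz0 => x Kx; rewrite ltNge; apply/negP => zx.
  by apply: h; exists x.
have {}zx0 : dot z0 x0 = 0 by apply/eqP; rewrite eq_le zx0 Kz0.
apply: (@touching_circle (k0' *: e - l) z0 x0 k0') => //.
- by rewrite !dot_lin lk; ring.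
- exact: ltW.
- rewrite !dot_lin (dotC l e) el ll ee.
  set A := (X in _ < X); have -> : A =
    (sg ^+ 2 * (1 + g) + k0' ^+ 2 * (2 * sg ^+ 2)) / (1 + g).
    by rewrite /A; field; rewrite gt_eqF.
  rewrite ltr_pdivlMr//.
  suff : k0' ^+ 2 * (1 + g - 2 * sg ^+ 2) < sg ^+ 2 * (1 + g) by narrow; lra.
  have [h|h] := leP 0 (1 + g - 2 * sg ^+ 2).
    apply: le_lt_trans kb; apply: ler_wpM2r => //.
    by rewrite ler_sqr ?nnegrE ?(ltW k0'0) ?(ltW k0).
  apply: (@lt_trans _ _ 0); last by rewrite mulr_gt0// exprn_gt0.
  by rewrite nmulr_llt0// exprn_gt0.
- have lnear : \forall y \near z0, 0 < dot l y.
    have := @open_dot_gt R l 0; rewrite openE => /(_ z0); exact.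
  by apply: filterS lnear => y ly y1 dy; exact: arc.
Qed.

End rolling.
End Rolling.

(** * From the local inclusion of the dual to the global one *)

Section RollingTheorem.
Context {R : realType}.
Implicit Types (x y z n c u v b d m : 'rV[R]_3) (a t r k : R).
Variables (K : set 'rV[R]_3) (r : R).
Hypotheses (Ks : K `<=` sphere) (Kcp : compact K).
Hypothesis Kbar : inner_barrier r K.
Hypothesis r_bnd : 0 < r < pi / 2.
Hypothesis Kint : sphere_interior K !=set0.

Let sg := sin r.
Let tau := cos r.

Let sg0 : 0 < sg. Proof. by rewrite sin_gt0_pihalf. Qed.

Let tau0 : 0 < tau.
Proof. by rewrite cos_gt0_pihalf//; case/andP: r_bnd => ? ?; apply/andP; split; lra. Qed.

Let ts : tau ^+ 2 + sg ^+ 2 = 1. Proof. exact: cos2Dsin2. Qed.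

Local Ltac narrow := clear - K r Ks Kcp Kbar r_bnd Kint sg tau sg0 tau0 ts.

Definition lens_point x y (s t w : R) := s *: x + t *: y + w *: cross x y.

Lemma lens_point_dot x y s t w v : dot (lens_point x y s t w) v =
  s * dot x v + t * dot y v + w * dot (cross x y) v.
Proof. by rewrite /lens_point !dot_lin. Qed.

(** The two half lenses together, in homogeneous coordinates: exchanging [n1] and [n2] changes the
    sign of [w], and the last inequality is that of [half_lens] multiplied by the norm. *)
Lemma lens_strict n1 n2 k s t w : dot n1 n1 = 1 -> dot n2 n2 = 1 ->
  -1 < dot n1 n2 < 1 -> strict_dual K n1 -> strict_dual K n2 -> 0 < k ->
  k ^+ 2 * (1 + dot n1 n2 - 2 * sg ^+ 2) < sg ^+ 2 * (1 + dot n1 n2) ->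
  `|w| * Num.sqrt (1 - dot n1 n2 ^+ 2) <= k * (s + t - nrm (lens_point n1 n2 s t w)) ->
  dual_cone K (lens_point n1 n2 s t w).
Proof.
move=> n11 n21 gb Kn1 Kn2 k0 kb.
wlog w0 : n1 n2 s t w n11 n21 gb Kn1 Kn2 kb / 0 <= w.
  move=> wl h; have [w0|w0] := leP 0 w; first exact: wl.
  have zE : lens_point n1 n2 s t w = lens_point n2 n1 t s (- w).
    by rewrite /lens_point (crossC n2) scaleNr scalerN opprK [X in X + _ = _]addrC.
  rewrite zE in h *; apply: wl => //.
  - by rewrite (dotC n2).
  - by rewrite (dotC n2).
  - lra.
  - by rewrite (dotC n2) normrN (addrC t).
rewrite (ger0_norm w0); set z := lens_point _ _ _ _ _; set g := dot n1 n2 in gb kb *.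
move=> hw; have [z0|z0] := eqVneq z 0; first by rewrite z0 => x _; rewrite dot0l.
case/andP: gb => gN1 g1.
have g2 : 0 < 1 - g ^+ 2.
  by rewrite (_ : _ - _ = (1 - g) * (1 + g)); [apply: mulr_gt0; lra|ring].
have s0 : 0 < Num.sqrt (1 - g ^+ 2) by rewrite sqrtr_gt0.
have lz : dot (lens_normal n1 n2) z = w * Num.sqrt (1 - g ^+ 2).
  rewrite dotC lens_point_dot /lens_normal !(dotZr (Num.sqrt _)^-1) !(dotC _ (cross _ _)).
  rewrite dot_crossl dot_crossr dot_cross_cross n11 n21 (dotC n2) -/g.
  have -> : 1 * 1 - g * g = Num.sqrt (1 - g ^+ 2) ^+ 2.
    by rewrite sqr_sqrtr ?(ltW g2)//; ring.
  by field; rewrite gt_eqF.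
have ez : dot (lens_axis n1 n2) z = s + t.
  rewrite dotC lens_point_dot /lens_axis !(dotZr (1 + g)^-1) !dotDr.
  by rewrite dot_crossl dot_crossr n11 n21 (dotC n2) -/g; field; lra.
have nz : 0 < nrm z by rewrite nrm_gt0.
suff Ku : dual_cone K (unitv z).
  by move=> x Kx; rewrite (unitvE z) dotZl mulr_ge0 ?Ku// ltW.
apply: (@half_lens R K r Ks Kcp Kbar r_bnd n1 n2 k) => //.
- by rewrite gN1.
- exact: unitv1.
- by rewrite dot_unitvr_ge0// lz mulr_ge0// ltW.
- rewrite !(dotZr (nrm z)^-1) lz ez -(@ler_pM2l _ (nrm z))//.
  have -> : nrm z * ((nrm z)^-1 * (w * Num.sqrt (1 - g ^+ 2))) =
    w * Num.sqrt (1 - g ^+ 2) by field; rewrite gt_eqF.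
  by have -> : nrm z * (k * ((nrm z)^-1 * (s + t) - 1)) = k * (s + t - nrm z);
    [field; rewrite gt_eqF|].
Qed.

(** Adding [e *: m] moves both endpoints into the strict dual; the strict inequalities survive for
    small [e], and nonnegativity passes to the limit. *)
Lemma lens_closed m n1 n2 k s t w : strict_dual K m ->
  dot n1 n1 = 1 -> dot n2 n2 = 1 ->
  -1 < dot n1 n2 < 1 -> dual_cone K n1 -> dual_cone K n2 -> 0 < k ->
  k ^+ 2 * (1 + dot n1 n2 - 2 * sg ^+ 2) < sg ^+ 2 * (1 + dot n1 n2) ->
  `|w| * Num.sqrt (1 - dot n1 n2 ^+ 2) < k * (s + t - nrm (lens_point n1 n2 s t w)) ->
  dual_cone K (lens_point n1 n2 s t w).
Proof.
move=> Km n11 n21 /andP[gN1 g1] Kn1 Kn2 k0 kb hw x Kx.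
pose F := (0 : R)^'+.
pose a e := unitv (n1 + e *: m); pose b e := unitv (n2 + e *: m).
have cv n : dot n n = 1 -> unitv (n + e *: m) @[e --> F] --> n.
  move=> n1'; rewrite -[X in _ --> X](unitv_id n1').
  by apply: unitv_cvg; [exact: unit_neq0|exact: (cvg_line m cvg_right0)].
have ca : a e @[e --> F] --> n1 by exact: cv.
have cb : b e @[e --> F] --> n2 by exact: cv.
have sK n : dual_cone K n -> dot n n = 1 -> \forall e \near F,
    dot (unitv (n + e *: m)) (unitv (n + e *: m)) = 1 /\ strict_dual K (unitv (n + e *: m)).
  move=> Kn n1'; have e0 : \forall e \near F, 0 < e by exact: nbhs_right_gt.
  apply: filterS e0 => e e0.
  have st y : K y -> 0 < dot (n + e *: m) y.
    move=> Ky; rewrite dotDl dotZl; have := Kn _ Ky.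
    have : 0 < e * dot m y by rewrite mulr_gt0// Km.
    lra.
  have nz : n + e *: m != 0.
    by apply: contraTN (st _ Kx) => /eqP ->; rewrite dot0l ltxx.
  split; first exact: unitv1.
  by move=> y Ky; rewrite dotZl mulr_gt0 ?st// invr_gt0 nrm_gt0.
have cg : dot (a e) (b e) @[e --> F] --> dot n1 n2 by exact: cvg_dot.
have cz : lens_point (a e) (b e) s t w @[e --> F] --> lens_point n1 n2 s t w.
  apply: cvgD; last by apply: cvgZl_tmp; exact: cvg_cross.
  by apply: cvgD; apply: cvgZl_tmp.
have cnz : nrm (lens_point (a e) (b e) s t w) @[e --> F] --> nrm (lens_point n1 n2 s t w).
  exact: (cvg_comp _ _ (cvg_dot cz cz) (@sqrt_continuous R _)).
have cs : Num.sqrt (1 - dot (a e) (b e) ^+ 2) @[e --> F] --> Num.sqrt (1 - dot n1 n2 ^+ 2).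
  have c1 : 1 - dot (a e) (b e) ^+ 2 @[e --> F] --> 1 - dot n1 n2 ^+ 2.
    apply: cvgB; [exact: cvg_cst|].
    by rewrite expr2; under eq_fun do rewrite expr2; apply: cvgM.
  exact: (cvg_comp _ _ c1 (@sqrt_continuous R _)).
have key : \forall e \near F, 0 <= dot (lens_point (a e) (b e) s t w) x.
  have h1 : \forall e \near F, -1 < dot (a e) (b e).
    exact: (cvgr_gt _ cg _ gN1).
  have h2 : \forall e \near F, dot (a e) (b e) < 1 by exact: (cvgr_lt _ cg _ g1).
  have h3 : \forall e \near F, (k ^+ 2 - sg ^+ 2) * dot (a e) (b e) <
      sg ^+ 2 - k ^+ 2 * (1 - 2 * sg ^+ 2).
    have : (k ^+ 2 - sg ^+ 2) * dot (a e) (b e) @[e --> F] -->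
        (k ^+ 2 - sg ^+ 2) * dot n1 n2 by apply: cvgM => //; exact: cvg_cst.
    by move=> /cvgr_lt; apply; move: kb; lra.
  have h4 : \forall e \near F, `|w| * Num.sqrt (1 - dot (a e) (b e) ^+ 2) -
      k * (s + t - nrm (lens_point (a e) (b e) s t w)) < 0.
    have : `|w| * Num.sqrt (1 - dot (a e) (b e) ^+ 2) -
      k * (s + t - nrm (lens_point (a e) (b e) s t w)) @[e --> F] -->
      `|w| * Num.sqrt (1 - dot n1 n2 ^+ 2) - k * (s + t - nrm (lens_point n1 n2 s t w)).
      apply: cvgB; apply: cvgM => //; try exact: cvg_cst.
      by apply: cvgB => //; exact: cvg_cst.
    by move=> /cvgr_lt; apply; rewrite subr_lt0.
  near=> e.
  have [a1 Ka] : dot (a e) (a e) = 1 /\ strict_dual K (a e).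
    by near: e; exact: sK.
  have [b1 Kb] : dot (b e) (b e) = 1 /\ strict_dual K (b e).
    by near: e; exact: sK.
  apply: (@lens_strict (a e) (b e) k s t w) => //.
  - by apply/andP; split; near: e.
  - suff : (k ^+ 2 - sg ^+ 2) * dot (a e) (b e) < sg ^+ 2 - k ^+ 2 * (1 - 2 * sg ^+ 2).
      by lra.
    by near: e.
  - by rewrite -subr_le0 ltW//; near: e.
have cx : dot (lens_point (a e) (b e) s t w) x @[e --> F] --> dot (lens_point n1 n2 s t w) x.
  exact: (@cvg_dot _ _ F _ _ (cst x) _ _ cz (cvg_cst _)).
rewrite leNgt; apply/negP => xlt.
have [e [_ _ []]] := ex_right ltr01 (filterI key (cvgr_lt _ cx _ xlt)); lra.
Unshelve. all: by end_near.
Qed.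

(* With [X = c.n - sg (b.n)] and [chi = c.(b x n)], the points
   [b + t n +- w t (b x n)] of the dual give [w |chi| <= X] for all admissible
   slopes [w], while the Gram identity bounds [chi^2] below by [X < sg (1 - b.n)]. *)
Lemma rolling_off_axis m b z n : strict_dual K m -> K z -> dot b b = 1 ->
  dual_cone K b -> dot b z = 0 -> dot n n = 1 -> dual_cone K n ->
  dot (tau *: z + sg *: b) (cross b n) != 0 ->
  sg <= dot (tau *: z + sg *: b) n.
Proof.
move=> Km Kz b1 Kb bz n1 Kn; have z1 : dot z z = 1 := Ks Kz.
have nloc := dual_local Ks Kbar r_bnd Kz b1 Kb bz; rewrite -/tau -/sg in nloc.
set c := tau *: z + sg *: b in nloc *.
have c1 : dot c c = 1.
  by rewrite /c !dot_lin z1 b1 (dotC z) bz -[RHS]ts; ring.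
have cb : dot c b = sg by rewrite /c !dot_lin b1 (dotC z) bz; ring.
clearbody c => chi0; rewrite leNgt; apply/negP => cn.
set chi := dot c (cross b n) in chi0; set g := dot b n; pose X := dot c n - sg * g.
have g1 : g < 1.
  rewrite lt_def dot_unit_le1// andbT eq_sym; apply/eqP => bn.
  by move: cn; rewrite -(dot_unit_eq1 b1 n1 bn) cb ltxx.
have gN1 : -1 < g.
  rewrite lt_def dot_unit_geN1// andbT; apply/eqP => bn.
  have [p Kp] := Kint; have := dual_interior Ks Kp b1 Kb.
  rewrite (dot_unit_eqN1 b1 n1 bn) dotNl oppr_gt0 ltNge Kn//.
  by case: Kp => p1 Up; exact: (nbhs_singleton Up).
have g2 : 0 < 1 - g ^+ 2.
  by rewrite (_ : _ - _ = (1 - g) * (1 + g)); [apply: mulr_gt0; lra|ring].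
have s0 : 0 < Num.sqrt (1 - g ^+ 2) by rewrite sqrtr_gt0.
have gram : chi ^+ 2 = (1 - sg ^+ 2) * (1 - g ^+ 2) - X ^+ 2.
  have : chi ^+ 2 = dot c c * (dot b b * dot n n - dot b n ^+ 2) -
     dot c b * (dot c b * dot n n - dot b n * dot c n) +
     dot c n * (dot c b * dot b n - dot b b * dot c n).
    by rewrite /chi !dotE !mxE /=; ring.
  by rewrite c1 b1 n1 cb -/g /X => ->; ring.
have slope k w : 0 < k -> k ^+ 2 * (1 + g - 2 * sg ^+ 2) < sg ^+ 2 * (1 + g) ->
    `|w| * Num.sqrt (1 - g ^+ 2) < k * (1 - g) -> 0 <= X + w * chi.
  move=> k0 kb hw.
  pose p t := lens_point b n 1 t (w * t).
  have pb : p t @[t --> (0 : R)^'+] --> b.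
    have -> : p = (fun t : R => b + t *: (n + w *: cross b n)).
      apply/funext => t; rewrite /p /lens_point scale1r scalerDr scalerA.
      by rewrite (mulrC w) addrA.
    exact: (cvg_line _ cvg_right0).
  pose A := 1 + w ^+ 2 * (1 - g ^+ 2).
  have A0 : 0 < A by rewrite ltr_wpDr// mulr_ge0 ?sqr_ge0// ltW.
  have pp t : dot (p t) (p t) = 1 + 2 * t * g + t ^+ 2 * A.
    rewrite /p lens_point_dot !(dotC _ (lens_point _ _ _ _ _)) !lens_point_dot.
    rewrite dot_crossl dot_crossr !(dotC _ (cross _ _)) dot_crossl dot_crossr.
    by rewrite dot_cross_cross b1 n1 (dotC n) -/g /A; ring.
  have gp : 0 < k * (1 - g) - `|w| * Num.sqrt (1 - g ^+ 2) by rewrite subr_gt0.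
  (* Below this bound the second-order part of the norm of [p t] stays within the slack of the
     strict slope inequality. *)
  pose e := Num.min (1 / A) ((k * (1 - g) - `|w| * Num.sqrt (1 - g ^+ 2)) / (k * A)).
  have e0 : 0 < e by rewrite lt_min !divr_gt0// mulr_gt0.
  have nl := pb _ nloc.
  have [t [t0 te nt]] := ex_right e0 nl.
  move: te; rewrite lt_min !ltr_pdivlMr ?mulr_gt0// => /andP[te1 te2].
  have nrmp : nrm (p t) <= 1 + t * g + t ^+ 2 * A / 2.
    have q0 : 0 <= 1 + t * g + t ^+ 2 * A / 2.
      rewrite -(@pmulr_rge0 _ 2)//.
      have -> : 2 * (1 + t * g + t ^+ 2 * A / 2) = 1 + dot (p t) (p t).
        by rewrite pp; field.
      by rewrite addr_ge0// dot_ge0.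
    rewrite le_nrm// pp.
    by have := sqr_ge0 (t * g + t ^+ 2 * A / 2); narrow; lra.
  have tA : t ^+ 2 * A / 2 * k < t * (k * (1 - g) - `|w| * Num.sqrt (1 - g ^+ 2)).
    have : t * (t * (k * A)) < t * (k * (1 - g) - `|w| * Num.sqrt (1 - g ^+ 2)).
      by rewrite ltr_pM2l.
    have : 0 < t * (t * (k * A)) by rewrite !mulr_gt0.
    by narrow; lra.
  have Kp : dual_cone K (p t).
    apply: (@lens_closed m b n k) => //.
    - by rewrite -/g gN1.
    - rewrite -/g normrM (gtr0_norm t0).
      have : k * nrm (p t) <= k * (1 + t * g + t ^+ 2 * A / 2) by rewrite ler_pM2l.
      rewrite /p; lra.
  have /(_ Kp) := nt.
  have bp : 1 + t * g <= nrm (p t).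
    have := dot_le_nrm b (p t); rewrite (nrm1 b1) mul1r; apply: le_trans.
    by rewrite dotC /p lens_point_dot dot_crossl b1 (dotC n) -/g; narrow; lra.
  have : sg * (1 + t * g) <= sg * nrm (p t) by rewrite ler_pM2l.
  have -> : dot (p t) c = sg + t * dot c n + w * t * chi.
    rewrite /p lens_point_dot !(dotC _ c) cb -/chi; ring.
  by move=> h1 h2; rewrite -(@pmulr_rge0 _ t)// /X; move: h1 h2; narrow; lra.
(* This is the slope 0; the parameter [sg / 2] is small enough for the radius condition whatever the
   angle between [b] and [n]. *)
have X0 : 0 <= X.
  have k0 : 0 < sg / 2 by rewrite divr_gt0.
  have := @slope (sg / 2) 0 k0; rewrite normr0 !mul0r addr0; apply.
    have -> : (sg / 2) ^+ 2 * (1 + g - 2 * sg ^+ 2) =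
      sg ^+ 2 * (1 + g) / 4 - (sg ^+ 2) ^+ 2 / 2 by field.
    have h1 : 0 < sg ^+ 2 * (1 + g) by apply: mulr_gt0; [exact: exprn_gt0|lra].
    have h2 := sqr_ge0 (sg ^+ 2).
    by move: h1 h2; set p := sg ^+ 2 * (1 + g); set q := (sg ^+ 2) ^+ 2; lra.
  by rewrite mulr_gt0// subr_gt0.
have Xlt : X < sg * (1 - g) by rewrite /X; move: cn; narrow; lra.
have absX w k : 0 < k -> k ^+ 2 * (1 + g - 2 * sg ^+ 2) < sg ^+ 2 * (1 + g) ->
    0 <= w -> w * Num.sqrt (1 - g ^+ 2) < k * (1 - g) -> w * `|chi| <= X.
  move=> k0 kb w0 hw; have h1 := slope k w k0 kb; have h2 := slope k (- w) k0 kb.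
  rewrite normrN (ger0_norm w0) in h1 h2; move: (h1 hw) (h2 hw) => {}h1 {}h2.
  have [c0|c0] := leP 0 chi; [rewrite ger0_norm//|rewrite ltr0_norm//];
    by move: h1 h2; narrow; lra.
have nchi : 0 < `|chi| by rewrite normr_gt0.
have sg1 : 0 < 1 - sg ^+ 2 by rewrite -ts addrK exprn_gt0.
(* After substitution of the Gram identity the difference of the two sides is a positive multiple of
   [(sg * (1 - g)) ^+ 2 - X ^+ 2]. It makes the critical slope [X / |chi|] admissible with room to
   spare. *)
have P0 : X ^+ 2 * (1 + g - 2 * sg ^+ 2) < sg ^+ 2 * (1 - g) * `|chi| ^+ 2.
  rewrite real_normK ?num_real// gram -subr_gt0.
  have -> : sg ^+ 2 * (1 - g) * ((1 - sg ^+ 2) * (1 - g ^+ 2) - X ^+ 2) -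
      X ^+ 2 * (1 + g - 2 * sg ^+ 2) =
      (1 + g) * (1 - sg ^+ 2) * ((sg * (1 - g)) ^+ 2 - X ^+ 2) by ring.
  have g10 : 0 < 1 + g by move: gN1; narrow; lra.
  rewrite mulr_gt0//; first by rewrite mulr_gt0.
  by rewrite subr_gt0 ltr_sqr ?nnegrE// (le_trans X0)// ltW.
pose w0 := X / `|chi|.
have w00 : 0 <= w0 by rewrite divr_ge0// ltW.
have Pw0 : w0 ^+ 2 * (1 + g - 2 * sg ^+ 2) < sg ^+ 2 * (1 - g).
  rewrite /w0 expr_div_n mulrAC ltr_pdivrMr//; exact: exprn_gt0.
have [w1 [w10 w1P]] : exists w1, w0 < w1 /\ w1 ^+ 2 * (1 + g - 2 * sg ^+ 2) < sg ^+ 2 * (1 - g).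
  have cw : (w0 + t) ^+ 2 * (1 + g - 2 * sg ^+ 2) @[t --> (0 : R)^'+] -->
      w0 ^+ 2 * (1 + g - 2 * sg ^+ 2).
    have ct : w0 + t @[t --> (0 : R)^'+] --> w0.
      rewrite -[X in _ --> X]addr0; apply: cvgD; [exact: cvg_cst|exact: cvg_right0].
    apply: cvgM; last exact: cvg_cst.
    by rewrite expr2; under eq_fun do rewrite expr2; apply: cvgM.
  have [t [t0 _ ht]] := ex_right ltr01 (cvgr_lt _ cw _ Pw0).
  by exists (w0 + t); split=> //; rewrite ltrDl.
(* Chosen so that [w1] is the limiting slope of the lens of parameter [k]; the radius condition on
   [k] then reduces to the inequality satisfied by [w1]. *)
pose k := w1 * Num.sqrt ((1 + g) / (1 - g)).
have g1' : 0 < 1 - g by rewrite subr_gt0.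
have q0 : 0 < (1 + g) / (1 - g) by rewrite divr_gt0//; move: gN1; narrow; lra.
have k0 : 0 < k by rewrite mulr_gt0 ?sqrtr_gt0// (le_lt_trans w00).
have kE : k * (1 - g) = w1 * Num.sqrt (1 - g ^+ 2).
  rewrite /k -mulrA; congr (_ * _).
  rewrite -{2}(gtr0_norm g1') -sqrtr_sqr -sqrtrM ?(ltW q0)//; congr Num.sqrt.
  by field; rewrite gt_eqF.
have kb : k ^+ 2 * (1 + g - 2 * sg ^+ 2) < sg ^+ 2 * (1 + g).
  rewrite /k exprMn sqr_sqrtr ?(ltW q0)//.
  have -> : w1 ^+ 2 * ((1 + g) / (1 - g)) * (1 + g - 2 * sg ^+ 2) =
     w1 ^+ 2 * (1 + g - 2 * sg ^+ 2) * ((1 + g) / (1 - g)) by ring.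
  have -> : sg ^+ 2 * (1 + g) = sg ^+ 2 * (1 - g) * ((1 + g) / (1 - g)) by field; rewrite gt_eqF.
  by rewrite ltr_pM2r.
have hw2 : (w0 + w1) / 2 * Num.sqrt (1 - g ^+ 2) < k * (1 - g).
  by rewrite kE ltr_pM2r//; move: w10; narrow; lra.
have w2 : 0 <= (w0 + w1) / 2 by move: w10 w00; narrow; lra.
(* The slope halfway between [w0] and [w1] is admissible, hence at most [w0], a contradiction. *)
have := absX _ _ k0 kb w2 hw2; rewrite -ler_pdivlMr// -/w0; move: w10; narrow; lra.
Qed.

(** The exceptional plane of [b] and [c] is avoided by perturbation: a failing [n] is first moved
    into the strict dual by a multiple of [m], then out of the plane along [cross c b], and it still
    fails because failing is an open condition. *)
Lemma rolling m b z n : strict_dual K m -> K z -> dot b b = 1 ->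
  dual_cone K b -> dot b z = 0 -> dot n n = 1 -> dual_cone K n ->
  sg <= dot (tau *: z + sg *: b) n.
Proof.
move=> Km Kz b1 Kb bz n1 Kn; have z1 : dot z z = 1 := Ks Kz.
have off n' : dot n' n' = 1 -> dual_cone K n' -> dot (tau *: z + sg *: b) (cross b n') != 0 ->
    sg <= dot (tau *: z + sg *: b) n' by exact: (@rolling_off_axis m b z n').
set c := tau *: z + sg *: b in off *.
have c1 : dot c c = 1.
  by rewrite /c !dot_lin z1 b1 (dotC z) bz -[RHS]ts; ring.
have cb : dot c b = sg by rewrite /c !dot_lin b1 (dotC z) bz; ring.
clearbody c; rewrite leNgt; apply/negP => cn.
have n0 := unit_neq0 n1.
have near1 : \forall y \near n, dot c y - sg * nrm y < 0.
  have : dot c y - sg * nrm y @[y --> n] --> dot c n - sg * nrm n.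
    apply: (cvgB (@dot_continuous R c n)); apply: cvgM; first exact: (cvg_cst _).
    exact: (cvg_comp _ _ (@cvg_dot _ _ (nbhs n) _ id id n n cvg_id cvg_id) (@sqrt_continuous R _)).
  by move=> /cvgr_lt; apply; rewrite (nrm1 n1) mulr1 subr_lt0.
have [e [e0 _ ne]] := ex_right ltr01 (near_line m (nbhs_interior near1)).
set n' := n + e *: m in ne.
have Kn' : strict_dual K n'.
  move=> x Kx; rewrite /n' !dot_lin; have := Kn _ Kx.
  have : 0 < e * dot m x by rewrite mulr_gt0// Km.
  lra.
have bad y : strict_dual K y -> dot c y - sg * nrm y < 0 -> dot c (cross b y) = 0.
  move=> Ky cy; apply/eqP/negPn/negP => cby.
  have y0 : y != 0 by apply: contraNN cby => /eqP ->; apply/eqP; rewrite dotE !mxE/=; ring.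
  have ny : 0 < nrm y by rewrite nrm_gt0.
  have := off (unitv y) (unitv1 y0).
  have crE : cross b (unitv y) = (nrm y)^-1 *: cross b y.
    by rewrite /unitv; apply: vec3P; rewrite !mxE/=; ring.
  rewrite crE !(dotZr (nrm y)^-1) mulf_eq0 invr_eq0 (gt_eqF ny)/= cby mulrC ler_pdivlMr//.
  move=> h; have : sg * nrm y <= dot c y.
    by apply: h => // x Kx; rewrite dotZl mulr_ge0 ?invr_ge0 ?(ltW ny)// ltW// Ky.
  lra.
have c0 : dot c (cross b n') = 0 by apply: bad => //; exact: nbhs_singleton ne.
have nU : nbhs n' (strict_dual K `&` [set y | dot c y - sg * nrm y < 0]).
  by apply: filterI; [exact: strict_dual_nbhs|exact: ne].
have [t [t0 _ [Kt ct]]] := ex_right ltr01 (near_line (cross c b) nU).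
have := bad _ Kt ct.
have -> : dot c (cross b (n' + t *: cross c b)) =
    dot c (cross b n') + t * (dot c c * dot b b - dot c b ^+ 2).
  by clearbody n'; rewrite !dotE !mxE/=; ring.
rewrite c0 add0r c1 b1 cb mulr1 -ts addrK => /eqP.
by rewrite mulf_eq0 !gt_eqF// exprn_gt0.
Qed.

End RollingTheorem.

(** * The circumscribed disk *)

Section Circumcenter.
Context {R : realType}.
Implicit Types (x y z n c u v b d m p : 'rV[R]_3) (a t r k mu : R) (K : set 'rV[R]_3).

Lemma gdist_le c x r : dot c c = 1 -> dot x x = 1 -> 0 <= r <= pi ->
  (gdist c x <= r) = (cos r <= dot c x).
Proof.
move=> c1 x1 rpi; have d1 : dot c x \in `[(-1), 1].
  by rewrite in_itv/= dot_unit_geN1// dot_unit_le1.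
have a1 : gdist c x \in `[0, pi].
  by rewrite in_itv/= acos_ge0 ?acos_lepi//; move: d1; rewrite in_itv.
by rewrite -[in RHS](acosK d1) [RHS]leNgt ltr_cos ?in_itv// -leNgt.
Qed.

(** The hypotheses certify [mu] as the value of a max-min problem: [c] attains it and no other
    center does better. Radii above pi are treated apart, since the cosine is monotone only up to
    pi. *)
Lemma circumradiusE K c mu : K `<=` sphere -> dot c c = 1 -> -1 <= mu <= 1 ->
  (forall x, K x -> mu <= dot c x) ->
  (forall c', dot c' c' = 1 -> exists2 x, K x & dot c' x <= mu) ->
  circumradius K = acos mu.
Proof.
move=> Ks c1 mu1 Kmu opt; rewrite /circumradius.
have a0 := acos_ge0 mu1; have api := acos_lepi mu1.
have cK : cos (acos mu) = mu by rewrite acosK// in_itv.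
set A := [set r | _].
have Aa : A (acos mu).
  split=> //; exists c => // x Kx; have x1 : dot x x = 1 := Ks _ Kx.
  by split=> //; rewrite gdist_le ?a0// cK Kmu.
have lbA : lbound A (acos mu).
  move=> r [r0 [c' c'1 Kc']]; rewrite /sphere/= in c'1.
  have [rpi|rpi] := leP r pi; last by rewrite (le_trans api)// ltW.
  have [x Kx cx] := opt _ c'1; have [x1] := Kc' _ Kx; rewrite /sphere/= in x1.
  rewrite gdist_le ?r0// => h; have := le_trans h cx.
  by rewrite -[in X in X -> _]cK leNgt ltr_cos ?in_itv/= ?r0 ?a0// -leNgt.
apply/eqP; rewrite eq_le; apply/andP; split.
  by apply: ge_inf => //; exists (acos mu).
by apply: lb_le_inf => //; exists (acos mu).
Qed.

(** The angle from [n] to [y] is at most pi/2 - r and the one from [y] to [x] at most r, so they add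
    up to at most pi/2; in coordinates this is the Cauchy-Schwarz inequality for the parts
    orthogonal to [y]. *)
Lemma disk_in_dual n y x r : 0 < r < pi / 2 -> dot y y = 1 -> dot x x = 1 ->
  sin r * nrm n <= dot n y -> cos r <= dot y x -> 0 <= dot n x.
Proof.
move=> rb y1 x1 ny yx.
have s0 : 0 < sin r by rewrite sin_gt0_pihalf.
have c0 : 0 < cos r.
  by rewrite cos_gt0_pihalf//; case/andP: rb => ? ?; apply/andP; split; lra.
have e := cos2Dsin2 r.
pose p := n - dot n y *: y; pose q := x - dot y x *: y.
have nE : dot n x = dot n y * dot y x + dot p q.
  by rewrite /p /q !dot_lin y1; ring.
have ny0 : 0 <= dot n y by rewrite (le_trans _ ny)// mulr_ge0 ?nrm_ge0// ltW.
have pp : dot p p = nrm n ^+ 2 - dot n y ^+ 2.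
  by rewrite nrm_sqr /p !dot_lin y1 (dotC y); ring.
have qq : dot q q = 1 - dot y x ^+ 2.
  by rewrite /q !dot_lin y1 x1 (dotC x y); ring.
have hp : sin r * nrm p <= cos r * dot n y.
  rewrite -ler_sqr ?nnegrE ?mulr_ge0 ?nrm_ge0 ?(ltW s0) ?(ltW c0)//.
  rewrite !exprMn nrm_sqr pp.
  have : (sin r * nrm n) ^+ 2 <= dot n y ^+ 2.
    by rewrite ler_sqr ?nnegrE ?mulr_ge0 ?nrm_ge0 ?(ltW s0).
  rewrite exprMn (_ : cos r ^+ 2 = 1 - sin r ^+ 2); last by rewrite -e addrK.
  lra.
have hq : nrm q <= sin r.
  rewrite le_nrm ?(ltW s0)// qq.
  have : cos r ^+ 2 <= dot y x ^+ 2.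
    by rewrite ler_sqr ?nnegrE ?(ltW c0)// (le_trans (ltW c0)).
  rewrite (_ : sin r ^+ 2 = 1 - cos r ^+ 2); last by rewrite -e addrAC subrr add0r.
  lra.
have pq : - (nrm p * nrm q) <= dot p q.
  by rewrite lerNl -dotNl (le_trans (dot_le_nrm _ _))// /nrm !dot_lin opprK.
have h1 : nrm p * nrm q <= nrm p * sin r by rewrite ler_wpM2l ?nrm_ge0.
have h2 : cos r * dot n y <= dot n y * dot y x by rewrite mulrC ler_wpM2l.
rewrite nE; lra.
Qed.

(** Separating [- k] from [K] gives a dual vector positive at [k], hence near [k]. By compactness
    finitely many of them suffice, and their sum is positive everywhere. *)
Lemma exists_strict_dual K : K `<=` sphere -> compact K -> cone_closed K ->
  (forall x, K x -> ~ K (- x)) -> exists m, strict_dual K m.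
Proof.
move=> Ks Kcp Kc Kna.
have cov : cover_compact K by rewrite -compact_cover.
have [] := cov 'rV[R]_3 (dual_cone K) (fun n => [set x | 0 < dot n x]).
- by move=> n _; exact: open_dot_gt.
- move=> k Kk; have k1 : dot k k = 1 := Ks _ Kk.
  have Nk1 : sphere (- k) by rewrite /sphere/= !(dotNl, dotNr) opprK.
  have [n [Kn nk]] := separation Kcp Ks Kc Nk1 (Kna _ Kk).
  by exists n => //=; move: nk; rewrite dotNr oppr_lt0.
move=> D' D'K Dcov; exists (\sum_(n <- finmap.enum_fset D') n) => x Kx.
have [n /= nD nx] := Dcov _ Kx.
have sE (s : seq 'rV[R]_3) : dot (\sum_(n <- s) n) x = \sum_(n <- s) dot n x.
  by elim: s => [|w s IH]; rewrite ?big_nil ?dot0l// !big_cons dotDl IH.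
rewrite sE (big_rem n)//=; apply: ltr_wpDr => //.
rewrite big_seq; apply: sumr_ge0 => w /mem_rem wD.
have /set_mem := D'K _ wD; exact.
Qed.

Lemma full_or_supported K : compact K -> K `<=` sphere -> cone_closed K ->
  K = sphere \/ exists2 n, dot n n = 1 & dual_cone K n.
Proof.
move=> Kcp Ks Kc; have [h|/existsNP[x /not_implyP[sx nKx]]] := pselect (forall x, sphere x -> K x).
  by left; apply/seteqP; split.
right; have [n [Kn nx]] := separation Kcp Ks Kc sx nKx.
have n0 : n != 0 by apply: contraTN nx => /eqP ->; rewrite dot0l ltxx.
exists (unitv n); first exact: unitv1.
by move=> k Kk; rewrite dotC dot_unitvr_ge0// dotC Kn.
Qed.

Definition hemisphere n : set 'rV[R]_3 := [set x | sphere x /\ 0 <= dot n x].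

(* At a point [q] with [q] and [- q] both in [K], the inscribed disk spans,
   together with [- q], the whole open hemisphere. *)
Lemma antipodal_hemisphere K r n q : compact K -> K `<=` sphere -> cone_closed K ->
  inner_barrier r K -> 0 < r < pi / 2 -> dot n n = 1 -> dual_cone K n ->
  K q -> K (- q) -> K = hemisphere n.
Proof.
move=> Kcp Ks Kc Kbar rb n1 Kn Kq KNq; have q1 : dot q q = 1 := Ks _ Kq.
have nq : dot n q = 0.
  apply/eqP; rewrite eq_le Kn// andbT -oppr_ge0 -dotNr; exact: Kn.
have s0 : 0 < sin r by rewrite sin_gt0_pihalf.
have c0 : 0 < cos r.
  by rewrite cos_gt0_pihalf//; case/andP: rb => ? ?; apply/andP; split; lra.
have [U qU UK] := barrier_center Ks Kbar rb Kq n1 Kn nq.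
have open_part x : dot x x = 1 -> 0 < dot n x -> K x.
  move=> x1 nx.
  pose v := x - dot q x *: q.
  have nv : dot n v = dot n x by rewrite /v !dot_lin nq; ring.
  have qv : dot q v = 0 by rewrite /v !dot_lin q1; ring.
  have vv : dot v v <= 1.
    by rewrite /v !dot_lin q1 x1 (dotC x q); have := sqr_ge0 (dot q x); lra.
  have xE : x = v + dot q x *: q by rewrite subrK.
  clearbody v.
  have e0 : 0 < Num.min 1 (sin r * dot n x) by rewrite lt_min ltr01 mulr_gt0.
  have [t [t0]] := ex_right e0 (near_unit_line v q1 qU).
  rewrite lt_min => /andP[t1 te] Ut.
  have z0 : q + t *: v != 0.
    apply/eqP => /(congr1 (dot q)); rewrite !dot_lin q1 qv dot0r; lra.
  have Kz : K (unitv (q + t *: v)).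
    apply: UK => //; first exact: unitv1.
    rewrite dotZr mulrC ler_pdivlMr ?nrm_gt0//.
    have -> : dot (cos r *: q + sin r *: n) (q + t *: v) = cos r + t * (sin r * dot n x).
      by rewrite !dot_lin q1 qv nq nv; ring.
    have nle : nrm (q + t *: v) <= 1 + t ^+ 2 / 2.
      have t20 := sqr_ge0 t.
      rewrite le_nrm; last lra.
      rewrite !dot_lin q1 (dotC v) qv.
      have : t ^+ 2 * dot v v <= t ^+ 2 by rewrite ler_piMr.
      have := sqr_ge0 (t ^+ 2); lra.
    apply: (@le_trans _ _ (cos r * (1 + t ^+ 2 / 2))); first by rewrite ler_pM2l.
    have h1 : cos r * (t ^+ 2) <= t ^+ 2 by rewrite ler_piMl ?sqr_ge0// cos_le1.
    have h2 : t ^+ 2 <= t * (sin r * dot n x) by rewrite expr2 ler_pM2l// ltW.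
    have h3 := sqr_ge0 t; lra.
  (* A small enough [t] puts [q + t *: v] in the disk, up to normalization, and [x] is a nonnegative
     combination of it and [- q]. *)
  have xz : x = (nrm (q + t *: v) / t) *: unitv (q + t *: v) + (t^-1 - dot q x) *: - q.
    rewrite mulrC -scalerA -unitvE scalerDr scalerA mulVf ?gt_eqF// scale1r {1}xE.
    by apply: vec3P; rewrite !mxE; ring.
  rewrite -(unitv_id x1) xz; apply: Kc => //.
  - by rewrite divr_ge0 ?nrm_ge0// ltW.
  - rewrite subr_ge0 (le_trans (dot_unit_le1 q1 x1))//.
    by rewrite -[1]invr1 lef_pV2 ?posrE// ltW.
  - by rewrite -xz unit_neq0.
apply/seteqP; split=> [x Kx|x [x1 nx]]; first by split; [exact: Ks|exact: Kn].
have cK := compact_closed_rV Kcp; apply: cK => B xB.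
have [t [t0 t1 Bt]] := ex_right ltr01 (near_unit_line n x1 xB).
have nz : 0 < dot n (x + t *: n) by rewrite !dot_lin n1; lra.
have z0 : x + t *: n != 0 by apply: contraTN nz => /eqP ->; rewrite dot0r ltxx.
exists (unitv (x + t *: n)); split=> //; apply: open_part; first exact: unitv1.
by rewrite dot_unitvr_gt0.
Qed.

(** The minimum of [dot c] over [K] is a Lipschitz function of [c], so it has a maximizer on the
    sphere; the direction of [m] shows that the maximum is positive. *)
Lemma exists_circumcenter K m : K `<=` sphere -> compact K -> K !=set0 ->
  strict_dual K m -> exists c mu, [/\ dot c c = 1, 0 < mu <= 1,
   forall x, K x -> mu <= dot c x &
   forall c', dot c' c' = 1 -> exists2 x, K x & dot c' x <= mu].
Proof.
move=> Ks Kcp K0 Km.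
have /choice[f fP] : forall c, exists x, K x /\ forall y, K y -> dot c x <= dot c y.
  move=> c; have [x + xmin] := EVT_min_rV K0 Kcp (continuous_subspaceT (@dot_continuous _ c)).
  by rewrite inE => Kx; exists x; split=> // y Ky; apply: xmin; rewrite inE.
pose g c := dot c (f c).
have lip c c' : g c <= g c' + nrm (c - c').
  have [Kf' _] := fP c'; have [_ h] := fP c; apply: le_trans (h _ Kf') _.
  rewrite /g -lerBlDl -dotBl (le_trans (dot_le_nrm _ _))//.
  by rewrite (nrm1 (Ks _ Kf')) mulr1.
have gc : continuous g.
  move=> c; apply/(@cvgrPdist_lt _ _ _ (nbhs c)) => e e0; have e20 : 0 < e ^+ 2 by rewrite exprn_gt0.
  apply: filterS (dot_ball_nbhs c e20) => c' /= h.
  have n1 : nrm (c' - c) < e by rewrite -ltr_sqr ?nnegrE ?nrm_ge0 ?(ltW e0)// nrm_sqr.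
  have n2 : nrm (c - c') < e.
    by rewrite -opprB /nrm !(dotNl, dotNr) opprK -/(nrm (c' - c)).
  have := lip c c'; have := lip c' c; rewrite ltr_norml; lra.
have S0 : @sphere R !=set0.
  by case: K0 => x /Ks sx; exists x.
have [c + cmax] := EVT_max_rV S0 (@compact_sphere R) (continuous_subspaceT gc).
rewrite inE => c1; rewrite /sphere/= in c1.
have [Kf fmin] := fP c; have f1 : dot (f c) (f c) = 1 := Ks _ Kf.
exists c, (g c); split=> //.
- rewrite dot_unit_le1// andbT.
  have [K' _] := fP m; have m0 : m != 0.
    by have := Km _ K'; apply: contraTN => /eqP ->; rewrite dot0l ltxx.
  have [Ku _] := fP (unitv m).
  have : 0 < g (unitv m) by rewrite /g dotC dot_unitvr_gt0// dotC Km.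
  by move/lt_le_trans; apply; apply: cmax; rewrite inE; exact: unitv1.
- move=> c' c'1; have [Kf' _] := fP c'; exists (f c') => //.
  by apply: cmax; rewrite inE.
Qed.

(** If [v] were positive at all contact points, tilting [c] slightly towards [v] would raise the
    minimum over [K] above the optimal value. *)
Lemma contact_direction K c mu v : K `<=` sphere -> compact K ->
  dot c c = 1 -> 0 < mu -> (forall x, K x -> mu <= dot c x) ->
  (forall c', dot c' c' = 1 -> exists2 x, K x & dot c' x <= mu) ->
  dot c v = 0 -> exists p, [/\ K p, dot c p = mu & dot v p <= 0].
Proof.
move=> Ks Kcp c1 mu0 Kmu opt cv; apply: contrapT => nex.
have pos p : K p -> dot c p = mu -> 0 < dot v p.
  by move=> Kp cp; rewrite ltNge; apply/negP => vp; apply: nex; exists p.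
have K0 : K !=set0 by have [x Kx _] := opt _ c1; exists x.
pose P := K `&` [set x | dot c x = mu].
have Pcp : compact P.
  apply: compact_sub_sphere; first by move=> x [/Ks].
  by apply: closedI; [exact: compact_closed_rV|exact: closed_dot_eq].
have P0 : P !=set0.
  have [x Kx cx] := opt _ c1; exists x; split=> //=.
  by apply/eqP; rewrite eq_le cx Kmu.
have [p0 + pmin] := EVT_min_rV P0 Pcp (continuous_subspaceT (@dot_continuous _ v)).
rewrite inE => -[Kp0 /= cp0]; have d0 := pos _ Kp0 cp0.
set d := dot v p0 in d0.
pose K1 := K `&` [set x | - (d / 2) <= dot (- v) x].
(* The points of [K] at which [v] is not clearly positive stay away from the circumscribed
   circle. *)
have [gap gap0 gapP] : exists2 e, 0 < e & forall x, K1 x -> mu + e <= dot c x.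
  have [K10|/set0P K10] := eqVneq K1 set0.
    by exists 1 => // x; rewrite K10.
  have K1cp : compact K1.
    apply: compact_sub_sphere; first by move=> x [/Ks].
    by apply: closedI; [exact: compact_closed_rV|exact: closed_halfspace].
  have [q + qmin] := EVT_min_rV K10 K1cp (continuous_subspaceT (@dot_continuous _ c)).
  rewrite inE => -[Kq /= vq].
  exists (dot c q - mu) => [|x K1x]; last first.
    by rewrite addrC subrK; apply: qmin; rewrite inE.
  rewrite subr_gt0 lt_def Kmu// andbT; apply/eqP => cq.
  have : d <= dot v q by apply: pmin; rewrite inE; split.
  move: vq; rewrite dotNl; lra.
have V0 : 0 < 1 + dot v v by have := dot_ge0 v; lra.
(* The second bound serves the points protected by the gap, where [v] may be negative; the third
   serves those with [dot v x > d / 2], where the gain must beat the growth of the norm. *)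
pose e := Num.min 1 (Num.min (gap / (1 + (1 + dot v v) + mu * dot v v)) (d / (1 + mu * dot v v))).
have q1 : 0 < 1 + mu * dot v v by rewrite ltr_wpDr// mulr_ge0 ?dot_ge0// ltW.
have e0 : 0 < e by rewrite !lt_min ltr01 !divr_gt0//; lra.
have [e1 e2 e3] : [/\ e <= 1, e * (1 + (1 + dot v v) + mu * dot v v) <= gap &
    e * (1 + mu * dot v v) <= d].
  have : e <= e by []. 
  rewrite {2}/e !le_min => /and3P[-> h1 h2]; split=> //.
    by rewrite -ler_pdivlMr//; lra.
  by rewrite -ler_pdivlMr.
clearbody e.
have w0 : c + e *: v != 0.
  by apply/eqP => /(congr1 (dot c)); rewrite !dot_lin c1 cv dot0r; lra.
have [x Kx] := opt _ (unitv1 w0); have x1 : dot x x = 1 := Ks _ Kx.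
rewrite dotZl mulrC ler_pdivrMr ?nrm_gt0//.
have nle : nrm (c + e *: v) <= 1 + e ^+ 2 * dot v v / 2.
  have p : 0 <= e ^+ 2 * dot v v by rewrite mulr_ge0 ?sqr_ge0 ?dot_ge0.
  rewrite le_nrm; last lra.
  rewrite !dot_lin c1 (dotC v) cv; have := sqr_ge0 (e ^+ 2 * dot v v / 2); lra.
have := ler_wpM2l (ltW mu0) nle.
have ee : e ^+ 2 <= e by rewrite expr2 ler_piMr// ltW.
have h4 : e ^+ 2 * (mu * dot v v) <= e * (mu * dot v v).
  by rewrite ler_wpM2r// mulr_ge0 ?dot_ge0// ltW.
have h5 : 0 <= e * (mu * dot v v).
  by apply: mulr_ge0; [exact: ltW|apply: mulr_ge0; [exact: ltW|exact: dot_ge0]].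
have [vx|vx] := leP (dot v x) (d / 2).
  have := gapP x (conj Kx _); rewrite /= dotNl lerN2 => /(_ vx) cx.
  have : - (1 + dot v v) <= dot v x.
    have := cauchy_schwarz v x; rewrite x1 mulr1 => h.
    have : 0 <= (dot v x + 1) ^+ 2 by exact: sqr_ge0.
    lra.
  move=> vx2; have : - (e * (1 + dot v v)) <= e * dot v x.
    by rewrite -mulrN ler_pM2l.
  rewrite !dot_lin; lra.
have : e * (d / 2) < e * dot v x by rewrite ltr_pM2l.
have : e * (e * (1 + mu * dot v v)) <= e * d by rewrite ler_pM2l.
have := Kmu _ Kx; have : 0 < e * e by rewrite mulr_gt0.
rewrite !dot_lin; lra.
Qed.

End Circumcenter.

(** * Circumcenter, contact directions and rolled disks of a concave body *)

Section Structure.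
Context {R : realType}.
Implicit Types (x y z n c u v b d m p : 'rV[R]_3) (a t r k mu lambda : R) (K : set 'rV[R]_3).

Lemma lambda_concave_barrier lambda K c r : circle_of_curvature lambda c r ->
  lambda_concave lambda K -> inner_barrier r K.
Proof.
move=> Cr [_ Kl] p /Kl[c' [r' [U [Cr' Cp pU UK]]]].
have rr := circle_of_curvature_radius Cr Cr'; rewrite -{r'}rr in Cr' Cp UK.
have [c'1 /andP[r0 rpi] _] := Cr'; rewrite /sphere/= in c'1.
have [p1 gp] := Cp; rewrite /sphere/= in p1.
exists c', U; split=> //.
  by rewrite -gp /gdist acosK// in_itv/= dot_unit_geN1// dot_unit_le1.
move=> x Ux x1 cx; apply: UK; split=> //; split=> //.
by rewrite gdist_le// !ltW.
Qed.

Definition ray_point c u t := cos t *: c + sin t *: u.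

Lemma ray_point1 c u t : dot c c = 1 -> dot u u = 1 -> dot c u = 0 ->
  dot (ray_point c u t) (ray_point c u t) = 1.
Proof.
move=> c1 u1 cu; rewrite /ray_point !dot_lin c1 u1 (dotC u) cu.
by rewrite -[RHS](cos2Dsin2 t); ring.
Qed.

Definition contact K c rho : set 'rV[R]_3 :=
  [set u | [/\ dot u u = 1, dot c u = 0 & K (ray_point c u rho)]].

Lemma closed_contact K c rho : closed K -> closed (contact K c rho).
Proof.
move=> cK.
have -> : contact K c rho = sphere `&` [set u | dot c u = 0] `&`
    (ray_point c ^~ rho) @^-1` K.
  by apply/seteqP; split=> u; [move=> []|move=> [[]]].
apply: closedI; last first.
  apply: (continuous_closedP _).1 => // u.
  apply: (@cvgD _ _ _ (nbhs u)); first exact: (cvg_cst _).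
  by apply: (@cvgZl_tmp _ _ _ (nbhs u)); exact: cvg_id.
by apply: closedI; [exact: closed_sphere|exact: closed_dot_eq].
Qed.

Lemma cos_le_lt (s t : R) : 0 <= s <= pi -> 0 <= t <= pi -> (cos s < cos t) = (t < s).
Proof. by move=> hs ht; rewrite ltr_cos ?in_itv. Qed.

(** Gathers what the area estimate uses: contact directions lie in no open half circle, and rolling
    at each of them places a disk of radius [r] at distance [a] from the circumcenter. *)
Lemma concave_structure K r m : compact K -> K `<=` sphere -> cone_closed K ->
  sphere_interior K !=set0 -> inner_barrier r K -> 0 < r < pi / 2 ->
  strict_dual K m -> exists c a,
  [/\ dot c c = 1, K c & [/\ 0 <= a, a + r < pi / 2, circumradius K = a + r,
    forall x, K x -> cos (a + r) <= dot c x &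
    (forall v, dot c v = 0 -> exists2 u, contact K c (a + r) u & dot v u <= 0) /\
    forall u, contact K c (a + r) u -> forall n, dual_cone K n ->
      sin r * nrm n <= dot n (ray_point c u a)]].
Proof.
move=> Kcp Ks Kc Kint Kbar rb Km.
have K0 : K !=set0.
  by have [x [x1 Ux]] := Kint; exists x; exact: (nbhs_singleton Ux).
have [c [mu [c1 /andP[mu0 mu1] Kmu opt]]] := exists_circumcenter Ks Kcp K0 Km.
have muN : -1 <= mu <= 1 by rewrite mu1 andbT (le_trans _ (ltW mu0))// lerN10.
have CR := circumradiusE Ks c1 muN Kmu opt.
have ct := contact_direction Ks Kcp c1 mu0 Kmu opt.
set rho := acos mu in CR.
have cr : cos rho = mu by rewrite acosK// in_itv.
have rho0 : 0 <= rho by exact: acos_ge0.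
have rhopi2 : rho < pi / 2.
  rewrite -acos0 ltNge; apply/negP => h; have : cos rho <= cos (acos 0).
    have pi0 : 0 <= (acos 0 : R) <= pi by rewrite acos_ge0 ?acos_lepi//= ?ler01 ?lerN10.
    by rewrite leNgt cos_le_lt// -?leNgt// rho0 acos_lepi.
  by rewrite cr acosK ?in_itv/= ?lerN10 ?ler01// leNgt mu0.
(* A vector separating [c] from [K] would, through its part orthogonal to [c], be negative at some
   contact point. *)
have Kcc : K c.
  apply: contrapT => nKc; have [n [Kn nc]] := separation Kcp Ks Kc c1 nKc.
  have cv : dot c (n - dot c n *: c) = 0 by rewrite !dot_lin c1; ring.
  have [p [Kp cp vp]] := ct _ cv; have := Kn _ Kp.
  have nE : dot n p = dot (n - dot c n *: c) p + dot n c * mu.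
    by rewrite -cp !dot_lin (dotC n c); ring.
  have : 0 < - dot n c * mu by rewrite mulr_gt0// oppr_gt0.
  by rewrite nE; move: vp; clear; lra.
have rho_gt0 : 0 < rho.
  rewrite lt_def rho0 andbT; apply/eqP => r0; have mu11 : mu = 1 by rewrite -cr r0 cos0.
  have Kc1 x : K x -> x = c.
    move=> Kx; apply/esym/dot_unit_eq1 => //; first exact: Ks.
    by apply/eqP; rewrite eq_le dot_unit_le1 ?Ks//= -mu11 Kmu.
  have [q Kq] := Kint; have [w w1 [cw _]] := exists_perp c 0.
  have h1 : dual_cone K w by move=> x /Kc1 ->; rewrite dotC cw.
  have := dual_interior Ks Kq w1 h1.
  have -> : q = c by apply: Kc1; case: Kq => q1 Uq; exact: (nbhs_singleton Uq).
  by rewrite dotC cw ltxx.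
have srho : 0 < sin rho by rewrite sin_gt0_pihalf// rho_gt0.
have e := cos2Dsin2 rho; have er := cos2Dsin2 r.
(* The inward normal of the circumscribed disk is dual to [K], as [K] lies in that disk, and it
   vanishes at the contact point; it is the support vector to which rolling is applied. *)
have normal u : dot u u = 1 -> dot c u = 0 ->
    dual_cone K (sin rho *: c - cos rho *: u) /\
    dot (sin rho *: c - cos rho *: u) (sin rho *: c - cos rho *: u) = 1.
  move=> u1 cu; have n1 : dot (sin rho *: c - cos rho *: u) (sin rho *: c - cos rho *: u) = 1.
    by rewrite !dot_lin c1 u1 (dotC u) cu -[RHS]e; ring.
  split=> // x Kx; apply: (@disk_in_dual _ _ c x rho) => //.
  - by rewrite rho_gt0.
  - exact: Ks.
  - by rewrite (nrm1 n1) !dot_lin c1 (dotC u) cu; clear; lra.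
  - by rewrite cr; exact: Kmu.
have roll u n : contact K c rho u -> dual_cone K n ->
    sin r * nrm n <= dot n (ray_point c u (rho - r)).
  move=> [u1 cu Kp] Kn; have [Kb b1] := normal u u1 cu.
  have [->|n0] := eqVneq n 0; first by rewrite dot0l /nrm dot0l sqrtr0 mulr0.
  have bp : dot (sin rho *: c - cos rho *: u) (ray_point c u rho) = 0.
    by rewrite /ray_point !dot_lin c1 u1 (dotC u) cu; ring.
  have Kn' : dual_cone K (unitv n).
    by move=> x Kx; rewrite dotC dot_unitvr_ge0// dotC Kn.
  have := rolling Ks Kcp Kbar rb Kint Km Kp b1 Kb bp (unitv1 n0) Kn'.
  have -> : cos r *: ray_point c u rho + sin r *: (sin rho *: c - cos rho *: u) =
      ray_point c u (rho - r).
    by rewrite /ray_point cosB sinB; apply: vec3P; rewrite !mxE; ring.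
  by rewrite (dotZr (nrm n)^-1) mulrC ler_pdivlMr ?nrm_gt0// (dotC n).
have ctu v : dot c v = 0 -> exists2 u, contact K c rho u & dot v u <= 0.
  move=> cv; have [p [Kp cp vp]] := ct _ cv; have p1 : dot p p = 1 := Ks _ Kp.
  pose u := (sin rho)^-1 *: (p - cos rho *: c).
  have pE : p = ray_point c u rho.
    by rewrite /ray_point /u scalerA divff ?gt_eqF// scale1r addrC subrK.
  exists u; last first.
    rewrite /u dotZr dotBr dotZr (dotC v c) cv mulr0 subr0.
    by rewrite pmulr_rle0// invr_gt0.
  split; last by rewrite -pE.
    rewrite /u dotZr dotZl !dot_lin p1 c1 (dotC p) cp cr.
    transitivity ((sin rho)^-1 ^+ 2 * (1 - mu ^+ 2)); first by ring.
    rewrite -[X in X - _]e cr addrAC subrr add0r -exprMn mulVf ?expr1n//.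
    by rewrite gt_eqF.
  by rewrite /u dotZr !dot_lin c1 cp cr mulr1 subrr mulr0.
(* Otherwise the rolled disk would reach past [c] to the distance [2 * r - rho], larger than the
   circumradius. *)
have a0 : 0 <= rho - r.
  rewrite subr_ge0 leNgt; apply/negP => rr.
  have [u Cu _] := ctu 0 (dot0r c); have [u1 cu Kp] := Cu.
  have [Kb b1] := normal u u1 cu.
  case/andP: rb => r0 rpi2.
  have Kx : K (ray_point c u (rho - r - r)).
    apply: contrapT => nKx.
    have [n [Kn nx]] := separation Kcp Ks Kc (ray_point1 (rho - r - r) c1 u1 cu) nKx.
    move: nx; rewrite ltNge => /negP; apply.
    apply: (@disk_in_dual _ _ (ray_point c u (rho - r)) _ r).
    - by rewrite r0.
    - exact: ray_point1.
    - exact: ray_point1.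
    - exact: roll.
    - rewrite /ray_point !dot_lin c1 u1 (dotC u) cu.
      have -> : cos r = cos ((rho - r) - (rho - r - r)).
        by congr cos; ring.
      by rewrite [in leLHS]cosB; clear; lra.
  have := Kmu _ Kx; rewrite /ray_point !dot_lin c1 cu mulr1 mulr0 addr0 -cr.
  have h : cos (- (rho - r - r)) < cos rho.
    have := pi_gt0 R; rewrite cos_le_lt; move: rr r0 rpi2 rho_gt0 rhopi2; clear => *; first lra.
      by apply/andP; split; lra.
    by apply/andP; split; lra.
  by move=> /(lt_le_trans h); rewrite cosN ltxx.
exists c, (rho - r); rewrite subrK; split=> //; split=> //.
- by move=> x Kx; rewrite cr; exact: Kmu.
- by split=> // u Cu n Kn; exact: roll.
Qed.

End Structure.

(** * Integrals over intervals *)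

Section ChangeOfVariable.
Context {R : realType}.
Variables (F f : R -> R) (a b : R).
Hypothesis ab : a < b.
Hypothesis dF : forall t, is_derive t (1 : R) F (f t).
Hypothesis cf : continuous f.
Hypothesis f0 : forall t, a < t < b -> 0 < f t.

Local Notation mu := (@lebesgue_measure R).
Let J : set R := `[a, b].
Let I : set R := `[F a, F b].

Let cF : continuous F.
Proof. by move=> t; apply/differentiable_continuous/derivable1_diffP; exact: ex_derive. Qed.

Let mF : measurable_fun [set: R] F. Proof. exact: continuous_measurable_fun. Qed.

Let mf : measurable_fun [set: R] f. Proof. exact: continuous_measurable_fun. Qed.

(** Positivity is assumed only in the interior because the substitutions by cosines have derivatives
    vanishing at 0 and pi; continuity extends the weak inequality to the endpoints. *)
Let f_ge0 t : J t -> 0 <= f t.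
Proof.
rewrite /J/= in_itv/= => /andP[at_ tb].
have cl : forall t, a <= t <= b -> 0 <= f t.
  move=> s /andP[as_ sb]; rewrite leNgt; apply/negP => fs.
  have [e /= e0 he] : \forall y \near s, f y < 0 by exact: (cvgr_lt _ (@cf s) _ fs).
  have [sm|sm] := ltP s ((a + b) / 2).
    pose y := s + Num.min (e / 2) ((b - a) / 4).
    have y1 : 0 < Num.min (e / 2) ((b - a) / 4) by rewrite lt_min !divr_gt0 ?subr_gt0.
    have y2 : Num.min (e / 2) ((b - a) / 4) <= e / 2 by rewrite ge_min lexx.
    have y3 : Num.min (e / 2) ((b - a) / 4) <= (b - a) / 4 by rewrite ge_min lexx orbT.
    have : f y < 0 by apply: he; rewrite /= /y opprD addrA subrr add0r normrN gtr0_norm//; lra.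
    by rewrite ltNge ltW// f0// /y; apply/andP; split; lra.
  pose y := s - Num.min (e / 2) ((b - a) / 4).
  have y1 : 0 < Num.min (e / 2) ((b - a) / 4) by rewrite lt_min !divr_gt0 ?subr_gt0.
  have y2 : Num.min (e / 2) ((b - a) / 4) <= e / 2 by rewrite ge_min lexx.
  have y3 : Num.min (e / 2) ((b - a) / 4) <= (b - a) / 4 by rewrite ge_min lexx orbT.
  have : f y < 0 by apply: he; rewrite /= /y opprB addrC subrK gtr0_norm//; lra.
  by rewrite ltNge ltW// f0// /y; apply/andP; split; lra.
by apply: cl; rewrite at_.
Qed.

Let incrF x y : a <= x -> x < y -> y <= b -> F x < F y.
Proof.
apply: gtr0_derive1_incr => [t _|t|]; first exact: ex_derive.
  by rewrite in_itv/= derive1E => tab; rewrite derive_val f0.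
exact: continuous_subspaceT.
Qed.

Let FTC x y : a <= x -> x <= y -> y <= b ->
  (\int[mu]_(t in `[x, y]) (f t)%:E = (F y - F x)%:E)%E.
Proof.
move=> ax xy yb; have [xy'|xy'] := ltP x y; last first.
  have -> : y = x by apply/le_anti; rewrite xy xy'.
  by rewrite set_itv1 integral_set1 subrr.
rewrite (@continuous_FTC2 _ f F)// ?EFinB//.
- exact: continuous_subspaceT.
- split; first by move=> t _; exact: ex_derive.
  + by apply: cvg_at_right_filter; exact: cF.
  + by apply: cvg_at_left_filter; exact: cF.
- by move=> t _; rewrite derive1E derive_val.
Qed.

(** The image under [F] of the measure of density [f] on [J]; as [f] is the derivative of [F], it
    should be Lebesgue measure on the image interval. *)
Definition density_pushforward (B : set (measurableTypeR R)) : \bar R :=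
  (\int[mu]_(t in J `&` F @^-1` B) (f t)%:E)%E.

Let mJF (B : set (measurableTypeR R)) : measurable B -> measurable (J `&` F @^-1` B).
Proof.
move=> mB; apply: measurableI; first exact: measurable_itv.
by rewrite -[X in measurable X]setTI; exact: mF. Qed.

Let dp0 : density_pushforward set0 = 0%E.
Proof. by rewrite /density_pushforward preimage_set0 setI0 integral_set0. Qed.

Let dp_ge0 B : (0 <= density_pushforward B)%E.
Proof. by apply: integral_ge0 => t [/f_ge0 ft _]; rewrite lee_fin. Qed.

Let dp_sigma : semi_sigma_additive density_pushforward.
Proof.
move=> A mA tA mUA; rewrite /density_pushforward preimage_bigcup setI_bigcupr.
rewrite (@ge0_integral_bigcup _ _ _ mu (fun k => J `&` F @^-1` (A k)) (EFin \o f))//.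
- apply: is_cvg_ereal_nneg_natsum_cond => n _ _.
  by apply: integral_ge0 => t [/f_ge0 ft _]; rewrite lee_fin.
- by move=> k; exact: mJF.
- by apply/measurable_EFinP; apply: measurable_funS mf.
- by move=> t [k _ [/f_ge0 ft _]]; rewrite lee_fin.
- move=> i j _ _ [t [[_ Ai] [_ Aj]]].
  by apply: (tA i j) => //; exists (F t).
Qed.

HB.instance Definition _ := isMeasure.Build _ _ _ density_pushforward
  dp0 dp_ge0 dp_sigma.

(** Both measures are finite on half-lines, a generating family stable under intersection. On a
    half-line ending at an intermediate value [F t0], agreement is the fundamental theorem of
    calculus. *)
Let cv_measure (B : set (measurableTypeR R)) : measurable B -> mu (B `&` I) = density_pushforward B.
Proof.
have Fab : F a < F b by exact: incrF.
have mI : measurable I by exact: measurable_itv.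
pose m1 := mrestr mu mI.
have Fin t : a <= t <= b -> F a <= F t <= F b.
  have le x y : a <= x -> x <= y -> y <= b -> F x <= F y.
    by move=> ax; rewrite [x <= y]le_eqVlt => /predU1P[->//|xy] yb; rewrite ltW// incrF.
  by move=> /andP[at_ tb]; rewrite !le.
have FJ t : J t -> F a <= F t <= F b by rewrite /J/= in_itv/=; exact: Fin.
have total : density_pushforward [set: R] = (F b - F a)%:E.
  by rewrite /density_pushforward preimage_setT setIT; exact: FTC (lexx _) (ltW ab) (lexx _).
have m1E (B' : set (measurableTypeR R)) : m1 B' = mu (B' `&` I) by [].
have key (x : R) : m1 `]-oo, x[%classic = density_pushforward `]-oo, x[%classic.
  rewrite m1E.
  have [xa|xa] := leP x (F a).
    have -> : `]-oo, x[ `&` I = set0.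
      apply/seteqP; split=> // y [] /=; rewrite /I /= !in_itv/= => yx /andP[ay _].
      lra.
    rewrite measure0 /density_pushforward.
    have -> : J `&` F @^-1` `]-oo, x[ = set0.
      apply/seteqP; split=> // t [/FJ /andP[h _]] /=; rewrite in_itv/=.
      lra.
    by rewrite integral_set0.
  have [bx|xb] := ltP (F b) x.
    have -> : `]-oo, x[ `&` I = I.
      apply/setIidPr => y; rewrite /I /= !in_itv/= => /andP[_]; lra.
    rewrite /I lebesgue_measure_itv/= lte_fin Fab -EFinB -total /density_pushforward.
    rewrite preimage_setT setIT; congr integral.
    apply/esym/setIidPl => t /FJ/andP[_ h] /=; rewrite in_itv/=; lra.
  have xm : Num.min (F a) (F b) <= x <= Num.max (F a) (F b).
    by rewrite (min_idPl (ltW Fab)) (max_idPr (ltW Fab)) xb ltW.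
  have [t0 + Ft0] := @IVT R F a b x (ltW ab) (continuous_subspaceT cF) xm.
  rewrite in_itv/= => /andP[at0 t0b].
  have t0a : a < t0.
    by rewrite lt_def at0 andbT; apply/eqP => h; rewrite -Ft0 h ltxx in xa.
  have -> : `]-oo, x[ `&` I = `[F a, x[%classic.
    apply/seteqP; split=> y; rewrite /I /= !in_itv/=; first by move=> [-> /andP[->]].
    by move=> /andP[-> yx]; split=> //=; rewrite (le_trans (ltW yx)).
  rewrite lebesgue_measure_itv/= lte_fin xa -EFinB -Ft0 -FTC// /density_pushforward.
  rewrite -integral_itv_bndo_bndc; last first.
    by apply/measurable_EFinP; apply: measurable_funS mf.
  congr integral; apply/seteqP; split=> t; rewrite /J /= !in_itv/=.
    move=> /andP[at_ tt0]; rewrite at_ ltW ?(lt_le_trans tt0)//; split=> //.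
    exact: incrF.
  move=> [/andP[at_ tb] h]; rewrite at_/= ltNge; apply/negP; rewrite le_eqVlt.
  case/predU1P => [t0t|t0t]; first by rewrite t0t ltxx in h.
  by have := lt_trans h (incrF at0 t0t tb); rewrite ltxx.
move=> mB; rewrite -m1E.
pose M1 : {measure set (measurableTypeR R) -> \bar R} := mrestr mu mI.
pose M2 : {measure set (measurableTypeR R) -> \bar R} := density_pushforward.
suff : M1 B = M2 B by [].
apply: (@measure_unique _ R (measurableTypeR R) (@RGenInftyO.G R) (fun k => `]-oo, k%:R[%classic)) => //.
- exact: RGenInftyO.measurableE.
- move=> _ _ [x ->] [y ->]; exists (Num.min x y).
  apply/seteqP; split=> z /=; rewrite !in_itv/= lt_min; first by move=> [-> ->].
  by move=> /andP[].
- by move=> k; exists k%:R.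
- apply/seteqP; split=> // z _; exists (Num.truncn `|z|).+1 => //=.
  by rewrite in_itv/= (le_lt_trans (ler_norm z))// truncnS_gt.
- by move=> _ [x ->]; exact: key.
- move=> k; rewrite -[M1 _]/(mu (`]-oo, k%:R[%classic `&` I)) (@le_lt_trans _ _ (mu I))//.
    by apply: le_measure; rewrite ?inE//; apply: measurableI.
  by rewrite /I lebesgue_measure_itv/= lte_fin Fab -EFinB ltry.
Qed.

Import HBNNSimple.

Let cv_simple (h : {nnsfun (measurableTypeR R) >-> R}) :
  (\int[mu]_(y in I) (h y)%:E = \int[mu]_(t in J) (h (F t) * f t)%:E)%E.
Proof.
have mI : measurable I by exact: measurable_itv.
have mJ : measurable J by exact: measurable_itv.
have hE x : h x = \sum_(r <- finmap.enum_fset (fset_set (range h))) r * \1_(h @^-1` [set r]) x.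
  by rewrite fimfunE fsbig_finite//; exact: fimfunP.
under eq_integral do rewrite hE -sumEFin.
under [RHS]eq_integral do rewrite hE mulr_suml -sumEFin.
have mind r : measurable_fun [set: measurableTypeR R] (\1_(h @^-1` [set r]) : _ -> R).
  exact: measurable_indic.
have mindF r : measurable_fun [set: measurableTypeR R] (fun t => \1_(h @^-1` [set r]) (F t) : R).
  exact: measurableT_comp (mind r) mF.
rewrite ge0_integral_sum//; last 2 first.
- by move=> r; apply/measurable_EFinP; apply: measurable_funM.
- by move=> r x _; rewrite EFinM nnfun_muleindic_ge0.
rewrite ge0_integral_sum//; last 2 first.
- move=> r; apply/measurable_EFinP; apply: measurable_funM; last exact: measurable_funS mf.
  by apply: measurable_funM => //; exact: measurable_funS (mindF r).
- move=> r x /f_ge0 fx; rewrite EFinM mule_ge0// ?lee_fin//.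
  by have := nnfun_muleindic_ge0 h r (F x); rewrite -EFinM lee_fin.
apply: eq_bigr => r _.
have [r0|r0] := ltP r 0.
  rewrite preimage_nnfun0//.
  by rewrite !integral0_eq// => x _; rewrite indic0 mulr0 ?mul0r.
set B := h @^-1` [set r].
have mB : measurable B by exact: measurable_sfunP.
under eq_integral do rewrite EFinM.
rewrite ge0_integralZl_EFin//; last first.
  by apply/measurable_EFinP; exact: measurable_funS (mind r).
under [RHS]eq_integral do rewrite -mulrA EFinM.
rewrite ge0_integralZl_EFin//; last 2 first.
- by move=> x /f_ge0 fx; rewrite lee_fin mulr_ge0.
- apply/measurable_EFinP; apply: measurable_funM; last exact: measurable_funS mf.
  exact: measurable_funS (mindF r).
congr (_ * _)%E; transitivity (mu (B `&` I)); first exact: integral_indic.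
rewrite cv_measure// /density_pushforward.
rewrite integral_mkcondr; apply: eq_integral => t _.
rewrite patchE; case: ifPn => tB.
  by rewrite indicE mem_set ?mul1r//; rewrite inE in tB.
rewrite indicE memNset ?mul0r//; by move=> h'; move/negP: tB; apply; rewrite inE.
Qed.

(** Since the indicator functions of slices are merely measurable, the formula is built from
    measures through simple functions and monotone convergence. *)
Lemma change_of_variable (g : R -> \bar R) : measurable_fun [set: measurableTypeR R] g ->
  (forall y, (0 <= g y)%E) ->
  (\int[mu]_(y in I) g y = \int[mu]_(t in J) (g (F t) * (f t)%:E))%E.
Proof.
move=> mg g0.
have mI : measurable I by exact: measurable_itv.
have mJ : measurable J by exact: measurable_itv.
pose g_ := nnsfun_approx measurableT mg.
have g_cvg y : (g_ n y)%:E @[n --> \oo] --> g y.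
  by apply: cvg_nnsfun_approx.
have g_nd y n m : (n <= m)%N -> g_ n y <= g_ m y.
  by move=> nm; exact/lefP/nd_nnsfun_approx.
have l1 : (\int[mu]_(y in I) (g_ n y)%:E)%E @[n --> \oo] --> (\int[mu]_(y in I) g y)%E.
  have := @cvg_monotone_convergence _ _ _ mu I mI (fun n y => (g_ n y)%:E).
  have -> : (fun x => limn (fun n => (g_ n x)%:E)) = g.
    by apply/funext => y; apply/cvg_lim.
  apply=> //.
  - by move=> n; exact/measurable_EFinP/measurable_funTS.
  - by move=> n x _; rewrite lee_fin.
  - by move=> x _ n m nm; rewrite lee_fin g_nd.
have l2 : (\int[mu]_(t in J) (g_ n (F t) * f t)%:E)%E @[n --> \oo] -->
    (\int[mu]_(t in J) (g (F t) * (f t)%:E))%E.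
  have := @cvg_monotone_convergence _ _ _ mu J mJ (fun n t => (g_ n (F t) * f t)%:E).
  rewrite (@eq_integral _ _ _ mu J (fun t => g (F t) * (f t)%:E)%E
     (fun x => limn (fun n => (g_ n (F x) * f x)%:E))); last first.
    move=> t _; apply/cvg_lim => //; under eq_fun do rewrite EFinM.
    by apply: cvgeZr => //; exact: g_cvg.
  apply=> //.
  - move=> n; apply/measurable_EFinP; apply: measurable_funM; last exact: measurable_funS mf.
    have mg_ : measurable_fun [set: measurableTypeR R] (g_ n) by [].
    exact: measurable_funTS (measurableT_comp mg_ mF).
  - by move=> n x /f_ge0 fx; rewrite lee_fin mulr_ge0.
  - by move=> x /f_ge0 fx n m nm; rewrite lee_fin ler_wpM2r// g_nd.
have e : (fun n => \int[mu]_(t in J) (g_ n (F t) * f t)%:E)%E =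
    (fun n => \int[mu]_(y in I) (g_ n y)%:E)%E.
  by apply/funext => n; rewrite cv_simple.
rewrite e in l2; exact: (cvg_unique _ l1 l2).
Qed.

End ChangeOfVariable.

(** * Measurability of preimages of closed sets *)

Section ClosedPreimage.
Context {R : realType} d (T : measurableType d).

(** The complement of [K] is a union of countably many boxes with rational centers, and the preimage
    of a box only involves the coordinates. *)
Lemma measurable_preimage_closed (K : set 'rV[R]_3) (f : T -> 'rV[R]_3) :
  closed K -> (forall i, measurable_fun [set: T] (fun t => f t 0 i : measurableTypeR R)) ->
  measurable (f @^-1` K).
Proof.
move=> cK mf; suff mC : measurable (f @^-1` (~` K)).
  by have := measurableC mC; rewrite preimage_setC setCK.
pose box (qn : 'rV[rat]_3 * nat) : set 'rV[R]_3 :=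
  [set x | forall i, `|x 0 i - ratr (qn.1 0 i)| < qn.2.+1%:R^-1].
have -> : f @^-1` (~` K) = \bigcup_(qn in [set qn | box qn `<=` ~` K]) (f @^-1` (box qn)).
  apply/seteqP; split=> [t /= tK|t [qn /= sub tb]]; last exact: sub.
  have /nbhs_ballP[e /= e0 he] : nbhs (f t) (~` K).
    by apply: open_nbhs_nbhs; split => //; exact: closed_openC.
  have [n hn] : exists n : nat, n.+1%:R^-1 < e / 2.
    exists (Num.truncn (e / 2)^-1); rewrite invf_plt ?posrE ?ltr0n ?divr_gt0//.
    exact: truncnS_gt.
  have /choice[q hq] : forall i, exists q : rat, `|f t 0 i - ratr q| < n.+1%:R^-1.
    move=> i; have [e1 -> e10] : exists2 e1 : R, n.+1%:R^-1 = e1 & 0 < e1.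
      by exists (n.+1%:R^-1) => //; rewrite invr_gt0 ltr0n.
    have /rat_in_itvoo[q] : f t 0 i - e1 < f t 0 i + e1 by lra.
    by rewrite in_itv/= => /andP[h1 h2]; exists q; rewrite ltr_norml; apply/andP; split; lra.
  exists (\row_i q i, n) => [/= x xb|i]; last by rewrite /= mxE; exact: hq.
  apply: he; split=> // i j; rewrite ord1; have := xb j; rewrite /= mxE; have := hq j.
  move: (n.+1%:R^-1) hn => e1 he1.
  rewrite /ball/= !ltr_norml => /andP[? ?] /andP[? ?]; apply/andP; split; lra.
rewrite bigcup_mkcond; apply: countable_bigcupT_measurable => [|[q n]].
  exact: countableP.
case: ifP => _ //.
suff mi i : measurable [set t | `|f t 0 i - ratr (q 0 i)| < n.+1%:R^-1].
  rewrite (_ : f @^-1` box (q, n) = [set t | `|f t 0 i0 - ratr (q 0 i0)| < n.+1%:R^-1] `&`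
      [set t | `|f t 0 i1 - ratr (q 0 i1)| < n.+1%:R^-1] `&`
      [set t | `|f t 0 i2 - ratr (q 0 i2)| < n.+1%:R^-1]).
    by apply: measurableI => //; exact: measurableI.
  apply/seteqP; split=> t /=; first by move=> h; split; [split|]; exact: h.
  by move=> [[h0 h1] h2]; exact: forall_ord3.
have -> : [set t | `|f t 0 i - ratr (q 0 i)| < n.+1%:R^-1] =
    (fun t => f t 0 i : measurableTypeR R) @^-1`
      `]ratr (q 0 i) - n.+1%:R^-1, ratr (q 0 i) + n.+1%:R^-1[%classic.
  move: (n.+1%:R^-1) => e1.
  apply/seteqP; split=> t /=; rewrite in_itv/= ltr_norml => /andP[? ?]; apply/andP; split; lra.
by rewrite -[X in measurable X]setTI; apply: mf.
Qed.

End ClosedPreimage.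

(** * Iterated integrals over measurable sets *)

Section Tonelli.
Context {R : realType}.
Local Notation mu := (@lebesgue_measure R).

Let restr_prod (g : R * R -> \bar R) (B : set (measurableTypeR R)) (x : R) :
  (\int[mu]_(y in B) g (x, y) = \int[mu]_y ((g \_ [set p | B p.2]) (x, y)))%E.
Proof.
rewrite integral_mkcond; apply: eq_integral => y _; rewrite !patchE.
by have -> : ((x, y) \in [set p : R * R | B p.2]) = (y \in B) by apply/idP/idP; rewrite !inE.
Qed.

Let measurable_restr (g : R * R -> \bar R) (B : set (measurableTypeR R)) : measurable B ->
  measurable_fun [set: measurableTypeR R * measurableTypeR R] g ->
  measurable_fun [set: measurableTypeR R * measurableTypeR R] (g \_ [set p | B p.2]).
Proof.
move=> mB mg; apply: (proj1 (@measurable_restrictT _ _ (measurableTypeR R * measurableTypeR R)%type _ _ _ _)).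
  by rewrite -[X in measurable X]setTI; exact: (@measurable_snd _ _ (measurableTypeR R) (measurableTypeR R) measurableT _ mB).
exact: measurable_funTS.
Qed.

Lemma measurable_slice (g : R * R -> \bar R) (B : set (measurableTypeR R)) : measurable B ->
  measurable_fun [set: measurableTypeR R * measurableTypeR R] g -> (forall p, (0 <= g p)%E) ->
  measurable_fun [set: measurableTypeR R] (fun x => \int[mu]_(y in B) g (x, y))%E.
Proof.
move=> mB mg g0; under eq_fun do rewrite restr_prod.
apply: (@measurable_fun_fubini_tonelli_F _ _ _ (measurableTypeR R) R mu (g \_ [set p | B p.2])).
  exact: measurable_restr.
by move=> p; rewrite patchE; case: ifP.
Qed.

Lemma tonelli_swap (g : R * R -> \bar R) (A B : set (measurableTypeR R)) :
  measurable A -> measurable B ->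
  measurable_fun [set: measurableTypeR R * measurableTypeR R] g -> (forall p, (0 <= g p)%E) ->
  (\int[mu]_(x in A) \int[mu]_(y in B) g (x, y) = \int[mu]_(y in B) \int[mu]_(x in A) g (x, y))%E.
Proof.
move=> mA mB mg g0.
pose h := g \_ (A `*` B).
have mh : measurable_fun [set: measurableTypeR R * measurableTypeR R] h.
  apply: (proj1 (@measurable_restrictT _ _ (measurableTypeR R * measurableTypeR R)%type _ _ _ _)).
    exact: measurableX.
  exact: measurable_funTS.
have h0 p : (0 <= h p)%E by rewrite /h patchE; case: ifP.
have /= := @sfinite_Fubini _ _ (measurableTypeR R) (measurableTypeR R) R mu mu h h0 mh.
have hE x y : h (x, y) = if (x \in A) && (y \in B) then g (x, y) else 0%E.
  by rewrite /h patchE in_setX.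
have -> : (\int[mu]_x \int[mu]_y h (x, y) = \int[mu]_(x in A) \int[mu]_(y in B) g (x, y))%E.
  rewrite [RHS]integral_mkcond; apply: eq_integral => x _; rewrite patchE.
  under eq_integral do rewrite hE.
  case: ifP => xA /=; last by rewrite integral0.
  by rewrite [RHS]integral_mkcond; apply: eq_integral => y _; rewrite patchE.
move=> ->; rewrite [RHS]integral_mkcond; apply: eq_integral => y _; rewrite patchE.
under eq_integral do rewrite hE andbC.
case: ifP => yB /=; last by rewrite integral0.
by rewrite [RHS]integral_mkcond; apply: eq_integral => x _; rewrite patchE.
Qed.

End Tonelli.

(** * Splitting, shifting and reflecting integrals over intervals *)

Section IntervalIntegrals.
Context {R : realType}.
Local Notation mu := (@lebesgue_measure R).
Implicit Types (g : R -> \bar R) (a b c : R).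

Lemma integral_itv_split g a b c : measurable_fun [set: measurableTypeR R] g ->
  (forall t, (0 <= g t)%E) -> a <= b -> b <= c ->
  (\int[mu]_(t in `[a, c]) g t = \int[mu]_(t in `[a, b]) g t + \int[mu]_(t in `[b, c]) g t)%E.
Proof.
move=> mg g0 ab bc.
have -> : `[a, c]%classic = `[a, b] `|` `]b, c].
  apply/seteqP; split=> t /=; rewrite !in_itv/=.
    by move=> /andP[-> ->]; have [h|h] := leP t b; [left|right].
  by move=> [/andP[-> h]|/andP[h ->]]; rewrite ?(le_trans h)//= (le_trans ab)// ltW.
rewrite ge0_integral_setU//; last 2 first.
- exact: measurable_funTS.
- apply/disj_setPS => t [/=]; rewrite !in_itv/= => /andP[_ tb] /andP[bt _].
  by have := lt_le_trans bt tb; rewrite ltxx.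
by congr (_ + _)%E; apply: integral_itv_obnd_cbnd; exact: measurable_funTS.
Qed.

Lemma integral_itv_opp g a b : measurable_fun [set: measurableTypeR R] g ->
  (forall t, (0 <= g t)%E) ->
  (\int[mu]_(t in `[a, b]) g t = \int[mu]_(t in `[(- b)%R, (- a)%R]) g (- t)%R)%E.
Proof.
move=> mg g0.
have -> : `[- b, - a]%classic = (-%R : _ -> measurableTypeR R) @^-1` `[a, b].
  by apply/seteqP; split=> t /=; rewrite !in_itv/= lerNl lerNr andbC.
rewrite -ge0_integral_pushforward//=; last exact: measurable_funTS.
by apply: eq_measure_integral => //= A mA AS; exact/esym/lebesgue_measureN.
Qed.

Lemma integral_itv_shift g a b c : measurable_fun [set: measurableTypeR R] g ->
  (forall t, (0 <= g t)%E) ->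
  (\int[mu]_(t in `[(a + c)%R, (b + c)%R]) g t = \int[mu]_(t in `[a, b]) g (t + c)%R)%E.
Proof.
move=> mg g0; have [ab|ab|->] := ltgtP a b; last by rewrite !set_itv1 !integral_set1.
  have dF t : is_derive t (1 : R) (fun t => t + c) 1 by apply: is_derive_eq; rewrite addr0.
  rewrite (change_of_variable ab dF (@cst_continuous _ _ _) _ mg g0); last by move=> *; exact: ltr01.
  by apply: eq_integral => t _; rewrite mule1.
by rewrite !set_itv_ge ?integral_set0// bnd_simp -ltNge// ltrD2r.
Qed.

Lemma integral_itv_periodic g c a : measurable_fun [set: measurableTypeR R] g ->
  (forall t, (0 <= g t)%E) -> (forall t, g (t + c) = g t) -> 0 <= a <= c ->
  (\int[mu]_(t in `[0%R, c]) g (t + a)%R = \int[mu]_(t in `[0%R, c]) g t)%E.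
Proof.
move=> mg g0 gc /andP[a0 ac].
rewrite -integral_itv_shift// add0r (@integral_itv_split _ a c)//; last by rewrite lerDl.
rewrite [RHS](@integral_itv_split _ 0 a)// addeC; congr (_ + _)%E.
rewrite -{1}[c]add0r [c + a]addrC integral_itv_shift//.
by apply: eq_integral => t _; rewrite gc.
Qed.

Lemma integral_itv_reflect g a b c : measurable_fun [set: measurableTypeR R] g ->
  (forall t, (0 <= g t)%E) ->
  (\int[mu]_(t in `[a, b]) g t = \int[mu]_(t in `[(c - b)%R, (c - a)%R]) g (c - t)%R)%E.
Proof.
move=> mg g0; rewrite integral_itv_opp//.
have mN : measurable_fun [set: measurableTypeR R] (fun t => g (- t)).
  exact: (measurableT_comp mg).
have mB : measurable_fun [set: measurableTypeR R] (fun t => g (c - t)).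
  by apply: (measurableT_comp mg); exact: measurable_funB.
rewrite ![c - _]addrC integral_itv_shift//.
by apply: eq_integral => t _; rewrite opprD addrC subrK.
Qed.

End IntervalIntegrals.

(** * Area in an orthonormal frame *)

(** The changes of coordinates below degenerate at the endpoints, which have measure zero. *)
Lemma eq_integral_itvoo {R : realType} (g h : R -> \bar R) (a b : R) :
  measurable_fun [set: measurableTypeR R] g -> measurable_fun [set: measurableTypeR R] h ->
  (forall t, a < t < b -> g t = h t) ->
  (\int[@lebesgue_measure R]_(t in `[a, b]) g t = \int[@lebesgue_measure R]_(t in `[a, b]) h t)%E.
Proof.
move=> mg mh gh; have mo : measurable (`]a, b[%classic : set (measurableTypeR R)) by exact: measurable_itv.
rewrite (@integral_itv_bndoo _ a b g true false); last exact: measurable_funTS.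
rewrite (@integral_itv_bndoo _ a b h true false); last exact: measurable_funTS.
by apply: eq_integral => t; rewrite inE/= in_itv/=; exact: gh.
Qed.

Section AreaFrame.
Context {R : realType}.
Local Notation mu := (@lebesgue_measure R).
Local Notation RR := (measurableTypeR R).
Implicit Types (u v c : 'rV[R]_3) (K : set 'rV[R]_3).

Definition frame_point u v c (phi theta : R) : 'rV[R]_3 :=
  (sin phi * cos theta) *: u + (sin phi * sin theta) *: v + cos phi *: c.

(** The absolute value is that of a nonnegative number on the interval from 0 to pi; it keeps the
    density nonnegative on the whole plane, as Tonelli's theorem asks. *)
Definition slice_density u v c K (p : R * R) : \bar R :=
  (`|sin p.2| * \1_K (frame_point u v c p.2 p.1))%:E.

Definition slice_area u v c K (theta : R) : \bar R :=
  (\int[mu]_(phi in `[0%R, pi]) slice_density u v c K (theta, phi))%E.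

Definition area_frame u v c K : \bar R :=
  (\int[mu]_(theta in `[0%R, (2 * pi)%R]) slice_area u v c K theta)%E.

(** The hemisphere on the side of [v], on which the orthogonal projection along [v] is injective. *)
Definition half_area u v c K : \bar R :=
  (\int[mu]_(theta in `[0%R, pi]) slice_area u v c K theta)%E.

Lemma slice_density_ge0 u v c K p : (0 <= slice_density u v c K p)%E.
Proof. by rewrite lee_fin mulr_ge0. Qed.

Lemma slice_area_ge0 u v c K theta : (0 <= slice_area u v c K theta)%E.
Proof. by apply: integral_ge0 => phi _; exact: slice_density_ge0. Qed.

Lemma measurable_indic_closed d (T : measurableType d) K (f : T -> 'rV[R]_3) : closed K ->
  (forall i, measurable_fun [set: T] (fun t => f t 0 i : RR)) ->
  measurable_fun [set: T] (fun t => \1_K (f t) : R).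
Proof.
move=> cK mf; have -> : (fun t => \1_K (f t) : R) = \1_(f @^-1` K).
  by apply/funext => t; rewrite !indicE; congr (_ _ : R); apply/idP/idP; rewrite !inE.
by apply: measurable_indic; exact: measurable_preimage_closed.
Qed.

Lemma measurable_slice_density u v c K : closed K ->
  measurable_fun [set: RR * RR] (slice_density u v c K).
Proof.
move=> cK; apply/measurable_EFinP.
have msin : measurable_fun [set: RR] (sin : R -> R) by apply: continuous_measurable_fun; exact: continuous_sin.
have mcos : measurable_fun [set: RR] (cos : R -> R) by apply: continuous_measurable_fun; exact: continuous_cos.
have ms : measurable_fun [set: RR * RR] (fun p : RR * RR => sin p.2 : R).
  exact: (measurableT_comp msin).
have mc : measurable_fun [set: RR * RR] (fun p : RR * RR => cos p.2 : R).
  exact: (measurableT_comp mcos).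
have ms1 : measurable_fun [set: RR * RR] (fun p : RR * RR => sin p.1 : R).
  exact: (measurableT_comp msin).
have mc1 : measurable_fun [set: RR * RR] (fun p : RR * RR => cos p.1 : R).
  exact: (measurableT_comp mcos).
apply: measurable_funM; first exact: measurableT_comp.
apply: measurable_indic_closed => // i; under eq_fun do rewrite !mxE.
by apply: measurable_funD; [apply: measurable_funD|]; apply: measurable_funM => //; exact: measurable_funM.
Qed.

Lemma measurable_slice_area u v c K : closed K ->
  measurable_fun [set: RR] (slice_area u v c K).
Proof.
move=> cK; apply: measurable_slice => //; first exact: measurable_slice_density.
exact: slice_density_ge0.
Qed.

(** The reflection of the longitude about pi exchanges [v] and [- v]. *)
Lemma half_area_split u v c K : closed K ->
  area_frame u v c K = (half_area u v c K + half_area u (- v) c K)%E.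
Proof.
move=> cK; have pi0 := pi_gt0 R.
have ms := @measurable_slice_area u v c K cK.
have s0 := @slice_area_ge0 u v c K.
have -> : half_area u (- v) c K = (\int[mu]_(theta in `[pi, (2 * pi)%R]) slice_area u v c K theta)%E.
  rewrite (@integral_itv_reflect R _ pi (2 * pi) (2 * pi) ms s0).
  rewrite subrr (_ : 2 * pi - pi = pi :> R); last by ring.
  apply: eq_integral => t _; apply: eq_integral => phi _.
  rewrite /slice_density/= /frame_point (_ : 2 * pi - t = - t + pi *+ 2); last by rewrite mulr_natl addrC.
  by rewrite cosD2pi sinD2pi cosN sinN mulrN scaleNr -scalerN.
by apply: integral_itv_split => //; lra.
Qed.

(* Orthogonal projection of the half sphere onto the plane of [u] and [c];
   the area density in the projected coordinates is symmetric in them. *)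
Definition projected_density u v c K (p : R * R) : \bar R :=
  (if p.1 ^+ 2 + p.2 ^+ 2 < 1 then
     (1 - p.1 ^+ 2 - p.2 ^+ 2) `^ (- 2^-1) *
     \1_K (- p.1 *: u + Num.sqrt (1 - p.1 ^+ 2 - p.2 ^+ 2) *: v + - p.2 *: c)
   else 0)%:E.

Lemma projected_density_ge0 u v c K p : (0 <= projected_density u v c K p)%E.
Proof. by rewrite lee_fin; case: ifP => // _; rewrite mulr_ge0// powR_ge0. Qed.

Lemma measurable_projected_density u v c K : closed K ->
  measurable_fun [set: RR * RR] (projected_density u v c K).
Proof.
move=> cK; apply/measurable_EFinP.
have m1 : measurable_fun [set: RR * RR] (fun p : RR * RR => p.1 : R) by exact: measurable_fst.
have m2 : measurable_fun [set: RR * RR] (fun p : RR * RR => p.2 : R) by exact: measurable_snd.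
have m11 := measurable_funX 2 m1; have m22 := measurable_funX 2 m2.
have m3 : measurable_fun [set: RR * RR] (fun p : RR * RR => 1 - p.1 ^+ 2 - p.2 ^+ 2 : R).
  by apply: measurable_funB => //; apply: measurable_funB.
apply: measurable_fun_if => //.
- by apply: measurable_fun_ltr => //; exact: measurable_funD.
- apply: measurable_funTS; apply: measurable_funM.
    by apply: (measurableT_comp (measurable_powR _)).
  apply: measurable_indic_closed => // i; under eq_fun do rewrite !mxE.
  apply: measurable_funD; [apply: measurable_funD|]; apply: measurable_funM => //.
  + exact: measurableT_comp.
  + apply: (measurableT_comp _ m3); apply: continuous_measurable_fun; exact: sqrt_continuous.
  + exact: measurableT_comp.
Qed.

(** The substitution is [x = - sin phi * cos theta], increasing in [theta], which explains the minus
    signs in [projected_density]. Its Jacobian [sin phi * sin theta] is the square root of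
    [1 - x ^+ 2 - z ^+ 2] and cancels the density; beyond the range of [x] the density is 0. *)
Let inner_projection u v c K phi : closed K -> 0 < phi < pi ->
  (\int[mu]_(theta in `[0%R, pi]) slice_density u v c K (theta, phi) =
   (\int[mu]_(x in `[(-1)%R, 1%R]) projected_density u v c K (x, (- cos phi)%R)) * (sin phi)%:E)%E.
Proof.
move=> cK phi0; have pi0 := pi_gt0 R; set s := sin phi; set z := - cos phi.
have s0 : 0 < s by apply: sin_gt0_pi.
have sz : s ^+ 2 + z ^+ 2 = 1 by rewrite /s /z sqrrN addrC cos2Dsin2.
have s1 : s <= 1 by rewrite /s sin_le1.
have mk : measurable_fun [set: RR] (fun x => projected_density u v c K (x, z)).
  by apply: (measurableT_comp (measurable_projected_density u v c cK)); exact: measurable_fun_pair.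
have k0 x : (0 <= projected_density u v c K (x, z))%E by exact: projected_density_ge0.
have kout x : s ^+ 2 <= x ^+ 2 -> projected_density u v c K (x, z) = 0%E.
  by move=> h; rewrite /projected_density/= ltNge (_ : 1 <= _)//; lra.
have -> : (\int[mu]_(x in `[(-1)%R, 1%R]) projected_density u v c K (x, z) =
    \int[mu]_(x in `[(- s)%R, s]) projected_density u v c K (x, z))%E.
  rewrite (@integral_itv_split _ _ (-1) (- s) 1)//; [|lra|lra].
  rewrite (@integral_itv_split _ _ (- s) s 1)//; [|lra].
  rewrite [X in (X + _)%E]integral0_eq ?add0e; last first.
    by move=> x /=; rewrite in_itv/= => /andP[x1 x2]; apply: kout; nra.
  rewrite [X in (_ + X)%E]integral0_eq ?adde0//.
  by move=> x /=; rewrite in_itv/= => /andP[x1 x2]; apply: kout; nra.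
pose F t := - s * cos t; pose f t := s * sin t.
have dF t : is_derive t (1 : R) F (f t).
  by rewrite /F /f; apply: is_derive_eq; rewrite /GRing.scale/= mulrN mulNr opprK; ring.
have cf : continuous f.
  by move=> t; apply: cvgM; [exact: cvg_cst|exact: continuous_sin].
have f0 t : 0 < t < pi -> 0 < f t by move=> /sin_gt0_pi ?; rewrite mulr_gt0.
have := @change_of_variable R F f 0 pi pi0 dF cf f0 _ mk k0.
rewrite /F cos0 cospi mulr1 mulrN1 opprK => ->.
have mF : measurable_fun [set: RR] F.
  by apply: continuous_measurable_fun => t; apply: differentiable_continuous; apply/derivable1_diffP; exact: ex_derive.
have mf : measurable_fun [set: RR] f by exact: continuous_measurable_fun.
have mL : measurable_fun [set: RR] (fun t => (projected_density u v c K (F t, z) * (f t)%:E)%E).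
  by apply: emeasurable_funM; [exact: (measurableT_comp mk mF)|exact/measurable_EFinP].
have mS : measurable_fun [set: RR] (fun t => slice_density u v c K (t, phi)).
  by apply: (measurableT_comp (measurable_slice_density u v c cK)); exact: measurable_fun_pair.
have fs0 t : t \in `[0, pi] -> 0 <= f t.
  by rewrite in_itv/= => /andP[t0 tpi]; apply: mulr_ge0; [exact: ltW|by apply: sin_ge0_pi; rewrite t0].
have mD : measurable (`[0, pi]%classic : set RR) by exact: measurable_itv.
rewrite muleC -(@ge0_integralZl_EFin _ RR R mu `[0, pi]%classic)//; last 3 first.
- by move=> t /fs0 ft; rewrite mule_ge0// lee_fin.
- exact: measurable_funTS.
- exact: ltW.
apply: eq_integral_itvoo => [//||t t0].
  exact: measurable_funeM.
have ft := f0 _ t0; rewrite /slice_density /projected_density/= /F -/s -/z.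
have e : 1 - (- s * cos t) ^+ 2 - z ^+ 2 = f t ^+ 2.
  rewrite (_ : z ^+ 2 = 1 - s ^+ 2); last by rewrite -sz [s ^+ 2 + _]addrC addrK.
  transitivity (s ^+ 2 * (cos t ^+ 2 + sin t ^+ 2) - s ^+ 2 * cos t ^+ 2).
    by rewrite cos2Dsin2; ring.
  by rewrite /f; ring.
have -> : (- s * cos t) ^+ 2 + z ^+ 2 < 1.
  have := exprn_gt0 2 ft; rewrite -e; lra.
rewrite e powRN powR12_sqrt ?sqr_ge0// sqrtr_sqr (gtr0_norm ft) (gtr0_norm s0).
rewrite -!EFinM; congr (_%:E); rewrite /frame_point -/s -/(f t) mulNr opprK /z opprK.
move: (\1_K _) => i; congr (s * _).
by rewrite mulrAC mulVf ?mul1r// gt_eqF.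
Qed.

Let swap_pair (g : R * R -> \bar R) : measurable_fun [set: RR * RR] g ->
  measurable_fun [set: RR * RR] (fun p : R * R => g (p.2, p.1)).
Proof.
move=> mg; apply: (measurableT_comp mg).
by apply: measurable_fun_pair; [exact: measurable_snd|exact: measurable_fst].
Qed.

Let half_area_projected u v c K : closed K ->
  half_area u v c K = (\int[mu]_(z in `[(-1)%R, 1%R])
    \int[mu]_(x in `[(-1)%R, 1%R]) projected_density u v c K (x, z))%E.
Proof.
move=> cK; have pi0 := pi_gt0 R.
pose G z : \bar R := (\int[mu]_(x in `[(-1)%R, 1%R]) projected_density u v c K (x, z))%E.
have mG : measurable_fun [set: RR] G.
  apply: (@measurable_slice R (fun p => projected_density u v c K (p.2, p.1))) => //.
    by apply: swap_pair; exact: measurable_projected_density.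
  by move=> p; exact: projected_density_ge0.
have G0 z : (0 <= G z)%E by apply: integral_ge0 => t _; exact: projected_density_ge0.
pose F t : R := - cos t.
have dF t : is_derive t (1 : R) F (sin t).
  by rewrite /F; apply: is_derive_eq; rewrite opprK.
have := @change_of_variable R F (@sin R) 0 pi pi0 dF (@continuous_sin R) (@sin_gt0_pi R) _ mG G0.
rewrite {1}/F {1}/F cos0 cospi opprK => ->.
rewrite /half_area /slice_area tonelli_swap//; last 2 first.
- exact: measurable_slice_density.
- exact: slice_density_ge0.
apply: eq_integral_itvoo.
- apply: (@measurable_slice R (fun p => slice_density u v c K (p.2, p.1))) => //.
    by apply: swap_pair; exact: measurable_slice_density.
  by move=> p; exact: slice_density_ge0.
- apply: emeasurable_funM; last by apply/measurable_EFinP; apply: continuous_measurable_fun; exact: continuous_sin.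
  by apply: (measurableT_comp mG); apply: continuous_measurable_fun => t; apply: cvgN; exact: continuous_cos.
- by move=> t t0; exact: inner_projection.
Qed.

(** Projected to the plane of [u] and [c], the two half areas differ only by the order of
    integration. *)
Lemma half_area_swap u v c K : closed K -> half_area u v c K = half_area c v u K.
Proof.
move=> cK; rewrite (half_area_projected u v c cK) (half_area_projected c v u cK).
pose g (p : R * R) := projected_density u v c K (p.2, p.1).
have mg : measurable_fun [set: RR * RR] g.
  by apply: swap_pair; exact: measurable_projected_density.
have mI : measurable (`[-1, 1]%classic : set RR) by exact: measurable_itv.
have := @tonelli_swap R g _ _ mI mI mg (fun p => projected_density_ge0 _ _ _ _ _).
rewrite /g => -> /=.
apply: eq_integral => z _; apply: eq_integral => x _; rewrite /projected_density/=.
rewrite [x ^+ 2 + _]addrC (addrAC 1 (- x ^+ 2)).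
by rewrite [X in \1_K (X + _)]addrC [X in \1_K X]addrC addrA.
Qed.

Lemma area_frame_swap u v c K : closed K -> area_frame u v c K = area_frame c v u K.
Proof. move=> cK; rewrite (half_area_split u v c cK) (half_area_split c v u cK).
by rewrite (half_area_swap u v c cK) (half_area_swap u (- v) c cK). Qed.

Lemma area_frame_reflect u v c K : closed K -> area_frame u (- v) c K = area_frame u v c K.
Proof.
move=> cK; rewrite (half_area_split u v c cK) (half_area_split u (- v) c cK).
rewrite opprK; exact: addeC.
Qed.

Lemma area_frame_rotate u v c K a : closed K -> 0 <= a <= 2 * pi ->
  area_frame (cos a *: u + sin a *: v) (cos a *: v - sin a *: u) c K = area_frame u v c K.
Proof.
move=> cK a0; rewrite /area_frame.
have ms := @measurable_slice_area u v c K cK.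
have per t : slice_area u v c K (t + 2 * pi) = slice_area u v c K t.
  apply: eq_integral => phi _; rewrite /slice_density/= /frame_point mulr_natl.
  by rewrite cosD2pi sinD2pi.
have := @integral_itv_periodic R _ (2 * pi) a ms (@slice_area_ge0 u v c K) per a0.
apply: etrans; apply: eq_integral => t _; apply: eq_integral => phi _.
rewrite /slice_density/=; congr (_%:E); congr (_ * \1_K _).
by rewrite /frame_point cosD sinD; apply/rowP => i; rewrite !mxE; ring.
Qed.

End AreaFrame.

Section Area.
Context {R : realType}.
Local Notation mu := (@lebesgue_measure R).
Local Notation RR := (measurableTypeR R).
Implicit Types (u v c x p : 'rV[R]_3) (K L : set 'rV[R]_3).

Lemma exists_angle (a b : R) : a ^+ 2 + b ^+ 2 = 1 ->
  exists2 t, 0 <= t <= 2 * pi & a = cos t /\ b = sin t.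
Proof.
move=> ab; have pi0 := pi_gt0 R; have [b0|b0] := leP 0 b.
  have [/andP[t0 tpi] ct st] := acos_cos_sin b0 ab.
  by exists (acos a); [apply/andP; split=> //; lra|rewrite ct st].
have nb0 : 0 <= - b by lra.
have [/andP[t0 tpi] ct st] : [/\ 0 <= acos a <= pi, cos (acos a) = a & sin (acos a) = - b].
  by apply: acos_cos_sin => //; rewrite sqrrN.
exists (- acos a + pi *+ 2); first by rewrite -mulr_natl; apply/andP; split; lra.
by rewrite cosD2pi sinD2pi cosN sinN ct st opprK.
Qed.

Lemma orthonormal_frame_swap c u v : orthonormal_frame c u v -> orthonormal_frame u c v.
Proof. by move=> [[? ? ?] [? ? ?]]; split; split=> //; rewrite dotC. Qed.

(** The two frames are related by an orthogonal matrix of the plane, that is a rotation or a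
    rotation followed by a reflection. *)
Let area_frame_same_pole c u v u' v' K : closed K ->
  orthonormal_frame c u v -> orthonormal_frame c u' v' ->
  area_frame u v c K = area_frame u' v' c K.
Proof.
move=> cK F F'; have [[_ u'1 v'1] [cu' cv' u'v']] := F'.
have := frame_expand u' F; rewrite [dot u' c]dotC cu' scale0r addr0.
have := frame_expand v' F; rewrite [dot v' c]dotC cv' scale0r addr0.
have [[_ u1 v1] [_ _ uv]] := F.
move: (dot u' u) (dot u' v) (dot v' u) (dot v' v) => a b a' b' v'E u'E.
have vu : dot v u = 0 by rewrite dotC.
have ab : a ^+ 2 + b ^+ 2 = 1.
  by rewrite -u'1 u'E !dot_lin u1 v1 uv vu; ring.
have ab' : a' ^+ 2 + b' ^+ 2 = 1.
  by rewrite -v'1 v'E !dot_lin u1 v1 uv vu; ring.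
have aa : a * a' + b * b' = 0.
  by rewrite -u'v' u'E v'E !dot_lin u1 v1 uv vu; ring.
have [e|e] : (a' = - b /\ b' = a) \/ (a' = b /\ b' = - a).
  have e1 : a' = - b * (a * b' - b * a').
    transitivity (a' * (a ^+ 2 + b ^+ 2) - a * (a * a' + b * b')).
      by rewrite ab aa; ring.
    by ring.
  have e2 : b' = a * (a * b' - b * a').
    transitivity (b' * (a ^+ 2 + b ^+ 2) - b * (a * a' + b * b')).
      by rewrite ab aa; ring.
    by ring.
  have : (a * b' - b * a') ^+ 2 = 1.
    transitivity ((a ^+ 2 + b ^+ 2) * (a' ^+ 2 + b' ^+ 2) - (a * a' + b * b') ^+ 2); first by ring.
    by rewrite ab ab' aa; ring.
  move=> /eqP; rewrite sqrf_eq1 => /orP[] /eqP d; rewrite d in e1 e2; [left|right].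
    by split; [rewrite {1}e1|rewrite {1}e2]; ring.
  by split; [rewrite {1}e1|rewrite {1}e2]; ring.
- have [t t0 [at_ bt]] := exists_angle ab.
  rewrite -(@area_frame_rotate R u v c K t cK t0) u'E v'E e.1 e.2 at_ bt.
  by rewrite scaleNr [- _ + _]addrC.
- have [t t0 [at_ bt]] := exists_angle ab.
  rewrite -(@area_frame_rotate R u v c K t cK t0) -(@area_frame_reflect R _ _ c K cK).
  by rewrite u'E v'E e.1 e.2 at_ bt opprB scaleNr.
Qed.

Lemma area_frame_independent c u v c' u' v' K : closed K ->
  orthonormal_frame c u v -> orthonormal_frame c' u' v' ->
  area_frame u v c K = area_frame u' v' c' K.
Proof.
move=> cK F F'; have [[c1 _ _] _] := F; have [[c'1 _ _] _] := F'.
have [w w1 [cw c'w]] := exists_perp c c'.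
have [t Ft] := exists_frame c1 w1 cw.
have [t' Ft'] := exists_frame c'1 w1 c'w.
rewrite (area_frame_same_pole cK F Ft) (area_frame_same_pole cK F' Ft').
rewrite (@area_frame_swap R w t c K cK) (@area_frame_swap R w t' c' K cK).
by apply: area_frame_same_pole => //; exact: orthonormal_frame_swap.
Qed.

Lemma area_frameE c u v K : closed K -> orthonormal_frame c u v ->
  area K = area_frame u v c K.
Proof.
move=> cK F; pose e i : 'rV[R]_3 := delta_mx 0 i.
have Fe : orthonormal_frame (e i2) (e i0) (e i1).
  by split; split; rewrite dotE !mxE /=; ring.
rewrite -(area_frame_independent cK Fe F).
apply: eq_integral => t _; apply: eq_integral => phi; rewrite inE/= in_itv/= => phi0.
rewrite /slice_density/= ger0_norm; last by apply: sin_ge0_pi.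
congr ((_ * \1_K _)%:E); apply: vec3P; rewrite /spherical_point /frame_point !mxE /=; ring.
Qed.

Lemma slice_area_le u v c K t : closed K -> (slice_area u v c K t <= pi%:E)%E.
Proof.
move=> cK; have pi0 := pi_gt0 R.
apply: (@le_trans _ _ (\int[mu]_(phi in `[0%R, pi]) (cst 1 phi))%E).
  apply: ge0_le_integral => //.
  - by move=> ? _; exact: slice_density_ge0.
  - apply: measurable_funTS; apply: (measurableT_comp (measurable_slice_density u v c cK)).
    exact: measurable_fun_pair.
  - move=> phi _; rewrite lee_fin; apply: mulr_ile1 => //.
    by rewrite ler_norml sin_geN1 sin_le1.
by rewrite integral_cst//= mul1e lebesgue_measure_itv/= lte_fin pi0 -EFinB subr0.
Qed.

Lemma area_fin_num K : closed K -> area K \is a fin_num.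
Proof.
move=> cK; have [v v1 [_ _]] := exists_perp (0 : 'rV[R]_3) 0.
have [u u1 [vu _]] := exists_perp v 0.
have [w F] := exists_frame v1 u1 vu.
rewrite (area_frameE cK F) ge0_fin_numE; last first.
  by apply: integral_ge0 => t _; exact: slice_area_ge0.
have pi0 := pi_gt0 R.
have sl t := slice_area_le u w v t cK.
apply: (@le_lt_trans _ _ (\int[mu]_(t in `[0%R, (2 * pi)%R]) (cst pi%:E t))%E).
  apply: ge0_le_integral => //; first by move=> ? _; exact: slice_area_ge0.
  apply: measurable_funTS; exact: measurable_slice_area.
by rewrite integral_cst//= lebesgue_measure_itv/= lte_fin; case: ifP => _; rewrite -?EFinB -?EFinM ?ltry// mule0.
Qed.

Lemma frame_pointE c u v phi t : orthonormal_frame c u v ->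
  sphere (frame_point u v c phi t) /\ dot c (frame_point u v c phi t) = cos phi.
Proof.
move=> [[c1 u1 v1] [cu cv uv]]; rewrite /sphere/= /frame_point !dot_lin.
rewrite (dotC u c) (dotC v c) (dotC v u) c1 u1 v1 cu cv uv; split; last by ring.
transitivity (sin phi ^+ 2 * (cos t ^+ 2 + sin t ^+ 2) + cos phi ^+ 2); first by ring.
by rewrite cos2Dsin2 mulr1 addrC cos2Dsin2.
Qed.

Lemma integral_sin_cap (e : R) : 0 < e <= pi ->
  (\int[mu]_(phi in `[0%R, pi]) (`|sin phi| * \1_(`[0%R, e]%classic : set RR) phi)%:E = (1 - cos e)%:E)%E.
Proof.
move=> /andP[e0 epi]; have pi0 := pi_gt0 R.
pose b phi : R := `|sin phi| * \1_(`[0, e]%classic : set RR) phi.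
have b0 phi : (0 <= (b phi)%:E)%E by rewrite lee_fin mulr_ge0.
have mb : measurable_fun [set: RR] (fun phi => (b phi)%:E).
  apply/measurable_EFinP; apply: measurable_funM; last exact: measurable_indic.
  apply: measurableT_comp => //; apply: continuous_measurable_fun; exact: continuous_sin.
rewrite -[LHS]/(\int[mu]_(phi in `[0%R, pi]) (b phi)%:E)%E.
rewrite (@integral_itv_split _ _ 0 e pi)//; last exact: ltW.
rewrite [X in (_ + X)%E](_ : _ = 0%E) ?adde0; last first.
  rewrite (@eq_integral_itvoo _ _ (cst 0%E))//; first by rewrite integral0.
  move=> phi /andP[h _]; rewrite /b indicE memNset ?mulr0//= in_itv/= => /andP[_].
  by rewrite leNgt h.
pose Fc t : R := - cos t.
have dF t : is_derive t (1 : R) Fc (sin t).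
  by rewrite /Fc; apply: is_derive_eq; rewrite opprK.
have sp t : 0 < t < e -> 0 < sin t.
  by move=> /andP[t0 te]; rewrite sin_gt0_pi// t0 (lt_le_trans te).
have := @change_of_variable R Fc (@sin R) 0 e e0 dF (@continuous_sin R) sp (cst 1%E) _ _.
rewrite integral_cst//= mul1e lebesgue_measure_itv/= lte_fin /Fc cos0.
have -> : -1 < - cos e by rewrite ltrN2 -[X in _ < X]cos0 cos_le_lt ?e0 ?lexx ?(ltW pi0)// (ltW e0) epi.
move=> h; rewrite addrC -[X in _ = (_ + X)%:E]opprK EFinB h//.
apply: eq_integral => phi; rewrite inE/= in_itv/= => /andP[p0 pe].
rewrite mul1e /b indicE mem_set ?mulr1//=; last by rewrite in_itv/= p0.
by rewrite ger0_norm// sin_ge0_pi// p0 (le_trans pe).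
Qed.

(** Computed in a frame whose pole is the center of the cap: every slice of [L] exceeds that of [K]
    by [1 - cos e]. *)
Lemma lt_area_cap K L c e : closed K -> closed L -> K `<=` L -> dot c c = 1 -> 0 < e <= pi ->
  (forall x, sphere x -> cos e <= dot c x -> L x /\ ~ K x) -> (area K < area L)%E.
Proof.
move=> cK cL KL c1 /andP[e0 epi] cap; have pi0 := pi_gt0 R.
have [u u1 [cu _]] := exists_perp c 0; have [w F] := exists_frame c1 u1 cu.
pose b phi : R := `|sin phi| * \1_(`[0, e]%classic : set RR) phi.
have b0 phi : (0 <= (b phi)%:E)%E by rewrite lee_fin mulr_ge0.
have mb : measurable_fun [set: RR] (fun phi => (b phi)%:E).
  apply/measurable_EFinP; apply: measurable_funM; last exact: measurable_indic.
  apply: measurableT_comp => //; apply: continuous_measurable_fun; exact: continuous_sin.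
have be phi t : 0 <= phi <= pi ->
    (slice_density u w c K (t, phi) + (b phi)%:E <= slice_density u w c L (t, phi))%E.
  move=> /andP[p0 ppi]; have [Sx cx] := frame_pointE phi t F.
  rewrite /slice_density /b/= -EFinD lee_fin -mulrDr ler_wpM2l// !indicE.
  have [pe|pe] := leP phi e.
    have [Lx Kx] : L (frame_point u w c phi t) /\ ~ K (frame_point u w c phi t).
      apply: cap => //; rewrite cx leNgt cos_le_lt ?p0 ?ppi//; last by rewrite (ltW e0) epi.
      by rewrite -leNgt.
    by rewrite (memNset Kx) (mem_set Lx) add0r; case: (_ \in _).
  rewrite [X in _ + X](_ : _ = 0) ?addr0; last first.
    by rewrite memNset//= in_itv/= => /andP[_]; rewrite leNgt pe.
  rewrite ler_nat; have [/[dup] /KL h1 h2|h] := pselect (K (frame_point u w c phi t)).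
    by rewrite !mem_set.
  by rewrite memNset.
pose k : R := 1 - cos e.
have kE : (\int[mu]_(phi in `[0%R, pi]) (b phi)%:E = k%:E)%E.
  by apply: integral_sin_cap; rewrite e0.
have k0 : 0 < k.
  by rewrite subr_gt0 -[X in _ < X]cos0 cos_le_lt ?e0 ?lexx ?(ltW pi0)// (ltW e0) epi.
have fK := area_fin_num cK.
suff h : (area K + (2 * pi * k)%:E <= area L)%E.
  apply: lt_le_trans h; rewrite -[X in (X < _)%E]adde0 lteD2lE// lte_fin.
  by rewrite mulr_gt0// mulr_gt0.
have md (X : set 'rV[R]_3) t : closed X ->
    measurable_fun [set: RR] (fun phi => slice_density u w c X (t, phi)).
  move=> cX; apply: (measurableT_comp (measurable_slice_density u w c cX)).
  exact: measurable_fun_pair.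
rewrite (area_frameE cK F) (area_frameE cL F).
apply: (@le_trans _ _ (\int[mu]_(t in `[0%R, (2 * pi)%R]) (slice_area u w c K t + k%:E))%E).
  rewrite ge0_integralD//=; last 3 first.
  - by move=> ? _; exact: slice_area_ge0.
  - by apply: measurable_funTS; exact: measurable_slice_area.
  - by move=> ? _; rewrite lee_fin ltW.
  suff -> : (\int[mu]_(t in `[0%R, (2 * pi)%R]) k%:E = (2 * pi * k)%:E)%E by [].
  rewrite integral_cst//= lebesgue_measure_itv/= lte_fin mulr_gt0// -EFinB subr0 -EFinM.
  by rewrite mulrC.
apply: ge0_le_integral => //=.
- by move=> t _; rewrite adde_ge0 ?slice_area_ge0// lee_fin ltW.
- by apply: measurable_funTS; apply: emeasurable_funD => //; exact: measurable_slice_area.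
- by apply: measurable_funTS; exact: measurable_slice_area.
move=> t _; rewrite -kE -ge0_integralD//=; last 3 first.
- by move=> ? _; exact: slice_density_ge0.
- by apply: measurable_funTS; exact: md.
- by apply: measurable_funTS.
apply: ge0_le_integral => //=.
- by move=> phi _; rewrite adde_ge0// slice_density_ge0.
- by apply: measurable_funTS; apply: emeasurable_funD => //; exact: md.
- by apply: measurable_funTS; exact: md.
by move=> phi; rewrite in_itv/=; exact: be.
Qed.

Lemma nbhs_cap p (U : set 'rV[R]_3) : dot p p = 1 -> nbhs p U ->
  exists2 e, 0 < e <= pi & forall x, sphere x -> cos e <= dot p x -> U x.
Proof.
move=> p1 /nbhs_dot_ball[e e0 he].
pose m := Num.max 0 (1 - e ^+ 2 / 4).
have m0 : 0 <= m by rewrite le_max lexx.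
have me : 1 - e ^+ 2 / 4 <= m by rewrite le_max lexx orbT.
have e20 : 0 < e ^+ 2 by rewrite exprn_gt0.
have m1 : m < 1 by rewrite gt_max ltr01/=; lra.
exists (acos m).
  by rewrite acos_gt0 ?acos_lepi//; apply/andP; split; lra.
move=> x; rewrite /sphere/= => x1; rewrite acosK; last by rewrite in_itv/=; apply/andP; split; lra.
move=> h; apply: he; rewrite !dot_lin x1 p1 (dotC x p); lra.
Qed.

(** The linear map that undoes the combination sends points near [y] to points near [p], so each of
    them is a combination of [x] with a point of [L] near [p]. *)
Lemma interior_cone L x p s : L `<=` sphere -> cone_closed L -> L x -> sphere_interior L p ->
  0 < s -> x + s *: p != 0 -> sphere_interior L (unitv (x + s *: p)).
Proof.
move=> Ls coneL Lx [p1 Lp] s0 y0; have y1 := unitv1 y0.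
set y := unitv (x + s *: p) in y1 *.
split=> //; set n := nrm (x + s *: p).
have n0 : 0 < n by rewrite nrm_gt0.
have ny : n *: y = x + s *: p by rewrite /n /y -unitvE.
have c0 : n *: z @[z --> y] --> n *: y by exact: scaler_continuous.
have cB : n *: z - x @[z --> y] --> n *: y - x.
  exact: (@cvgB _ _ _ (nbhs y) _ (fun z => n *: z) (cst x) (n *: y) x c0 (cvg_cst x)).
have c1 : s^-1 *: (n *: z - x) @[z --> y] --> s^-1 *: (n *: y - x).
  exact: (cvg_comp _ _ cB (@scaler_continuous _ _ s^-1 (n *: y - x))).
have e1 : s^-1 *: (n *: y - x) = p.
  by rewrite ny addrAC subrr add0r scalerA mulVf ?scale1r// gt_eqF.
rewrite e1 in c1; have p0 := unit_neq0 p1.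
have c2 : unitv (s^-1 *: (n *: z - x)) @[z --> y] --> p.
  have := @unitv_cvg R _ (nbhs y) _ (fun z => s^-1 *: (n *: z - x)) p p0 c1.
  by rewrite (unitv_id p1) => h; apply: h; exact: nbhs_filter.
have c3 : \forall z \near y, s^-1 *: (n *: z - x) != 0.
  have N0 : nbhs p [set z | z != 0].
    have : nbhs p [set z | 0 < dot p z].
      by apply: open_nbhs_nbhs; split; [exact: open_dot_gt|rewrite /= p1].
    by apply: filterS => z /=; apply: contraTneq => ->; rewrite dot0r ltxx.
  exact: (c1 _ N0).
have c4 : \forall z \near y, sphere (unitv (s^-1 *: (n *: z - x))) -> L (unitv (s^-1 *: (n *: z - x))).
  exact: (c2 _ Lp).
apply: filterS2 c3 c4 => z; set w := s^-1 *: (n *: z - x) => w0 Lw z1.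
have {}Lw : L (unitv w) by apply: Lw; exact: unitv1.
have zE : n *: z = 1 *: x + (s * nrm w) *: unitv w.
  by rewrite -scalerA -unitvE /w scalerA divff ?gt_eqF// !scale1r addrCA subrr addr0.
have -> : z = unitv (n *: z) by rewrite unitvZ// unitv_id.
rewrite zE; apply: coneL => //; first by rewrite mulr_ge0 ?nrm_ge0// ltW.
by rewrite -zE scaler_eq0 negb_or gt_eqF//= unit_neq0.
Qed.

(** A point of [L] outside the closed set [K], pushed slightly towards the interior of [L], becomes
    the center of a cap contained in [L] and disjoint from [K]. *)
Lemma lt_area K L : closed K -> closed L -> L `<=` sphere -> cone_closed L ->
  sphere_interior L !=set0 -> K `<=` L -> ~ (L `<=` K) -> (area K < area L)%E.
Proof.
move=> cK cL Ls coneL [p Lp] KL LK.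
have [x Lx Kx] : exists2 x, L x & ~ K x.
  by apply: contrapT => h; apply: LK => x Lx; apply: contrapT => Kx; apply: h; exists x.
have x1 := Ls _ Lx; rewrite /sphere/= in x1.
have nK : nbhs x (~` K) by apply: open_nbhs_nbhs; split=> //; exact: closed_openC.
have [s [s0 s1 Ks]] := ex_right ltr01 (near_unit_line p x1 nK).
have y0 : x + s *: p != 0.
  apply/eqP => /eqP; rewrite addr_eq0 => /eqP xE; move: x1; rewrite xE !dot_lin Lp.1; nra.
have [y1 Ly] := interior_cone Ls coneL Lx Lp s0 y0.
have nKy : nbhs (unitv (x + s *: p)) (~` K) by apply: open_nbhs_nbhs; split=> //; exact: closed_openC.
have [e e0 cap] := nbhs_cap y1 (filterI Ly nKy).
apply: (lt_area_cap cK cL KL y1 e0) => z z1 /(cap _ z1)[h1 h2]; split=> //.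
exact: h1.
Qed.

End Area.

(** * Sausages *)

Lemma cos_homo {R : realType} (s t : R) : 0 <= s -> s <= t -> t <= pi -> cos t <= cos s.
Proof.
move=> s0 st tpi; rewrite leNgt cos_le_lt -?leNgt//; first by rewrite s0 (le_trans st).
by rewrite (le_trans s0).
Qed.

Section StandardSausage.
Context {R : realType}.
Implicit Types (x : 'rV[R]_3) (a b t p q psi phi : R).

(** Bipolar description of the hull of the two disks of radius [r] centered at distance [a] from [c]
    in the directions [u] and [- u]: by [disk_in_dual] and [admissible_of_circle], the two
    inequalities say that [n] is nonnegative on these disks. *)
Definition std_sausage (c u : 'rV[R]_3) (r a : R) : set 'rV[R]_3 :=
  [set x | sphere x /\ forall n, sin r * nrm n <= dot n (ray_point c u a) ->
     sin r * nrm n <= dot n (ray_point c (- u) a) -> 0 <= dot n x].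

Lemma std_sausage_opp c u r a : std_sausage c (- u) r a = std_sausage c u r a.
Proof.
by apply/seteqP; split=> x [x1 Sx]; split=> // n; rewrite ?opprK => h1 h2; apply: Sx; rewrite ?opprK.
Qed.

Lemma std_sausage_cone c u r a : cone_closed (std_sausage c u r a).
Proof.
move=> x y s t [x1 Sx] [y1 Sy] s0 t0 z0; split; first exact: unitv1.
move=> n h1 h2; rewrite dot_unitvr_ge0// dotDr !dotZr.
by rewrite addr_ge0// mulr_ge0// ?Sx// ?Sy.
Qed.

Lemma std_sausage_sphere c u r a : std_sausage c u r a `<=` sphere.
Proof. by move=> x []. Qed.

Lemma closed_std_sausage c u r a : closed (std_sausage c u r a).
Proof.
rewrite (_ : std_sausage c u r a = sphere `&`
  \bigcap_(n in [set n | sin r * nrm n <= dot n (ray_point c u a) /\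
     sin r * nrm n <= dot n (ray_point c (- u) a)]) [set x | 0 <= dot n x]).
  apply: closedI; first exact: closed_sphere.
  by apply: closed_bigI => n _; exact: closed_halfspace.
apply/seteqP; split=> x [x1 Sx]; split=> // n; first by move=> [h1 h2]; exact: Sx.
by move=> h1 h2; exact: (Sx n).
Qed.

Variables (c u v : 'rV[R]_3) (r : R).
Hypothesis F : orthonormal_frame c u v.
Hypothesis rb : 0 < r < pi / 2.

Let pi0 : 0 < pi :> R. Proof. exact: pi_gt0. Qed.

Let r0 : 0 < r. Proof. by case/andP: rb. Qed.

Let sr0 : 0 < sin r. Proof. exact: sin_gt0_pihalf. Qed.

Let cr0 : 0 < cos r. Proof. by apply: cos_gt0_pihalf; apply/andP; split; case/andP: rb => ? ?; lra. Qed.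

Let c1 : dot c c = 1. Proof. by case: F => -[]. Qed.

Let u1 : dot u u = 1. Proof. by case: F => -[]. Qed.

Let v1 : dot v v = 1. Proof. by case: F => -[]. Qed.

Let cu : dot c u = 0. Proof. by case: F => _ []. Qed.

Let cv : dot c v = 0. Proof. by case: F => _ []. Qed.

Let uv : dot u v = 0. Proof. by case: F => _ []. Qed.

Lemma frame_pointP x : dot x x = 1 -> exists2 psi, 0 <= psi <= pi &
  exists2 phi, 0 <= phi <= 2 * pi & x = frame_point u v c psi phi.
Proof.
move=> x1; have xE := frame_expand x F; have xx := frame_dot x x F; rewrite x1 in xx.
move: (dot x u) (dot x v) (dot x c) xE xx => p q z xE xx.
pose h := Num.sqrt (p ^+ 2 + q ^+ 2).
have h2 : h ^+ 2 = p ^+ 2 + q ^+ 2 by rewrite sqr_sqrtr// addr_ge0 ?sqr_ge0.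
have [psi0 cpsi spsi] : [/\ 0 <= acos z <= pi, cos (acos z) = z & sin (acos z) = h].
  by apply: acos_cos_sin; [exact: sqrtr_ge0|rewrite h2; lra].
exists (acos z) => //; have [hz|hz] := eqVneq h 0.
  exists 0; first by rewrite lexx mulr_ge0// ltW.
  have [p0 q0] : p = 0 /\ q = 0.
    move: h2; rewrite hz expr0n/= => /esym/eqP; rewrite paddr_eq0 ?sqr_ge0// !sqrf_eq0.
    by move=> /andP[/eqP -> /eqP ->].
  by rewrite xE /frame_point spsi cpsi hz p0 q0 !mul0r.
have [t t0 [ct st]] : exists2 t, 0 <= t <= 2 * pi & p / h = cos t /\ q / h = sin t.
  by apply: exists_angle; rewrite !expr_div_n -mulrDl -h2 divff// expf_neq0.
exists t => //; rewrite xE /frame_point spsi cpsi -ct -st.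
by rewrite ![h * _]mulrC !divfK.
Qed.

Let combP (n : 'rV[R]_3) : exists n1 n2 n3, n = n1 *: u + n2 *: v + n3 *: c.
Proof. by exists (dot n u), (dot n v), (dot n c); exact: frame_expand. Qed.

Lemma dot_comb_point n1 n2 n3 psi phi : dot (n1 *: u + n2 *: v + n3 *: c) (frame_point u v c psi phi) =
  n3 * cos psi + sin psi * (n1 * cos phi + n2 * sin phi).
Proof.
rewrite /frame_point !dot_lin (dotC u c) (dotC v c) (dotC v u) c1 u1 v1 cu cv uv; ring.
Qed.

Lemma dot_comb_ray n1 n2 n3 p q a : dot (n1 *: u + n2 *: v + n3 *: c) (ray_point c (p *: u + q *: v) a) =
  n3 * cos a + sin a * (n1 * p + n2 * q).
Proof.
rewrite /ray_point !dot_lin (dotC u c) (dotC v c) (dotC v u) c1 u1 v1 cu cv uv; ring.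
Qed.

Lemma nrm_comb n1 n2 n3 : nrm (n1 *: u + n2 *: v + n3 *: c) = Num.sqrt (n1 ^+ 2 + n2 ^+ 2 + n3 ^+ 2).
Proof.
rewrite /nrm; congr Num.sqrt.
rewrite !dot_lin (dotC u c) (dotC v c) (dotC v u) c1 u1 v1 cu cv uv; ring.
Qed.

Let ray1 a : ray_point c u a = ray_point c (1 *: u + 0 *: v) a.
Proof. by rewrite scale1r scale0r addr0. Qed.

Let rayN1 a : ray_point c (- u) a = ray_point c (- 1 *: u + 0 *: v) a.
Proof. by rewrite scaleN1r scale0r addr0. Qed.

(** The condition in spherical coordinates does not mention the frame, so that slices of sausages
    depend on [r], [a] and the longitude only. *)
Lemma std_sausage_pointP psi phi a : std_sausage c u r a (frame_point u v c psi phi) <->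
  forall n1 n2 n3, sin r * Num.sqrt (n1 ^+ 2 + n2 ^+ 2 + n3 ^+ 2) + sin a * n1 <= n3 * cos a ->
    sin r * Num.sqrt (n1 ^+ 2 + n2 ^+ 2 + n3 ^+ 2) - sin a * n1 <= n3 * cos a ->
    0 <= n3 * cos psi + sin psi * (n1 * cos phi + n2 * sin phi).
Proof.
split=> [[_ Sx] n1 n2 n3 h1 h2|Sx].
  rewrite -dot_comb_point; apply: Sx; rewrite nrm_comb.
    by rewrite ray1 dot_comb_ray; lra.
  by rewrite rayN1 dot_comb_ray; lra.
split; first by have [] := frame_pointE psi phi F.
move=> n; have [n1 [n2 [n3 ->]]] := combP n; rewrite nrm_comb ray1 rayN1 !dot_comb_ray dot_comb_point.
by move=> h1 h2; apply: Sx; lra.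
Qed.

Lemma std_sausage_disk x a : dot x x = 1 -> cos r <= dot (ray_point c u a) x -> std_sausage c u r a x.
Proof.
move=> x1 h; split=> // n hn _; apply: (disk_in_dual rb _ x1 hn h).
exact: ray_point1.
Qed.

Lemma std_sausage_reflect_u psi phi a : std_sausage c u r a (frame_point u v c psi phi) ->
  std_sausage c u r a (frame_point u v c psi (pi - phi)).
Proof.
move=> /std_sausage_pointP Sx; apply/std_sausage_pointP => n1 n2 n3 h1 h2.
have := Sx (- n1) n2 n3; rewrite sqrrN cosB sinB cospi sinpi => h.
rewrite [leRHS](_ : _ = n3 * cos psi + sin psi * (- n1 * cos phi + n2 * sin phi)); last by ring.
by apply: h; lra.
Qed.

Section Fixed.
Variable a : R.
Hypothesis a0 : 0 <= a.
Hypothesis ar : a + r < pi / 2.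

Let sa0 : 0 <= sin a. Proof. by apply: sin_ge0_pi; apply/andP; split=> //; have := r0; have := ar; have := a0; have := pi0; lra. Qed.

Let ca0 : 0 < cos a. Proof. by apply: cos_gt0_pihalf; apply/andP; split; have := r0; have := ar; have := a0; have := pi0; lra. Qed.

Let sar0 : 0 < sin (a + r). Proof. by apply: sin_gt0_pihalf; apply/andP; split=> //; have := r0; have := ar; have := a0; have := pi0; lra. Qed.

Let car0 : 0 < cos (a + r). Proof. by apply: cos_gt0_pihalf; apply/andP; split; have := r0; have := ar; have := a0; have := pi0; lra. Qed.

(** The test vector is normal to the great circle tangent, at longitude [phi], to the disk of radius
    [a + r] about [c]; [key] says that both disks of the sausage lie on its positive side. *)
Lemma std_sausage_colatitude psi phi : 0 <= psi <= pi ->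
  std_sausage c u r a (frame_point u v c psi phi) -> psi <= a + r.
Proof.
move=> /andP[psi0 psipi] /std_sausage_pointP Sx.
have key t : sin r <= sin (a + r) * cos a + sin a * (- cos (a + r) * cos t).
  rewrite (_ : sin r = sin (a + r) * cos a + sin a * (- cos (a + r) * 1)).
    by rewrite lerD2l ler_wpM2l// ler_nM2l ?cos_le1 ?oppr_lt0.
  by rewrite mulr1 mulrN [sin a * _]mulrC -sinB addrAC subrr add0r.
have e : Num.sqrt ((- cos (a + r) * cos phi) ^+ 2 + (- cos (a + r) * sin phi) ^+ 2 + sin (a + r) ^+ 2) = 1.
  rewrite (_ : _ + _ + _ = cos (a + r) ^+ 2 * (cos phi ^+ 2 + sin phi ^+ 2) + sin (a + r) ^+ 2); last by ring.
  by rewrite cos2Dsin2 mulr1 cos2Dsin2 sqrtr1.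
have := Sx (- cos (a + r) * cos phi) (- cos (a + r) * sin phi) (sin (a + r)).
rewrite e mulr1; have k1 := key phi; have := key (pi - phi).
rewrite cosB cospi sinpi mulN1r mul0r addr0 => k2 h.
have {}h : 0 <= sin (a + r - psi).
  rewrite sinB -[X in _ - X]mulr1 -(cos2Dsin2 phi).
  rewrite [leRHS](_ : _ = sin (a + r) * cos psi +
    sin psi * (- cos (a + r) * cos phi * cos phi + - cos (a + r) * sin phi * sin phi)); last by ring.
  by apply: h; lra.
rewrite leNgt; apply/negP => lt.
have : 0 < sin (psi - (a + r)) by apply: sin_gt0_pi; apply/andP; split; have := r0; have := ar; have := a0; have := pi0; lra.
by rewrite -opprB sinN; lra.
Qed.

Let polar p q : 0 <= p -> 0 <= q -> exists h t : R,
  [/\ 0 <= h, 0 <= t <= pi / 2, p = h * cos t, q = h * sin t & h ^+ 2 = p ^+ 2 + q ^+ 2].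
Proof.
move=> p0 q0; pose h := Num.sqrt (p ^+ 2 + q ^+ 2).
have h2 : h ^+ 2 = p ^+ 2 + q ^+ 2 by rewrite sqr_sqrtr// addr_ge0 ?sqr_ge0.
have h0 : 0 <= h by exact: sqrtr_ge0.
have [hz|hz] := eqVneq h 0.
  exists 0, 0; rewrite lexx divr_ge0 ?ltW//; split=> //; rewrite ?mul0r.
  - by apply/eqP; rewrite -sqrf_eq0 eq_le sqr_ge0 andbT; move: h2; rewrite hz expr0n/=; nra.
  - by apply/eqP; rewrite -sqrf_eq0 eq_le sqr_ge0 andbT; move: h2; rewrite hz expr0n/=; nra.
  - by rewrite -h2 hz.
have [/andP[t0 tpi] ct st] : [/\ 0 <= acos (p / h) <= pi, cos (acos (p / h)) = p / h & sin (acos (p / h)) = q / h].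
  by apply: acos_cos_sin; rewrite ?divr_ge0// !expr_div_n -mulrDl -h2 divff// expf_neq0.
exists h, (acos (p / h)); rewrite ct st; split=> //.
- rewrite t0 leNgt; apply/negP => lt; have : cos (acos (p / h)) < cos (pi / 2).
    by rewrite cos_le_lt ?t0// divr_ge0 ?ltW//=; have := pi0; lra.
  by rewrite cos_pihalf ct ltNge divr_ge0.
- by rewrite mulrC divfK.
- by rewrite mulrC divfK.
Qed.

Let sin_ge0_quarter (x : R) : 0 <= x -> x <= pi / 2 -> 0 <= sin x.
Proof. by move=> x0 xh; apply: sin_ge0_pi; rewrite x0 (le_trans xh)// ler_pdivrMr// ler_peMr ?ler1n// ltW. Qed.

Let cos_ge0_quarter (x : R) : 0 <= x -> x <= pi / 2 -> 0 <= cos x.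
Proof. by move=> x0 xh; apply: cos_ge0_pihalf; rewrite xh (le_trans _ x0)// oppr_le0 divr_ge0// ltW. Qed.

Local Ltac narrow := clear - c u v r F rb a a0 ar pi0 r0 sr0 cr0 c1 u1 v1 cu cv uv combP ray1 rayN1 sa0 ca0 sar0 car0 polar.

(** For an admissible vector with horizontal part of length [h], the worst choice of signs gives the
    horizontal value [- h * cos (t - phi)]. If [phi' <= t], the vector with these signs tested at
    [phi'] is at least as demanding. Otherwise its horizontal part is turned to point opposite to
    [phi'], which lowers the component along [u] and keeps it admissible. *)
Lemma std_sausage_azimuth psi phi phi' : 0 <= psi <= pi -> 0 <= phi -> phi <= phi' ->
  phi' <= pi / 2 -> std_sausage c u r a (frame_point u v c psi phi') ->
  std_sausage c u r a (frame_point u v c psi phi).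
Proof.
move=> psi0 phi0 pp p'h /std_sausage_pointP Sx; apply/std_sausage_pointP => n1 n2 n3 h1 h2.
have ppi := pi0; have spsi := sin_ge0_pi psi0.
have ph := le_trans pp p'h; have phi'0 := le_trans phi0 pp.
have sphi := sin_ge0_quarter phi0 ph.
have cphi := cos_ge0_quarter phi0 ph.
have cphi' := cos_ge0_quarter phi'0 p'h.
have [h [t [h0 /andP[t0 th] ct st hh]]] := polar (normr_ge0 n1) (normr_ge0 n2).
rewrite !real_normK ?num_real// in hh.
set q := Num.sqrt _ in h1 h2; have qE : q = Num.sqrt (h ^+ 2 + n3 ^+ 2) by rewrite hh.
have h3 : sin r * q + sin a * (h * cos t) <= n3 * cos a.
  by rewrite -ct; move: q h1 h2 {qE} => q; narrow; case: (ger0P n1) => _; lra.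
have l1 : - (h * cos (t - phi)) <= n1 * cos phi + n2 * sin phi.
  have -> : h * cos (t - phi) = `|n1| * cos phi + `|n2| * sin phi by rewrite ct st cosB; ring.
  have := ler_wpM2r cphi (ler_norm (- n1)); have := ler_wpM2r sphi (ler_norm (- n2)).
  by rewrite !normrN; narrow; lra.
suff l2 : 0 <= n3 * cos psi + sin psi * - (h * cos (t - phi)).
  by apply: le_trans l2 _; rewrite lerD2l ler_wpM2l.
have sa := sa0; have [tp|tp] := lerP phi' t.
  have le : cos (t - phi) <= cos (t - phi').
    by apply: cos_homo; move: phi0 pp tp th p'h ppi; narrow; lra.
  have l3 : 0 <= n3 * cos psi + sin psi * (- (h * cos t) * cos phi' + - (h * sin t) * sin phi').
    apply: Sx; rewrite (_ : (- (h * cos t)) ^+ 2 + _ = h ^+ 2 * (cos t ^+ 2 + sin t ^+ 2)); try ring.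
      by rewrite cos2Dsin2 mulr1 -qE; have : 0 <= sin a * (h * cos t) by [rewrite -ct mulr_ge0]; move: h3; narrow; lra.
    by rewrite cos2Dsin2 mulr1 -qE; move: h3; narrow; lra.
  apply: le_trans l3 _; rewrite lerD2l ler_wpM2l//.
  by have := ler_wpM2l h0 le; rewrite [cos (t - phi')]cosB; narrow; lra.
have le : cos phi' <= cos t.
  by apply: cos_homo; move: t0 tp p'h ppi; narrow; lra.
have l3 : 0 <= n3 * cos psi + sin psi * (- (h * cos phi') * cos phi' + - (h * sin phi') * sin phi').
  have := ler_wpM2l sa (ler_wpM2l h0 le) => l4; have l5 : 0 <= sin a * (h * cos phi').
    by rewrite !mulr_ge0.
  apply: Sx; rewrite (_ : (- (h * cos phi')) ^+ 2 + _ = h ^+ 2 * (cos phi' ^+ 2 + sin phi' ^+ 2)); try ring.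
    by rewrite cos2Dsin2 mulr1 -qE; move: h3 l4 l5; narrow; lra.
  by rewrite cos2Dsin2 mulr1 -qE; move: h3 l4 l5; narrow; lra.
apply: le_trans l3 _; rewrite lerD2l ler_wpM2l//.
rewrite (_ : _ + _ = - (h * (cos phi' ^+ 2 + sin phi' ^+ 2))); last by ring.
by rewrite cos2Dsin2 mulr1 lerN2 -[leRHS]mulr1 ler_wpM2l// cos_le1.
Qed.

(** Here [n] is admissible for the disks in the directions 0 and [2 * b], perhaps not for the one
    opposite to [u]. Unless the value is visibly nonnegative, the horizontal part of [n] has a
    direction [- t]. Reflecting it across the direction [phi] keeps the value at [phi] and gives the
    direction [2 * phi + t], for which the vector is admissible for the sausage. *)
Lemma std_sausage_sector psi phi b (n : 'rV[R]_3) : 0 <= psi <= pi -> 0 <= phi -> phi <= b ->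
  b <= pi / 2 -> std_sausage c u r a (frame_point u v c psi phi) ->
  0 <= dot n c -> sin r * nrm n <= dot n (ray_point c u a) ->
  sin r * nrm n <= dot n (ray_point c (cos (2 * b) *: u + sin (2 * b) *: v) a) ->
  0 <= dot n (frame_point u v c psi phi).
Proof.
move=> psi0 phi0 pb bh Sx; have psia := std_sausage_colatitude psi0 Sx.
move/std_sausage_pointP: Sx => Sx.
have [n1 [n2 [n3 ->]]] := combP n; rewrite nrm_comb ray1 !dot_comb_ray dot_comb_point.
rewrite !dot_lin (dotC u c) (dotC v c) cu cv c1 !mulr0 !add0r !mulr1 !addr0 => n30.
set q := Num.sqrt _ => h1 h2; have spsi := sin_ge0_pi psi0; have ppi := pi0.
have sa := sa0; have arh := ar; have ph := le_trans pb bh.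
have cpsi : 0 <= cos psi.
  by apply: cos_ge0_quarter; [case/andP: psi0|exact: le_trans psia (ltW arh)].
have sphi := sin_ge0_quarter phi0 ph.
have cphi := cos_ge0_quarter phi0 ph.
have [h3|h3] := leP (sin r * q + sin a * n1) (n3 * cos a).
  by apply: Sx; rewrite -/q; move: q h1 h3 {h2} => q; narrow; lra.
have n10 : 0 <= n1.
  rewrite leNgt; apply/negP => /ltW n1N; have := mulr_ge0_le0 sa n1N.
  by move: q h1 h3 {h2} => q; narrow; lra.
have [n20|/ltW n20] := leP 0 n2.
  by rewrite addr_ge0// mulr_ge0// addr_ge0// mulr_ge0.
have n2N : 0 <= - n2 by rewrite oppr_ge0.
have [h [t [h0 /andP[t0 th] ct st hh]]] := polar n10 n2N.
have n2E : n2 = - (h * sin t) by rewrite -st opprK.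
rewrite sqrrN in hh.
have cosE w : n1 * cos w + n2 * sin w = h * cos (w + t) by rewrite ct n2E cosD; ring.
rewrite cosE in h2; rewrite cosE.
have [pt|pt] := leP (phi + t) (pi / 2).
  have cpt := cos_ge0_quarter (addr_ge0 phi0 t0) pt.
  by apply: addr_ge0; apply: mulr_ge0 => //; exact: mulr_ge0.
(* As [2 * b <= pi], an angle beyond pi would make the condition at [2 * b] imply admissibility for
   the disk opposite to [u], excluded by [h3]. *)
have bt : 2 * b + t <= pi.
  rewrite leNgt; apply/negP => bt.
  have : cos t <= cos (2 * b + t - pi).
    by apply: cos_homo; move: bt bh t0 th ppi; narrow; lra.
  rewrite cosB cospi sinpi mulrN1 mulr0 addr0 => /(ler_wpM2l h0)/(ler_wpM2l sa).
  by rewrite -ct; move: q h1 h2 h3 => q; narrow; lra.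
have le1 : cos (2 * b + t) <= cos (2 * phi + t).
  by apply: cos_homo; move: phi0 pb t0 bt ppi; narrow; lra.
have le2 : cos (2 * phi + t) <= cos (pi / 2).
  by apply: cos_homo; move: pt phi0 pb t0 bt ppi; narrow; lra.
rewrite cos_pihalf in le2.
have {}le1 := ler_wpM2l sa (ler_wpM2l h0 le1).
have {}le2 := mulr_ge0_le0 sa (mulr_ge0_le0 h0 le2).
have -> : h * cos (phi + t) = h * cos (2 * phi + t) * cos phi + h * sin (2 * phi + t) * sin phi.
  by rewrite (_ : phi + t = 2 * phi + t - phi); [rewrite cosB; ring|ring].
apply: Sx; rewrite (_ : (h * cos (2 * phi + t)) ^+ 2 + _ =
    h ^+ 2 * (cos (2 * phi + t) ^+ 2 + sin (2 * phi + t) ^+ 2)); try ring.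
  by rewrite cos2Dsin2 mulr1 hh -/q; move: q h1 h2 h3 le1 le2 => q; narrow; lra.
by rewrite cos2Dsin2 mulr1 hh -/q; move: q h1 h2 h3 le1 le2 => q; narrow; lra.
Qed.

Let diskP (e : 'rV[R]_3) : dot e e = 1 -> dot c e = 0 -> forall psi,
  dot (ray_point c e a) (ray_point c e psi) = cos (psi - a).
Proof.
move=> e1 ce psi; rewrite /ray_point !dot_lin c1 e1 (dotC e c) ce cosB; ring.
Qed.

Lemma std_sausage_tip : std_sausage c u r a (ray_point c u (a + r)).
Proof.
apply: std_sausage_disk; first exact: ray_point1.
by rewrite diskP// addrAC subrr add0r.
Qed.

Lemma std_sausage_tipN : std_sausage c u r a (ray_point c (- u) (a + r)).
Proof.
have := @std_sausage_reflect_u (a + r) 0 a.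
rewrite /frame_point subr0 cos0 sin0 cospi sinpi !mulr1 !mulr0 !scale0r !addr0 mulrN1 scaleNr.
have := std_sausage_tip; rewrite /ray_point addrC => h /(_ h); by rewrite scalerN addrC.
Qed.

Lemma std_sausage_ge x : std_sausage c u r a x -> cos (a + r) <= dot c x.
Proof.
move=> Sx; have x1 : dot x x = 1 by case: Sx.
have [psi psi0 [phi phi0 xE]] := frame_pointP x1; rewrite xE in Sx *.
have [_ ->] := frame_pointE psi phi F; have := std_sausage_colatitude psi0 Sx.
case/andP: psi0 => p0 ppi h; rewrite leNgt cos_le_lt -?leNgt//; first by rewrite p0.
by have := ar; have := a0; have := r0; have := pi0; move=> *; apply/andP; split; lra.
Qed.

Lemma circumradius_std_sausage : circumradius (std_sausage c u r a) = a + r.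
Proof.
have h : 0 <= a + r <= pi by have := ar; have := a0; have := r0; have := pi0; move=> *; apply/andP; split; lra.
rewrite (@circumradiusE R _ c (cos (a + r)))//.
- by rewrite cosK// in_itv.
- exact: std_sausage_sphere.
- by rewrite cos_geN1 cos_le1.
- exact: std_sausage_ge.
have car := car0; move=> c' c'1; have sar := ltW sar0.
have h2 := ler_wpM2l (ltW car) (dot_unit_le1 c'1 c1).
have [h1|/ltW h1] := leP (dot c' u) 0.
  exists (ray_point c u (a + r)); first exact: std_sausage_tip.
  rewrite /ray_point !dot_lin; have := mulr_ge0_le0 sar h1; lra.
exists (ray_point c (- u) (a + r)); first exact: std_sausage_tipN.
rewrite /ray_point !dot_lin; have := mulr_ge0 sar h1; lra.
Qed.

Lemma std_sausage_mono b : b <= a -> 0 <= b -> std_sausage c u r b `<=` std_sausage c u r a.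
Proof.
move=> ba b0 x [x1 Sx]; split=> // n; have [n1 [n2 [n3 nE]]] := combP n.
rewrite nE !nrm_comb ray1 rayN1 !dot_comb_ray -nrm_comb -nE => h1 h2.
have sa := sa0; have ca := ca0; have arh := ar; have aa := a0; have rr := r0; have ppi := pi0.
have sb0 : 0 <= sin b by apply: sin_ge0_pi; apply/andP; split; lra.
have cab : cos a <= cos b by apply: cos_homo; lra.
have sab : sin b <= sin a.
  by rewrite -ler_sqr ?nnegrE// !sin2cos2 lerD2l lerN2 ler_sqr ?nnegrE// ltW// (lt_le_trans ca).
have nn0 : 0 <= sin r * nrm n by rewrite mulr_ge0 ?nrm_ge0// ltW.
have n30 : 0 <= n3 by rewrite -(pmulr_lge0 _ ca); lra.
have h3 := ler_wpM2l n30 cab.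
have key : sin r * nrm n + sin b * `|n1| <= n3 * cos b.
  have := ler_wpM2r (normr_ge0 n1) sab.
  have : sin r * nrm n + sin a * `|n1| <= n3 * cos a by case: (ger0P n1) => _; lra.
  lra.
have k1 := ler_wpM2l sb0 (ler_norm n1); have k2 := ler_wpM2l sb0 (ler_norm (- n1)).
rewrite normrN in k2; apply: Sx; rewrite {2}nE.
  by rewrite ray1 dot_comb_ray; lra.
by rewrite rayN1 dot_comb_ray; lra.
Qed.

Lemma std_sausage_interior : sphere_interior (std_sausage c u r a) !=set0.
Proof.
have y1 : dot (ray_point c u a) (ray_point c u a) = 1 by exact: ray_point1.
exists (ray_point c u a); split=> //.
have : nbhs (ray_point c u a) [set x | cos r < dot (ray_point c u a) x].
  apply: open_nbhs_nbhs; split; first exact: open_dot_gt.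
  rewrite /= y1 -[X in _ < X]cos0; rewrite cos_le_lt//; have rbb := rb; have ppi := pi0.
    by move: rbb => /andP[? ?]; apply/andP; split; lra.
  by rewrite lexx ltW.
by apply: filterS => x /= h x1; apply: std_sausage_disk => //; exact: ltW.
Qed.

Lemma std_sausage_geodesically_convex : geodesically_convex (std_sausage c u r a).
Proof.
apply: cone_geodesically_convex; [exact: std_sausage_sphere|exact: std_sausage_cone|].
move=> x /std_sausage_ge h /std_sausage_ge; rewrite dotNr; have := car0; lra.
Qed.

End Fixed.

Lemma std_sausage_area_lt a b : 0 <= b -> b < a -> a + r < pi / 2 ->
  (area (std_sausage c u r b) < area (std_sausage c u r a))%E.
Proof.
move=> b0 ba ar; have a0 : 0 <= a by lra.
apply: lt_area; try exact: closed_std_sausage.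
- exact: std_sausage_sphere.
- exact: std_sausage_cone.
- exact: std_sausage_interior.
- by apply: std_sausage_mono => //; exact: ltW.
move=> /(_ _ (std_sausage_tip a)).
have br : b + r < pi / 2 by lra.
move=> /(std_sausage_ge b0 br); rewrite /ray_point !dot_lin c1 cu.
have : cos (a + r) < cos (b + r).
  by rewrite cos_le_lt; have := r0; have := pi0 => *; [lra|apply/andP; split; lra|apply/andP; split; lra].
lra.
Qed.

End StandardSausage.

(** * Sausages as hulls of two circles *)

Section Hull.
Context {R : realType}.
Implicit Types (x y z c u v : 'rV[R]_3) (X S : set 'rV[R]_3) (a b r t s : R).

Lemma mem_geodesic_circle y r x : dot y y = 1 -> 0 <= r <= pi ->
  geodesic_circle y r x <-> sphere x /\ dot y x = cos r.
Proof.
move=> y1 rpi; split=> -[x1 h]; split=> //.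
  by rewrite -h /gdist acosK// in_itv/= dot_unit_geN1// dot_unit_le1.
by rewrite /gdist h cosK// in_itv.
Qed.

Lemma perp_decomposition y x : dot y y = 1 -> exists e s,
  [/\ dot e e = 1, dot y e = 0, 0 <= s & x = dot y x *: y + s *: e].
Proof.
move=> y1.
have [w0|w0] := eqVneq (x - dot y x *: y) 0.
  have [e e1 [ye _]] := exists_perp y 0; exists e, 0; split=> //.
  by rewrite scale0r addr0; apply/eqP; rewrite -subr_eq0 w0.
exists (unitv (x - dot y x *: y)), (nrm (x - dot y x *: y)); split.
- exact: unitv1.
- by rewrite dotZr dotBr dotZr y1 mulr1 subrr mulr0.
- exact: nrm_ge0.
- by rewrite -unitvE addrC subrK.
Qed.

(** The great circle through the center and a point of the disk meets the boundary circle in two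
    points, of which the given one is a nonnegative combination with weights [A] and [B]. *)
Lemma cone_closed_disk X y r : cone_closed X -> dot y y = 1 -> 0 < r < pi / 2 ->
  geodesic_circle y r `<=` X -> forall x, dot x x = 1 -> cos r <= dot y x -> X x.
Proof.
move=> Xc y1 rb CX x x1 h; have pi0 := pi_gt0 R.
have sr : 0 < sin r by rewrite sin_gt0_pihalf.
have cr : 0 < cos r by apply: cos_gt0_pihalf; case/andP: rb => ? ?; apply/andP; split; lra.
have rpi : 0 <= r <= pi by case/andP: rb => ? ?; apply/andP; split; lra.
have [e [s [e1 ye s0 xE]]] := perp_decomposition x y1.
set t := dot y x in h xE.
have ts : t ^+ 2 + s ^+ 2 = 1.
  by rewrite -x1 xE !dot_lin y1 e1 (dotC e y) ye; ring.
have cs := cos2Dsin2 r.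
have ssr : s <= sin r.
  rewrite -ler_sqr ?nnegrE ?(ltW sr)//; have : cos r ^+ 2 <= t ^+ 2.
    by rewrite ler_sqr ?nnegrE ?(ltW cr)// (le_trans (ltW cr)).
  lra.
pose A := (t / cos r + s / sin r) / 2; pose B := (t / cos r - s / sin r) / 2.
have scr : 0 <= s / sin r by rewrite divr_ge0// ltW.
have le : s / sin r <= t / cos r.
  apply: (@le_trans _ _ 1); first by rewrite ler_pdivrMr// mul1r.
  by rewrite ler_pdivlMr// mul1r.
have A0 : 0 <= A by rewrite /A divr_ge0//; lra.
have B0 : 0 <= B by rewrite /B divr_ge0//; lra.
have onC eps : eps ^+ 2 = 1 -> X (cos r *: y + (eps * sin r) *: e).
  move=> e2; apply: CX; apply/mem_geodesic_circle => //; rewrite /sphere/= !dot_lin y1 e1 (dotC e) ye.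
  split; last by ring.
  transitivity (cos r ^+ 2 + eps ^+ 2 * sin r ^+ 2); first by ring.
  by rewrite e2 mul1r.
have xAB : x = A *: (cos r *: y + (1 * sin r) *: e) + B *: (cos r *: y + (-1 * sin r) *: e).
  rewrite {1}xE /A /B; apply: vec3P; rewrite !mxE; field; rewrite ?gt_eqF//.
rewrite -(unitv_id x1) xAB; apply: Xc => //; [exact/onC/expr1n|by apply: onC; rewrite sqrrN expr1n|].
by rewrite -xAB unit_neq0.
Qed.

(** The test is made at the point of the circle opposite to the tangential part of [n], where [n] is
    smallest. *)
Lemma admissible_of_circle y r (n : 'rV[R]_3) : dot y y = 1 -> 0 < r < pi / 2 ->
  (forall x, geodesic_circle y r x -> 0 <= dot n x) -> sin r * nrm n <= dot n y.
Proof.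
move=> y1 rb Cn; have pi0 := pi_gt0 R.
have sr : 0 < sin r by rewrite sin_gt0_pihalf.
have cr : 0 < cos r by apply: cos_gt0_pihalf; case/andP: rb => ? ?; apply/andP; split; lra.
have rpi : 0 <= r <= pi by case/andP: rb => ? ?; apply/andP; split; lra.
have [e [s [e1 ye s0 nE]]] := perp_decomposition n y1; rewrite [dot y n]dotC in nE.
have cs := cos2Dsin2 r.
have /Cn : geodesic_circle y r (cos r *: y - sin r *: e).
  apply/mem_geodesic_circle => //; rewrite /sphere/= !dot_lin y1 e1 (dotC e) ye.
  by split; [rewrite -[RHS]cs; ring|ring].
set t := dot n y in nE *; have nn : dot n n = t ^+ 2 + s ^+ 2.
  by rewrite {1 2}nE !dot_lin y1 e1 (dotC e y) ye; ring.
rewrite {1}nE !dot_lin y1 e1 (dotC e) ye => h.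
have {}h : s * sin r <= t * cos r by lra.
have t0 : 0 <= t by rewrite -(pmulr_lge0 _ cr) (le_trans _ h)// mulr_ge0// ltW.
rewrite -ler_sqr ?nnegrE ?mulr_ge0 ?nrm_ge0 ?(ltW sr)// exprMn nrm_sqr nn.
have : (s * sin r) ^+ 2 <= (t * cos r) ^+ 2.
  by rewrite ler_sqr ?nnegrE// mulr_ge0// ltW.
rewrite !exprMn (_ : cos r ^+ 2 = 1 - sin r ^+ 2); last by lra.
lra.
Qed.

Lemma compact_join (A B : set 'rV[R]_3) c : compact A -> compact B ->
  (forall x, A x -> 0 < dot c x) -> (forall x, B x -> 0 < dot c x) ->
  compact [set z | exists x y t, [/\ A x, B y, 0 <= t <= 1 & z = unitv ((1 - t) *: x + t *: y)]].
Proof.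
move=> cA cB cA0 cB0.
have pos (t p q : R) : 0 <= t -> t <= 1 -> 0 < p -> 0 < q -> 0 < (1 - t) * p + t * q by nra.
pose f (p : 'rV[R]_3 * 'rV[R]_3 * R) := unitv ((1 - p.2) *: p.1.1 + p.2 *: p.1.2).
have -> : [set z | exists x y t, [/\ A x, B y, 0 <= t <= 1 & z = unitv ((1 - t) *: x + t *: y)]] =
    f @` (A `*` B `*` `[0, 1]).
  apply/seteqP; split=> [z [x [y [t [Ax By t01 ->]]]]|z [[[x y] t] /= [[Ax By] t01] <-]].
    by exists (x, y, t).
  by exists x, y, t.
apply: continuous_compact; last first.
  by apply: compact_setX; [exact: compact_setX|exact: segment_compact].
apply: continuous_in_subspaceT => -[[x y] t]; rewrite inE/= => -[[Ax By]]; rewrite in_itv/= => /andP[t0 t1].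
rewrite /f; apply: unitv_cvg => /=.
  apply/eqP => /(congr1 (dot c)); rewrite !dot_lin => e.
  by have := pos t _ _ t0 t1 (cA0 _ Ax) (cB0 _ By); rewrite e dot0r ltxx.
have cp2 : p.2 @[p --> (x, y, t)] --> t by exact: cvg_snd.
have cp1 : p.1.1 @[p --> (x, y, t)] --> x.
  exact: (cvg_comp _ _ (@cvg_fst _ _ (nbhs (x, y)) (nbhs t) _) (@cvg_fst _ _ (nbhs x) (nbhs y) _)).
have cp12 : p.1.2 @[p --> (x, y, t)] --> y.
  exact: (cvg_comp _ _ (@cvg_fst _ _ (nbhs (x, y)) (nbhs t) _) (@cvg_snd _ _ (nbhs x) (nbhs y) _)).
apply: cvgD; apply: cvgZ => //.
by apply: cvgB => //; exact: cvg_cst.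
Qed.

(** A hull need not be closed, so separation is applied to this explicit join. It is compact as the
    image of a product, the vector [c] keeping combinations away from 0, and collecting the weights
    inside each disk shows that it is cone closed. *)
Lemma cone_closed_disk_join c y1 y2 r : dot y1 y1 = 1 -> dot y2 y2 = 1 -> 0 < r < pi / 2 ->
  (forall x, dot x x = 1 -> cos r <= dot y1 x -> 0 < dot c x) ->
  (forall x, dot x x = 1 -> cos r <= dot y2 x -> 0 < dot c x) ->
  exists T, [/\ compact T, T `<=` sphere, cone_closed T,
    (forall x, dot x x = 1 -> cos r <= dot y1 x \/ cos r <= dot y2 x -> T x) &
    forall X, cone_closed X -> (forall x, dot x x = 1 -> cos r <= dot y1 x -> X x) ->
      (forall x, dot x x = 1 -> cos r <= dot y2 x -> X x) -> T `<=` X].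
Proof.
move=> y11 y21 rb cy1 cy2.
have cr : 0 < cos r by apply: cos_gt0_pihalf; case/andP: rb => ? ?; apply/andP; split; lra.
pose D y : set 'rV[R]_3 := sphere `&` [set x | cos r <= dot y x].
have cD y : compact (D y).
  apply: compact_sub_sphere; first by move=> x [].
  by apply: closedI; [exact: closed_sphere|exact: closed_halfspace].
have D1 x : D y1 x -> 0 < dot c x by move=> [? ?]; exact: cy1.
have D2 x : D y2 x -> 0 < dot c x by move=> [? ?]; exact: cy2.
have coneD y x1 x2 p q : D y x1 -> D y x2 -> 0 <= p -> 0 <= q -> exists m x, [/\ D y x, 0 <= m &
    p *: x1 + q *: x2 = m *: x].
  move=> [h11 h12] [h21 h22] p0 q0; have [->|z0] := eqVneq (p *: x1 + q *: x2) 0.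
    by exists 0, x1; rewrite scale0r.
  exists (nrm (p *: x1 + q *: x2)), (unitv (p *: x1 + q *: x2)).
  split; [|exact: nrm_ge0|exact: unitvE]; split; first exact: unitv1.
  have x11 : nrm x1 = 1 by exact: nrm1.
  have x21 : nrm x2 = 1 by exact: nrm1.
  rewrite /= dotZr mulrC ler_pdivlMr ?nrm_gt0// !dot_lin.
  have le := nrmD (p *: x1) (q *: x2); rewrite !nrmZ// x11 x21 !mulr1 in le.
  apply: (le_trans (ler_wpM2l (ltW cr) le)); rewrite mulrDr.
  by apply: lerD; rewrite mulrC ler_wpM2l.
pose T := [set z | exists x y t, [/\ D y1 x, D y2 y, 0 <= t <= 1 & z = unitv ((1 - t) *: x + t *: y)]].
have pos (t p q : R) : 0 <= t -> t <= 1 -> 0 < p -> 0 < q -> 0 < (1 - t) * p + t * q by nra.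
have nz x y t : D y1 x -> D y2 y -> 0 <= t <= 1 -> (1 - t) *: x + t *: y != 0.
  move=> Dx Dy /andP[t0 t1]; apply/eqP => /(congr1 (dot c)); rewrite !dot_lin dot0r => e.
  by have := pos t _ _ t0 t1 (D1 _ Dx) (D2 _ Dy); rewrite e ltxx.
have comb x y p q : D y1 x -> D y2 y -> 0 <= p -> 0 <= q -> p *: x + q *: y != 0 ->
    T (unitv (p *: x + q *: y)).
  move=> Dx Dy p0 q0 z0; have pq : 0 < p + q.
    rewrite lt_def addr_ge0// andbT; apply: contraNneq z0 => /eqP.
    by rewrite paddr_eq0// => /andP[/eqP -> /eqP ->]; rewrite !scale0r addr0.
  exists x, y, (q / (p + q)); split=> //.
    by rewrite divr_ge0 ?(ltW pq)//= ler_pdivrMr// mul1r lerDr.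
  have pqE : (p + q) * (q / (p + q)) = q by rewrite mulrC divfK// gt_eqF.
  have e : (p + q) *: ((1 - q / (p + q)) *: x + (q / (p + q)) *: y) = p *: x + q *: y.
    by rewrite scalerDr !scalerA mulrBr mulr1 pqE addrK.
  by rewrite -e unitvZ.
exists T; split.
- exact: (compact_join (cD y1) (cD y2) D1 D2).
- by move=> z [x [y [t [Dx Dy t01 ->]]]]; apply: unitv1; exact: nz.
- move=> z z' p q [x [y [t [Dx Dy /[dup] t01 /andP[t0 t1] ->]]]]
    [x' [y' [t' [Dx' Dy' /[dup] t01' /andP[t0' t1'] ->]]]] p0 q0.
  rewrite /unitv !scalerA; set p' := p / _; set q' := q / _.
  have p'0 : 0 <= p' by rewrite divr_ge0 ?nrm_ge0.
  have q'0 : 0 <= q' by rewrite divr_ge0 ?nrm_ge0.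
  have s1 : 0 <= 1 - t by rewrite subr_ge0.
  have s1' : 0 <= 1 - t' by rewrite subr_ge0.
  have [m1 [x2 [Dx2 m10 e1]]] := coneD _ _ _ _ _ Dx Dx' (mulr_ge0 p'0 s1) (mulr_ge0 q'0 s1').
  have [m2 [y2' [Dy2 m20 e2]]] := coneD _ _ _ _ _ Dy Dy' (mulr_ge0 p'0 t0) (mulr_ge0 q'0 t0').
  have -> : p' *: ((1 - t) *: x + t *: y) + q' *: ((1 - t') *: x' + t' *: y') =
      ((p' * (1 - t)) *: x + (q' * (1 - t')) *: x') + ((p' * t) *: y + (q' * t') *: y').
    by rewrite !scalerDr !scalerA addrACA.
  by rewrite e1 e2 => z0; exact: comb.
- move=> x x1 xx.
  have [Dx|Dx] : D y1 x \/ D y2 x by case: xx => ?; [left|right].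
    have Dy2 : D y2 y2 by split; rewrite /= ?y21 ?cos_le1.
    by have := comb x y2 1 0 Dx Dy2 ler01 (lexx 0); rewrite scale1r scale0r addr0 unitv_id//; apply; exact: unit_neq0.
  have Dy1 : D y1 y1 by split; rewrite /= ?y11 ?cos_le1.
  by have := comb y1 x 0 1 Dy1 Dx (lexx 0) ler01; rewrite scale1r scale0r add0r unitv_id//; apply; exact: unit_neq0.
- move=> X Xc X1 X2 z [x [y [t [Dx Dy /[dup] t01 /andP[t0 t1] ->]]]]; apply: Xc => //.
  + by case: Dx => *; exact: X1.
  + by case: Dy => *; exact: X2.
  + by rewrite subr_ge0.
  + exact: nz.
Qed.

(** A point of the standard sausage outside the join of the two disks would be separated from it by
    a vector nonnegative on both disks, hence admissible. *)
Lemma hull_std_sausage c u v r a : orthonormal_frame c u v -> 0 < r < pi / 2 ->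
  0 <= a -> a + r < pi / 2 ->
  geodesic_hull (geodesic_circle (ray_point c u a) r `|` geodesic_circle (ray_point c (- u) a) r) =
  std_sausage c u r a.
Proof.
move=> F rb a0 ar; have [[c1 u1 v1] [cu cv uv]] := F; have pi0 := pi_gt0 R.
have uN1 : dot (- u) (- u) = 1 by rewrite dotNl dotNr opprK.
have cuN : dot c (- u) = 0 by rewrite dotNr cu oppr0.
have y11 := ray_point1 a c1 u1 cu; have y21 := ray_point1 a c1 uN1 cuN.
have rpi : 0 <= r <= pi by case/andP: rb => ? ?; apply/andP; split; lra.
have FN : orthonormal_frame c (- u) v by split; split=> //; rewrite dotNl uv oppr0.
have S1 x : dot x x = 1 -> cos r <= dot (ray_point c u a) x -> std_sausage c u r a x.
  by move=> x1 h; exact: (std_sausage_disk F rb).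
have S2 x : dot x x = 1 -> cos r <= dot (ray_point c (- u) a) x -> std_sausage c u r a x.
  by move=> x1 h; rewrite -std_sausage_opp; exact: (std_sausage_disk FN rb).
have car : 0 < cos (a + r) by apply: cos_gt0_pihalf; case/andP: rb => ? ?; apply/andP; split; lra.
have pos x : std_sausage c u r a x -> 0 < dot c x.
  by move=> /(std_sausage_ge F rb a0 ar); exact: lt_le_trans.
have C1 y := mem_geodesic_circle y y11 rpi; have C2 y := mem_geodesic_circle y y21 rpi.
apply/seteqP; split=> [x hx|x Sx X [Xg CX]].
  apply: (hx (std_sausage c u r a)); split; first exact: (std_sausage_geodesically_convex F rb).
  by move=> y [/C1|/C2] [y1 h]; [apply: S1|apply: S2] => //; rewrite h.
have Xc := geodesically_convex_cone Xg.
have [T [Tcp Ts Tc TD TX]] := cone_closed_disk_join y11 y21 rb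
  (fun x e h => pos x (S1 x e h)) (fun x e h => pos x (S2 x e h)).
have {}TX : T `<=` X.
  apply: TX => // z; apply: (cone_closed_disk Xc) => // y Cy; apply: CX; [by left|by right].
apply: TX; apply: contrapT => nTx; have [x1 Sx'] := Sx.
have [n [Tn nx]] := separation Tcp Ts Tc x1 nTx.
suff : 0 <= dot n x by lra.
apply: Sx'; apply: admissible_of_circle => // y; [move=> /C1|move=> /C2] => -[y1 h]; apply: Tn; apply: TD => //.
  by left; rewrite h.
by right; rewrite h.
Qed.

Lemma bisector_frame y1 y2 : dot y1 y1 = 1 -> dot y2 y2 = 1 -> y1 + y2 != 0 ->
  exists c u v a, [/\ orthonormal_frame c u v, 0 <= a <= pi / 2,
    y1 = ray_point c u a & y2 = ray_point c (- u) a].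
Proof.
move=> y11 y21 s0; have pi0 := pi_gt0 R.
have n0 : 0 < nrm (y1 + y2) by rewrite nrm_gt0.
have [u [u1 su e]] : exists u, [/\ dot u u = 1, dot (y1 + y2) u = 0 &
    y1 - y2 = nrm (y1 - y2) *: u].
  have [->|d0] := eqVneq (y1 - y2) 0.
    have [u u1 [su _]] := exists_perp (y1 + y2) 0.
    by exists u; rewrite /nrm dot0l sqrtr0 scale0r.
  exists (unitv (y1 - y2)); split; [exact: unitv1| |exact: unitvE].
  by rewrite dotZr !dot_lin y11 y21 (dotC y2 y1); ring.
set c := unitv (y1 + y2); have c1 : dot c c = 1 by exact: unitv1.
have cE : y1 + y2 = nrm (y1 + y2) *: c by exact: unitvE.
have cu : dot c u = 0 by rewrite /c /unitv dotZl su mulr0.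
have [v F] := exists_frame c1 u1 cu.
have [/andP[a0 api] ca sa] : [/\ 0 <= acos (nrm (y1 + y2) / 2) <= pi,
    cos (acos (nrm (y1 + y2) / 2)) = nrm (y1 + y2) / 2 &
    sin (acos (nrm (y1 + y2) / 2)) = nrm (y1 - y2) / 2].
  apply: acos_cos_sin; first by rewrite divr_ge0 ?nrm_ge0.
  by rewrite !expr_div_n !nrm_sqr !dot_lin y11 y21 (dotC y2 y1); field.
exists c, u, v, (acos (nrm (y1 + y2) / 2)); rewrite /ray_point ca sa; split=> //.
- apply/andP; split=> //; rewrite leNgt; apply/negP => lt.
  have : cos (acos (nrm (y1 + y2) / 2)) < cos (pi / 2).
    by rewrite cos_le_lt ?a0 ?api//; apply/andP; split; lra.
  by rewrite cos_pihalf ca ltNge divr_ge0// ltW.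
- by rewrite ![_ / 2]mulrC -!scalerA -cE -e; apply: vec3P; rewrite !mxE; field.
- by rewrite scalerN ![_ / 2]mulrC -!scalerA -cE -e; apply: vec3P; rewrite !mxE; field.
Qed.

(** An open hemisphere together with two antipodal boundary points is convex but not closed; it
    bounds the hull from outside in the limit case of [sausageP]. *)
Let pierced_convex c u : dot c c = 1 -> dot u u = 1 -> dot c u = 0 ->
  geodesically_convex [set x | sphere x /\ [\/ 0 < dot c x, x = u | x = - u]].
Proof.
move=> c1 u1 cu; have u0 := unit_neq0 u1.
have ge x : [\/ 0 < dot c x, x = u | x = - u] -> 0 <= dot c x.
  by move=> [/ltW//|->|->]; rewrite ?dotNr cu ?oppr0.
have eq0 x : [\/ 0 < dot c x, x = u | x = - u] -> dot c x = 0 -> exists2 e : R, e != 0 & x = e *: u.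
  move=> [h h0|-> _|-> _]; first by rewrite h0 ltxx in h.
    by exists 1; rewrite ?oner_eq0// scale1r.
  by exists (-1); rewrite ?oppr_eq0 ?oner_eq0// scaleN1r.
have unitu k : k *: u != 0 -> unitv (k *: u) = u \/ unitv (k *: u) = - u.
  rewrite scaler_eq0 negb_or => /andP[k0 _]; have [kp|kn|k00] := ltgtP k 0.
  - right; rewrite -[k]opprK scaleNr -scalerN unitvZ ?oppr_gt0// unitv_id//.
    by rewrite dotNl dotNr opprK.
  - by left; rewrite unitvZ// unitv_id.
  - by rewrite k00 eqxx in k0.
apply: cone_geodesically_convex; first by move=> x [].
- move=> x y p q [x1 hx] [y1 hy] p0 q0 z0; split; first exact: unitv1.
  have gx := ge _ hx; have gy := ge _ hy.
  have : 0 <= dot c (p *: x + q *: y) by rewrite !dot_lin addr_ge0// mulr_ge0.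
  rewrite le_eqVlt => /predU1P[/esym|h]; last by apply: Or31; rewrite dot_unitvr_gt0.
  rewrite !dot_lin => /eqP; rewrite paddr_eq0 ?mulr_ge0// !mulf_eq0.
  move=> /andP[/orP[/eqP pz|/eqP cx] /orP[/eqP qz|/eqP cy]].
  + by rewrite pz qz !scale0r addr0 eqxx in z0.
  + have [e _ yE] := eq0 _ hy cy.
    move: z0; rewrite pz scale0r add0r yE scalerA => /unitu[->|->]; [exact: Or32|exact: Or33].
  + have [e _ xE] := eq0 _ hx cx.
    move: z0; rewrite qz scale0r addr0 xE scalerA => /unitu[->|->]; [exact: Or32|exact: Or33].
  + have [e _ xE] := eq0 _ hx cx; have [e' _ yE] := eq0 _ hy cy.
    move: z0; rewrite xE yE !scalerA -scalerDl => /unitu[->|->]; [exact: Or32|exact: Or33].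
- move=> x [x1 hx] [_ hNx]; exists c.
  have cx : dot c x = 0 by have := ge _ hx; have := ge _ hNx; rewrite dotNr; lra.
  split=> //; first by rewrite dotC.
  move=> t /andP[t0 tpi]; have s0 : 0 <= sin t by rewrite sin_ge0_pi// t0.
  rewrite /geodesic; split.
    rewrite /sphere/= !dot_lin c1 (dotC x) cx x1 -[RHS](cos2Dsin2 t); ring.
  move: s0; rewrite le_eqVlt => /predU1P[/esym s0|s0]; last first.
    by apply: Or31; rewrite !dot_lin cx c1 mulr0 add0r mulr1.
  have [tE|tE] : t = 0 \/ t = pi by apply: sin_eq0_0pi => //; rewrite t0.
    by rewrite tE cos0 sin0 scale1r scale0r addr0.
  by rewrite tE cospi sinpi scaleN1r scale0r addr0.
Qed.

(* When the two disks reach antipodal points, that is [a + r = pi / 2], the hull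
   is not closed: the geodesics from one tip to points near the other one
   accumulate at points outside of it. *)
Lemma sausageP lambda S : 0 < lambda -> lambda_sausage lambda S -> exists2 r,
  0 < r < pi / 2 & (forall c, sphere c -> circle_of_curvature lambda c r) /\
  (S = sphere \/ exists c u v a, [/\ orthonormal_frame c u v, 0 <= a, a + r < pi / 2 &
    S = std_sausage c u r a]).
Proof.
move=> l0 [[Scp Sg Sint] [y1 [y2 [r [r' [C1 C2 SE]]]]]].
have rr := circle_of_curvature_radius C1 C2; rewrite -{r'}rr in C2 SE.
have [y11 rpi cl] := (circle_of_curvatureP _ _ _).1 C1.
have [y21 _ _] := (circle_of_curvatureP _ _ _).1 C2.
have rh := curvature_radius_lt_pihalf l0 rpi cl; have pi0 := pi_gt0 R.
have rb : 0 < r < pi / 2 by rewrite rh andbT; case/andP: rpi.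
exists r => //; split; first by move=> c c1; apply/circle_of_curvatureP.
have Ss := Sg.1; have Sc := geodesically_convex_cone Sg.
have [->|[n n1 Sn]] := full_or_supported Scp Ss Sc; [by left|right].
have sr : 0 < sin r by rewrite sin_gt0_pihalf.
have CS : geodesic_circle y1 r `|` geodesic_circle y2 r `<=` S.
  by rewrite SE => x Cx X [_]; exact.
have adm (m : 'rV[R]_3) : dual_cone S m -> sin r * nrm m <= dot m y1 /\ sin r * nrm m <= dot m y2.
  by move=> Sm; split; apply: admissible_of_circle => // x Cx; apply: Sm; apply: CS; [left|right].
rewrite /sphere/= in y11 y21.
have [c [u [v [a [F /andP[a0 ah] E1 E2]]]]] : exists c u v a, [/\ orthonormal_frame c u v,
    0 <= a <= pi / 2, y1 = ray_point c u a & y2 = ray_point c (- u) a].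
  apply: bisector_frame => //; apply/eqP => /(congr1 (dot n)).
  by have [] := adm n Sn; rewrite (nrm1 n1) !dot_lin dot0r; lra.
have [[c1 u1 v1] [cu cv uv]] := F.
have [nc1 nc2] := adm n Sn; rewrite (nrm1 n1) mulr1 E1 E2 /ray_point !dot_lin in nc1 nc2.
have ca0 : 0 <= cos a.
  by apply: cos_ge0_pihalf; move: a0 ah pi0; clear => *; apply/andP; split; lra.
(* The average of the two conditions on the dual vector [n]; it bounds [a + r] by pi/2. *)
have sca : sin r <= cos a.
  by have := ler_wpM2l ca0 (dot_unit_le1 n1 c1); move: nc1 nc2; clear; lra.
have r0 : 0 < r by case/andP: rb.
have ar : a + r <= pi / 2.
  rewrite leNgt; apply/negP => lt; suff : cos a < cos (pi / 2 - r).
    by rewrite cosB cos_pihalf sin_pihalf mul0r add0r mul1r ltNge sca.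
  rewrite cos_le_lt; move: lt ah a0 r0 rh pi0; clear => *; first lra.
    by apply/andP; split; lra.
  by apply/andP; split; lra.
exists c, u, v, a; have [ar'|ar'] := ltP (a + r) (pi / 2).
  by split=> //; rewrite SE E1 E2 (hull_std_sausage F).
exfalso; have aE : a = pi / 2 - r by apply/eqP; rewrite eq_sym subr_eq eq_le ar ar'.
have caE : cos a = sin r by rewrite aE cosB cos_pihalf sin_pihalf; ring.
have saE : sin a = cos r by rewrite aE sinB cos_pihalf sin_pihalf; ring.
have cr : 0 < cos r.
  by apply: cos_gt0_pihalf; move: r0 rh; clear => *; apply/andP; split; lra.
have rpi' : 0 <= r <= pi by move: r0 rh pi0; clear => *; apply/andP; split; lra.
have circ e x : e = u \/ e = - u -> geodesic_circle (ray_point c e a) r x -> 0 < dot c x \/ x = e.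
  move=> eu; have [e1 ce] : dot e e = 1 /\ dot c e = 0.
    by case: eu => ->; rewrite ?dotNl ?dotNr ?opprK ?cu ?oppr0.
  have p1 := ray_point1 a c1 e1 ce.
  move=> /(mem_geodesic_circle _ p1 rpi')[x1 h].
  have cx : 0 <= dot c x.
    apply: (disk_in_dual rb p1 x1); last by rewrite h.
    by rewrite (nrm1 c1) /ray_point !dot_lin c1 ce caE; clear; lra.
  move: cx; rewrite le_eqVlt => /predU1P[/esym cx|]; [right|by left].
  move: h; rewrite /ray_point !dot_lin cx mulr0 add0r saE => h.
  apply/esym/dot_unit_eq1 => //; apply: (mulfI (lt0r_neq0 cr)); by rewrite h mulr1.
pose X := [set x | sphere x /\ [\/ 0 < dot c x, x = u | x = - u]].
have SX : S `<=` X.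
  rewrite SE => x; apply; split; first exact: pierced_convex.
  rewrite E1 E2 => y [] Cy; split; try by case: Cy.
    by have [h|h] := circ u y (or_introl erefl) Cy; [exact: Or31|exact: Or32].
  by have [h|h] := circ (- u) y (or_intror erefl) Cy; [exact: Or31|exact: Or33].
have nSv : ~ S v.
  move=> /SX[_ [|vu|vu]]; first by rewrite cv ltxx.
    by move: uv; rewrite vu u1 => /eqP; rewrite oner_eq0.
  by move: uv; rewrite vu dotNr u1 => /eqP; rewrite oppr_eq0 oner_eq0.
(* Since [u] and [- u] are in [S], [m] is orthogonal to [u], and the condition at the first disk
   becomes [nrm m <= dot m c]. Then [m] is a multiple of [c], against [dot m v < 0]. *)
have [m [Sm mv]] := separation Scp Ss Sc v1 nSv.
have tip e : e = u \/ e = - u -> S e.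
  move=> eu; have [e1 ce] : dot e e = 1 /\ dot c e = 0.
    by case: eu => ->; rewrite ?dotNl ?dotNr ?opprK ?cu ?oppr0.
  apply: CS; rewrite E1 E2; case: eu => eE; rewrite eE in e1 ce *; [left|right].
    apply/mem_geodesic_circle => //; first exact: ray_point1.
    by split=> //; rewrite /ray_point !dot_lin cu u1 saE; ring.
  apply/mem_geodesic_circle => //; first exact: ray_point1.
  by split=> //; rewrite /ray_point !dot_lin cu u1 saE; ring.
have mu0 : dot m u = 0.
  have := Sm _ (tip u (or_introl erefl)); have := Sm _ (tip (- u) (or_intror erefl)).
  by rewrite dotNr; clear; lra.
have [+ _] := adm m Sm; rewrite E1 /ray_point !dot_lin mu0 caE => h.
have {}h : nrm m <= dot m c by rewrite -(ler_pM2l sr); move: h; clear; lra.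
have mm := frame_dot m m F; rewrite -nrm_sqr mu0 in mm.
by have := nrm_ge0 m; move: h mm mv; clear; nra.
Qed.

End Hull.

(** * Area in sectors *)

Section MonotoneProfile.
Context {R : realType}.
Local Notation mu := (@lebesgue_measure R).
Variables (g : R -> R) (M : R).
Hypothesis mg : measurable_fun [set: measurableTypeR R] g.
Hypothesis g0 : forall t, 0 <= g t.
Hypothesis gM : forall t, g t <= M.

Definition profile_integral (x y : R) : R := fine (\int[mu]_(t in `[x, y]) (g t)%:E)%E.
Local Notation I := profile_integral.

Let mgE : measurable_fun [set: measurableTypeR R] (fun t => (g t)%:E).
Proof. exact/measurable_EFinP. Qed.

Let const_integral x y (k : R) : x <= y -> (\int[mu]_(t in `[x, y]) (cst k%:E t) = (k * (y - x))%:E)%E.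
Proof.
move=> xy; rewrite integral_cst//= lebesgue_measure_itv/= lte_fin; case: ltP => [_|yx].
  by rewrite -EFinB -EFinM.
have -> : y = x by apply/le_anti; rewrite xy yx.
by rewrite subrr mulr0 mule0.
Qed.

Lemma profile_integralE x y : x <= y -> (\int[mu]_(t in `[x, y]) (g t)%:E = (I x y)%:E)%E.
Proof.
move=> xy; rewrite fineK// ge0_fin_numE; last by apply: integral_ge0 => t _; rewrite lee_fin.
apply: (@le_lt_trans _ _ (\int[mu]_(t in `[x, y]) (cst M%:E t))%E); last by rewrite const_integral ?ltry.
apply: ge0_le_integral => //; try by move=> t _; rewrite /= lee_fin.
exact: measurable_funTS.
Qed.

Lemma profile_integral_split x y z : x <= y -> y <= z -> I x z = I x y + I y z.
Proof.
move=> xy yz; apply: EFin_inj; rewrite EFinD -!profile_integralE//; last exact: le_trans yz.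
by apply: integral_itv_split => // t; rewrite lee_fin.
Qed.

Lemma profile_integral_ge x y k : x <= y -> 0 <= k -> (forall t, x <= t <= y -> k <= g t) ->
  k * (y - x) <= I x y.
Proof.
move=> xy k0 kg; rewrite -lee_fin -profile_integralE// -const_integral//.
apply: ge0_le_integral => //; try by move=> t _; rewrite /= lee_fin.
exact: measurable_funTS.
Qed.

Lemma profile_integral_le x y k : x <= y -> (forall t, x <= t <= y -> g t <= k) ->
  I x y <= k * (y - x).
Proof.
move=> xy gk; rewrite -lee_fin -profile_integralE// -const_integral//.
have k0 : 0 <= k by apply: le_trans (g0 x) (gk x _); rewrite lexx.
apply: ge0_le_integral => //; try by move=> t _; rewrite /= lee_fin.
exact: measurable_funTS.
Qed.

Variable L : R.
Hypothesis L0 : 0 < L.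
Hypothesis gdec : forall s t, 0 <= s -> s <= t -> t <= L -> g t <= g s.

Local Ltac narrow := clear - g M mg g0 gM L L0 gdec.

(** The value [g b] separates the mean over the first part of the interval from the mean over the
    rest. *)
Lemma profile_concave b : 0 <= b <= L -> b * I 0 L <= L * I 0 b.
Proof.
move=> /andP[b0 bL]; rewrite (profile_integral_split b0 bL).
have h1 : g b * (b - 0) <= I 0 b.
  by apply: profile_integral_ge => // t /andP[t0 tb]; exact: gdec.
have h2 : I b L <= g b * (L - b).
  by apply: profile_integral_le => // t /andP[bt tL]; exact: gdec.
have Lb : 0 <= L - b by lra.
have := ler_wpM2l Lb h1; have := ler_wpM2l b0 h2; lra.
Qed.

(** The value [g b] cannot be both at least [k1] and at most [k2], so one of the two comparisons of
    means is strict near the corresponding end of the interval. *)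
Lemma profile_strictly_concave b d k1 k2 : 0 < b < L -> 0 < d -> k2 < k1 ->
  (forall t, 0 <= t <= d -> k1 <= g t) -> (forall t, L - d <= t <= L -> g t <= k2) ->
  b * I 0 L < L * I 0 b.
Proof.
move=> /andP[b0 bL] d0 kk gk1 gk2; rewrite (profile_integral_split (ltW b0) (ltW bL)).
have k20 : 0 <= k2 by apply: le_trans (g0 L) (gk2 L _); rewrite lexx andbT gerBl ltW.
have Lb : 0 < L - b by rewrite subr_gt0.
have h1 : g b * (b - 0) <= I 0 b.
  by apply: profile_integral_ge => [||t /andP[t0 tb]]; [exact: ltW|by []|apply: gdec => //; exact: ltW].
have h2 : I b L <= g b * (L - b).
  by apply: profile_integral_le => [|t /andP[bt tL]]; [exact: ltW|apply: gdec => //; exact: ltW].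
suff [h|h] : g b * (b - 0) < I 0 b \/ I b L < g b * (L - b).
- have := ler_wpM2l (ltW b0) h2; have : (L - b) * (g b * (b - 0)) < (L - b) * I 0 b by rewrite ltr_pM2l.
  by move: (I 0 b) (I b L) => i j; narrow; lra.
- have := ler_wpM2l (ltW Lb) h1; have : b * I b L < b * (g b * (L - b)) by rewrite ltr_pM2l.
  by move: (I 0 b) (I b L) => i j; narrow; lra.
have [gb|gb] := ltP (g b) k1.
- left; pose e := Num.min d b.
  have e0 : 0 < e by rewrite lt_min d0 b0.
  have eb : e <= b by rewrite ge_min lexx orbT.
  have ed : e <= d by rewrite ge_min lexx.
  rewrite (@profile_integral_split 0 e b); [|exact: ltW|by []].
  have h3 : k1 * (e - 0) <= I 0 e.
    apply: profile_integral_ge => [||t /andP[t0 te]]; [exact: ltW|exact: le_trans (ltW kk)|].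
    by apply: gk1; rewrite t0 (le_trans te).
  have h4 : g b * (b - e) <= I e b.
    apply: profile_integral_ge => [||t /andP[te tb]]; [by []|by []|].
    by apply: gdec => //; [exact: le_trans (ltW e0) te|exact: ltW].
  have : g b * e < k1 * e by rewrite ltr_pM2r.
  by move: h3 h4; narrow; lra.
- right; pose e := Num.min d (L - b).
  have e0 : 0 < e by rewrite lt_min d0 Lb.
  have eb : e <= L - b by rewrite ge_min lexx orbT.
  have ed : e <= d by rewrite ge_min lexx.
  have [l1 l2] : b <= L - e /\ L - e <= L by move: e0 eb; narrow => *; split; lra.
  rewrite (@profile_integral_split b (L - e) L)//.
  have h3 : I (L - e) L <= k2 * (L - (L - e)).
    apply: profile_integral_le => [|t /andP[t0 te]]; [by []|].
    by apply: gk2; rewrite te andbT (le_trans _ t0)// lerB.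
  have h4 : I b (L - e) <= g b * (L - e - b).
    apply: profile_integral_le => [|t /andP[bt te]]; [by []|].
    by apply: gdec => //; [exact: ltW|exact: le_trans te l2].
  have : k2 * e < g b * e by rewrite ltr_pM2r//; exact: lt_le_trans gb.
  by move: h3 h4; narrow; lra.
Qed.

End MonotoneProfile.

(** * Bounds on the area of a slice *)

Section SliceBounds.
Context {R : realType}.
Local Notation mu := (@lebesgue_measure R).
Local Notation RR := (measurableTypeR R).
Implicit Types (u v c : 'rV[R]_3) (X Y : set 'rV[R]_3).

Let measurable_cap (e : R) : measurable_fun [set: RR] (fun phi => (`|sin phi| * \1_(`[0, e]%classic : set RR) phi)%:E).
Proof.
apply/measurable_EFinP; apply: measurable_funM; last exact: measurable_indic.
apply: measurableT_comp => //; apply: continuous_measurable_fun; exact: continuous_sin.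
Qed.

Let measurable_dens u v c X t : closed X ->
  measurable_fun [set: RR] (fun phi => slice_density u v c X (t, phi)).
Proof.
move=> cX; apply: (measurableT_comp (measurable_slice_density u v c cX)).
exact: measurable_fun_pair.
Qed.

Lemma slice_area_ge_cap u v c X t e : closed X -> 0 < e <= pi ->
  (forall psi, 0 <= psi <= e -> X (frame_point u v c psi t)) ->
  ((1 - cos e)%:E <= slice_area u v c X t)%E.
Proof.
move=> cX epi Xe; rewrite -integral_sin_cap//; apply: ge0_le_integral => //=.
- exact: measurable_funTS.
- by apply: measurable_funTS; exact: measurable_dens.
move=> phi _; rewrite lee_fin ler_wpM2l// !indicE ler_nat.
have [pe|pe] := boolP (phi \in `[0, e]%classic); last by rewrite leq0n.
by rewrite mem_set//; apply: Xe; move: pe; rewrite inE/= in_itv.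
Qed.

Lemma slice_area_le_cap u v c X t e : closed X -> 0 < e <= pi ->
  (forall psi, 0 <= psi <= pi -> X (frame_point u v c psi t) -> psi <= e) ->
  (slice_area u v c X t <= (1 - cos e)%:E)%E.
Proof.
move=> cX epi Xe; rewrite -integral_sin_cap//; apply: ge0_le_integral => //=.
- by move=> phi _; exact: slice_density_ge0.
- by apply: measurable_funTS; exact: measurable_dens.
- exact: measurable_funTS.
move=> phi; rewrite in_itv/= => phi0; rewrite lee_fin ler_wpM2l// !indicE ler_nat.
have [pe|pe] := pselect (X (frame_point u v c phi t)); last by rewrite (memNset pe).
rewrite (mem_set pe) mem_set//= in_itv/=; have := Xe _ phi0 pe.
by case/andP: phi0 => -> _.
Qed.

Lemma slice_area_mono u v c X u' v' c' Y t t' : closed X -> closed Y ->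
  (forall psi, 0 <= psi <= pi -> X (frame_point u v c psi t) -> Y (frame_point u' v' c' psi t')) ->
  (slice_area u v c X t <= slice_area u' v' c' Y t')%E.
Proof.
move=> cX cY XY; apply: ge0_le_integral => //=.
- by move=> phi _; exact: slice_density_ge0.
- by apply: measurable_funTS; exact: measurable_dens.
- by apply: measurable_funTS; exact: measurable_dens.
move=> phi; rewrite in_itv/= => phi0; rewrite lee_fin ler_wpM2l// !indicE ler_nat.
have [pe|pe] := pselect (X (frame_point u v c phi t)); last by rewrite (memNset pe).
by rewrite (mem_set pe) mem_set//; exact: XY.
Qed.

End SliceBounds.

(* The basis used here is irrelevant, see [profileE]. *)
HB.lock Definition profile (R : realType) (r a phi : R) : R :=
  fine (slice_area (delta_mx 0 i0) (delta_mx 0 i1) (delta_mx 0 i2)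
    (std_sausage (delta_mx 0 i2) (delta_mx 0 i0) r a) phi).
Arguments profile {R}.

Section Sectors.
Context {R : realType}.
Local Notation mu := (@lebesgue_measure R).
Local Notation RR := (measurableTypeR R).
Implicit Types (u v c w z : 'rV[R]_3) (K S X : set 'rV[R]_3) (a b r t psi phi : R).

Opaque slice_area.

Definition direction u v t := cos t *: u + sin t *: v.

Let standard_frame : orthonormal_frame (delta_mx 0 i2 : 'rV[R]_3) (delta_mx 0 i0) (delta_mx 0 i1).
Proof. by split; split; rewrite dotE !mxE /=; ring. Qed.

Let slice_fineK u v c X t : closed X -> slice_area u v c X t = (fine (slice_area u v c X t))%:E.
Proof.
move=> cX; rewrite fineK// ge0_fin_numE ?slice_area_ge0//.
by apply: le_lt_trans (slice_area_le _ _ _ _ cX) _; rewrite ltry.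
Qed.

Lemma profileE c u v r a phi : orthonormal_frame c u v ->
  slice_area u v c (std_sausage c u r a) phi = (profile r a phi)%:E.
Proof.
move=> F; rewrite profile.unlock -slice_fineK; last exact: closed_std_sausage.
apply/le_anti/andP; split; apply: slice_area_mono; try exact: closed_std_sausage.
- by move=> psi _ /(std_sausage_pointP _ F) h; apply/(std_sausage_pointP _ standard_frame).
- by move=> psi _ /(std_sausage_pointP _ standard_frame) h; apply/(std_sausage_pointP _ F).
Qed.

Lemma measurable_profile r a : measurable_fun [set: RR] (profile r a).
Proof.
rewrite profile.unlock; apply: (measurableT_comp (fine_measurable measurableT)).
by apply: measurable_slice_area; exact: closed_std_sausage.
Qed.

Lemma profile_mono r a s t : 0 < r < pi / 2 -> 0 <= a -> a + r < pi / 2 ->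
  0 <= s -> s <= t -> t <= pi / 2 -> profile r a t <= profile r a s.
Proof.
move=> rb a0 ar s0 st th; have cS := closed_std_sausage (c := delta_mx 0 i2) (u := delta_mx 0 i0) (r := r) (a := a).
rewrite profile.unlock; apply: fine_le; try by rewrite slice_fineK.
apply: slice_area_mono => // psi psi0; exact: (std_sausage_azimuth standard_frame).
Qed.

Lemma profile_reflect r a phi : profile r a (pi - phi) = profile r a phi.
Proof.
have cS := closed_std_sausage (c := delta_mx 0 i2) (u := delta_mx 0 i0) (r := r) (a := a).
suff le t : profile r a t <= profile r a (pi - t).
  by apply/le_anti; rewrite le -{2}[phi](subKr pi) le.
rewrite profile.unlock; apply: fine_le; try by rewrite slice_fineK.
apply: slice_area_mono => // psi _; exact: (std_sausage_reflect_u standard_frame).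
Qed.

Lemma profile_ge0 r a phi : 0 <= profile r a phi.
Proof. by rewrite -lee_fin -(profileE r a phi standard_frame) slice_area_ge0. Qed.

Lemma profile_le r a phi : profile r a phi <= pi.
Proof. by rewrite -lee_fin -(profileE r a phi standard_frame); apply: slice_area_le; exact: closed_std_sausage. Qed.

Local Notation G r a := (profile_integral (profile r a) 0).

Let GE r a x y : x <= y -> (\int[mu]_(t in `[x, y]) (profile r a t)%:E)%E = (profile_integral (profile r a) x y)%:E.
Proof. by apply: profile_integralE; [exact: measurable_profile|exact: profile_ge0|exact: profile_le]. Qed.

Lemma area_std_sausage c u v r a : orthonormal_frame c u v ->
  area (std_sausage c u r a) = (4 * G r a (pi / 2))%:E.
Proof.
move=> F; have pi0 := pi_gt0 R.
have FN : orthonormal_frame c u (- v).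
  by case: F => -[c1 u1 v1] [cu cv uv]; split; split=> //; rewrite ?dotNl ?dotNr ?opprK ?cv ?uv ?oppr0.
have cS := closed_std_sausage (c := c) (u := u) (r := r) (a := a).
have mp : measurable_fun [set: RR] (fun t => (profile r a t)%:E).
  by apply/measurable_EFinP; exact: measurable_profile.
have pp t : (0 <= (profile r a t)%:E)%E by rewrite lee_fin profile_ge0.
have half w : orthonormal_frame c u w -> half_area u w c (std_sausage c u r a) = (2 * G r a (pi / 2))%:E.
  move=> Fw; rewrite /half_area; under eq_integral do rewrite (profileE _ _ _ Fw).
  rewrite (@integral_itv_split R _ 0 (pi / 2) pi mp pp); [|lra|lra].
  rewrite (@integral_itv_reflect R _ (pi / 2) pi pi mp pp).
  under [X in (_ + X)%E]eq_integral do rewrite profile_reflect.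
  rewrite subrr (_ : pi - pi / 2 = pi / 2 :> R); last by lra.
  by rewrite GE ?divr_ge0 ?ltW// -EFinD; congr (_%:E); ring.
by rewrite (area_frameE cS F) (half_area_split u v c cS) !half// -EFinD; congr (_%:E); ring.
Qed.

(** Each half of a sector between two contact directions is compared with the sausage whose long
    axis points to the nearer one; [std_sausage_sector] applies because every dual vector is
    admissible for both rolled disks. *)
Lemma sector_area K c u v r a al b : compact K -> K `<=` sphere -> cone_closed K ->
  K c -> orthonormal_frame c u v -> 0 < r < pi / 2 -> 0 <= a -> a + r < pi / 2 -> 0 <= b <= pi / 2 ->
  (forall n, dual_cone K n -> sin r * nrm n <= dot n (ray_point c (direction u v al) a)) ->
  (forall n, dual_cone K n -> sin r * nrm n <= dot n (ray_point c (direction u v (al + 2 * b)) a)) ->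
  ((2 * G r a b)%:E <= \int[mu]_(t in `[al, (al + 2 * b)%R]) slice_area u v c K t)%E.
Proof.
move=> Kcp Ks Kc Kcc F rb a0 ar /andP[b0 bh] K1 K2; have cK := compact_closed_rV Kcp.
have [[c1 u1 v1] [cu cv uv]] := F; have vu : dot v u = 0 by rewrite dotC.
have ms := measurable_slice_area u v c cK.
have frame e t : e ^+ 2 = 1 -> orthonormal_frame c (direction u v t) (e *: (cos t *: v - sin t *: u)).
  move=> e2; have e1 := cos2Dsin2 t; split; split=> //; rewrite /direction !dot_lin ?u1 ?v1 ?uv ?vu ?cu ?cv.
  - by rewrite -[RHS]e1; ring.
  - transitivity (e ^+ 2 * (cos t ^+ 2 + sin t ^+ 2)); first by ring.
    by rewrite e2 e1 mulr1.
  - by ring.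
  - by ring.
  - by ring.
have dirE e t s : direction (direction u v t) (e *: (cos t *: v - sin t *: u)) s =
    (cos s * cos t - e * sin s * sin t) *: u + (cos s * sin t + e * sin s * cos t) *: v.
  by rewrite /direction; apply: vec3P; rewrite !mxE; ring.
have pointE e t s psi : frame_point (direction u v t) (e *: (cos t *: v - sin t *: u)) c psi s =
    sin psi *: direction (direction u v t) (e *: (cos t *: v - sin t *: u)) s + cos psi *: c.
  by rewrite /frame_point /direction; apply: vec3P; rewrite !mxE; ring.
have pointE' s psi : frame_point u v c psi s = sin psi *: direction u v s + cos psi *: c.
  by rewrite /frame_point /direction; apply: vec3P; rewrite !mxE; ring.
(* The sign [e] is the orientation: the first half is run through forwards from [al], the second one
   backwards from [al + 2 * b]. *)
have inK e t s : e ^+ 2 = 1 -> 0 <= s <= b ->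
    (forall n, dual_cone K n -> sin r * nrm n <= dot n (ray_point c (direction u v t) a)) ->
    (forall n, dual_cone K n -> sin r * nrm n <= dot n (ray_point c (direction u v (t + e * (2 * b))) a)) ->
    direction u v (t + e * s) = direction (direction u v t) (e *: (cos t *: v - sin t *: u)) s ->
    direction u v (t + e * (2 * b)) = direction (direction u v t) (e *: (cos t *: v - sin t *: u)) (2 * b) ->
    ((profile r a s)%:E <= slice_area u v c K (t + e * s)%R)%E.
  move=> e2 /andP[s0 sb] k1 k2 E1 E2; rewrite -(profileE _ _ _ (frame e t e2)).
  apply: slice_area_mono => //; first exact: closed_std_sausage.
  move=> psi psi0 Sx; rewrite pointE' E1 -pointE; apply: contrapT => nK.
  have [x1 _] := Sx; have [n [Kn nx]] := separation Kcp Ks Kc x1 nK.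
  suff : 0 <= dot n (frame_point (direction u v t) (e *: (cos t *: v - sin t *: u)) c psi s) by rewrite leNgt nx.
  apply: (std_sausage_sector (frame e t e2) rb a0 ar (b := b)) => //.
  - exact: Kn.
  - exact: k1.
  - by have := k2 n Kn; rewrite E2.
have one : (1 : R) ^+ 2 = 1 by rewrite expr1n.
have mone : (- 1 : R) ^+ 2 = 1 by rewrite sqrrN expr1n.
have p0 : (0 <= \int[mu]_(t in `[0%R, b]) (profile r a t)%:E)%E.
  by apply: integral_ge0 => t _; rewrite lee_fin profile_ge0.
have mp : measurable_fun [set: RR] (fun t => (profile r a t)%:E).
  by apply/measurable_EFinP; exact: measurable_profile.
have -> : (2 * G r a b)%:E = (\int[mu]_(t in `[0%R, b]) (profile r a t)%:E + \int[mu]_(t in `[0%R, b]) (profile r a t)%:E)%E.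
  by rewrite GE// -EFinD; congr (_%:E); ring.
have s0 := slice_area_ge0 u v c K.
have [l1 l2] : al <= al + b /\ al + b <= al + 2 * b by move: b0; clear => ?; split; lra.
rewrite (@integral_itv_split R _ al (al + b) (al + 2 * b) ms s0)//.
apply: leeD.
  rewrite -{1}[al]add0r [al + b]addrC integral_itv_shift//.
  apply: ge0_le_integral.
  - exact: measurable_itv.
  - by move=> t _; rewrite lee_fin profile_ge0.
  - exact: measurable_funTS.
  - by apply: measurable_funTS; apply: (measurableT_comp ms); exact: measurable_funD.
  move=> t; rewrite /= in_itv/= => t0; rewrite addrC -[t in (al + t)%R]mul1r.
  by apply: inK => //; rewrite ?mul1r// dirE /direction cosD sinD; apply: vec3P; rewrite !mxE; ring.
rewrite (@integral_itv_reflect R _ _ _ (al + 2 * b) ms s0) subrr (_ : al + 2 * b - (al + b) = b); last by ring.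
apply: ge0_le_integral.
- exact: measurable_itv.
- by move=> t _; rewrite lee_fin profile_ge0.
- exact: measurable_funTS.
- by apply: measurable_funTS; apply: (measurableT_comp ms); exact: measurable_funB.
move=> t; rewrite /= in_itv/= => t0; rewrite -mulN1r.
have e1 : al + 2 * b + -1 * (2 * b) = al by ring.
apply: inK => //; rewrite ?e1//.
  by rewrite dirE /direction mulN1r cosB sinB; apply: vec3P; rewrite !mxE; ring.
by rewrite dirE -{1}e1 /direction mulN1r cosB sinB; apply: vec3P; rewrite !mxE; ring.
Qed.

End Sectors.

(** * Strict decrease of the angular profile of a sausage *)

Section Extremal.
Context {R : realType}.
Implicit Types (u v c w z : 'rV[R]_3) (K S X : set 'rV[R]_3) (a b d e r t psi phi : R).
Local Notation G r a := (profile_integral (profile r a) 0).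

Lemma cos_lt s t : 0 <= s -> s < t -> t <= pi -> cos t < cos s.
Proof.
move=> s0 st tpi; rewrite cos_le_lt//; last by rewrite s0 ltW// (lt_le_trans st).
by rewrite tpi andbT (le_trans s0)// ltW.
Qed.

Let exists_some_frame : exists c u v : 'rV[R]_3, orthonormal_frame c u v.
Proof.
have [c c1 _] := exists_perp (0 : 'rV[R]_3) 0.
have [u u1 [cu _]] := exists_perp c 0; have [v F] := exists_frame c1 u1 cu.
by exists c, u, v.
Qed.

(** The last hypothesis places the point of colatitude [e] and longitude [d] in one disk of the
    sausage; the slice then contains the whole segment from the pole to it. *)
Lemma profile_ge_cap r a d e : 0 < r < pi / 2 -> 0 < cos a -> 0 < e <= pi / 2 ->
  cos r <= cos a * cos e + sin a * (sin e * cos d) -> 1 - cos e <= profile r a d.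
Proof.
move=> rb ca /andP[e0 eh] le; have pi0 := pi_gt0 R.
have [c [u [v F]]] := exists_some_frame.
have cS := closed_std_sausage (c := c) (u := u) (r := r) (a := a).
have sr : 0 < sin r by apply: sin_gt0_pihalf.
have epi : 0 < e <= pi by apply/andP; split=> //; lra.
have se : 0 < sin e by apply: sin_gt0_pi; apply/andP; split=> //; lra.
rewrite -lee_fin -(profileE r a d F); apply: slice_area_ge_cap => //.
have S1 : std_sausage c u r a (frame_point u v c e d).
  apply: (std_sausage_disk F rb); first by have [] := frame_pointE e d F.
  have [[c1 u1 v1] [cu cv uv]] := F.
  by rewrite /ray_point /frame_point !dot_lin c1 u1 cu cv uv (dotC u c) cu; lra.
move=> psi /andP[p0 pe].
have s0 : 0 <= sin psi by apply: sin_ge0_pi; apply/andP; split=> //; lra.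
have s1 : 0 <= sin (e - psi) by apply: sin_ge0_pi; apply/andP; split; lra.
apply/(std_sausage_pointP _ F) => n1 n2 n3 h1 h2.
have := (std_sausage_pointP _ F _ _ _).1 S1 n1 n2 n3 h1 h2.
have : 0 <= n3.
  have q0 : 0 <= sin r * Num.sqrt (n1 ^+ 2 + n2 ^+ 2 + n3 ^+ 2) by rewrite mulr_ge0 ?sqrtr_ge0// ltW.
  by rewrite -(pmulr_lge0 _ ca); lra.
set k := n1 * cos d + n2 * sin d => n30 h3.
rewrite -(pmulr_rge0 _ se).
(* The point of colatitude [psi] as a combination of the pole and the point of colatitude [e]. *)
have -> : sin e * (n3 * cos psi + sin psi * k) =
    n3 * sin (e - psi) + sin psi * (n3 * cos e + sin e * k).
  by rewrite sinB; ring.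
by apply: addr_ge0; apply: mulr_ge0.
Qed.

(** The test vector with coordinates 0, [- k], [sin r] has norm [cos a] and satisfies both
    conditions with equality: its great circle is tangent to both disks along one side of the
    sausage. *)
Lemma profile_le_cap r a d e k : 0 < r < pi / 2 -> 0 <= a -> a + r < pi / 2 -> 0 < e < pi / 2 ->
  0 <= k -> k ^+ 2 = cos a ^+ 2 - sin r ^+ 2 -> 0 <= cos d ->
  sin r * cos e <= cos d * (k * sin e) -> profile r a (pi / 2 - d) <= 1 - cos e.
Proof.
move=> rb a0 ar /andP[e0 eh] k0 k2 cd le; have pi0 := pi_gt0 R; have /andP[r0 rh] := rb.
have [c [u [v F]]] := exists_some_frame.
have cS := closed_std_sausage (c := c) (u := u) (r := r) (a := a).
have sr : 0 < sin r by apply: sin_gt0_pihalf.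
have ca : 0 < cos a by apply: cos_gt0_pihalf; apply/andP; split; lra.
have epi : 0 < e <= pi by apply/andP; split=> //; lra.
rewrite -lee_fin -(profileE r a (pi / 2 - d) F); apply: slice_area_le_cap => //.
move=> psi psi0 Sx; have psir := std_sausage_colatitude F rb a0 ar psi0 Sx.
have := (std_sausage_pointP _ F _ _ _).1 Sx 0 (- k) (sin r).
rewrite sqrrN k2 expr0n/= add0r subrK sqrtr_sqr (gtr0_norm ca) mulr0 addr0 subr0.
move=> /(_ (lexx _) (lexx _)); rewrite mul0r add0r sinB sin_pihalf cos_pihalf mul0r subr0 mul1r.
move=> h; rewrite leNgt; apply/negP => lt; case/andP: psi0 => p0 ppi.
have c1 : cos psi < cos e by apply: cos_lt => //; exact: ltW.
have se : 0 <= sin e by apply: sin_ge0_pi; move: e0 eh pi0; clear => *; apply/andP; split; lra.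
have sp : 0 <= sin psi by apply: sin_ge0_pi; rewrite p0 ppi.
have c0 : 0 <= cos psi.
  by apply: cos_ge0_pihalf; move: p0 psir ar; clear => *; apply/andP; split; lra.
have s1 : sin e <= sin psi.
  by rewrite -ler_sqr ?nnegrE// !sin2cos2 lerD2l lerN2 ler_sqr ?nnegrE ?(ltW c1)// (le_trans c0)// ltW.
have h2 : sin r * cos psi < sin r * cos e by rewrite ltr_pM2l.
have h3 : cos d * (k * sin e) <= cos d * (k * sin psi).
  by apply: ler_wpM2l => //; exact: ler_wpM2l.
by move: h h2 h3 le; clear; lra.
Qed.

(* Close to the axis through both disks the slice reaches almost [a + r];
   orthogonally to it, only the angle [tau] of sine [sin r / cos a]. *)
Lemma profile_gap r a : 0 < r < pi / 2 -> 0 < a -> a + r < pi / 2 ->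
  exists2 d, 0 < d <= pi / 2 & profile r a (pi / 2 - d) < profile r a d.
Proof.
move=> rb a0 ar; have pi0 := pi_gt0 R; have /andP[r0 rh] := rb.
have sr : 0 < sin r by apply: sin_gt0_pihalf.
have sa : 0 < sin a by apply: sin_gt0_pihalf; apply/andP; split; lra.
have ca : 0 < cos a by apply: cos_gt0_pihalf; apply/andP; split; lra.
have srho : 0 < sin (a + r) by apply: sin_gt0_pihalf; apply/andP; split; lra.
have crho : 0 < cos (a + r) by apply: cos_gt0_pihalf; apply/andP; split; lra.
have lt1 : sin r < cos a * sin (a + r).
  rewrite (_ : sin r = sin (a + r - a)); last by congr sin; ring.
  by rewrite sinB; have := mulr_gt0 crho sa; lra.
have sca : sin r < cos a.
  by apply: (lt_le_trans lt1); rewrite -[leRHS]mulr1 ler_wpM2l ?sin_le1// ltW.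
pose k := Num.sqrt (cos a ^+ 2 - sin r ^+ 2).
have k2 : k ^+ 2 = cos a ^+ 2 - sin r ^+ 2.
  by rewrite sqr_sqrtr// subr_ge0 ler_sqr ?nnegrE ?ltW.
have k0 : 0 < k by rewrite sqrtr_gt0 subr_gt0 ltr_sqr ?nnegrE ?ltW.
clearbody k.
have [tau [tau0 taur ct st]] : exists tau, [/\ 0 <= tau, tau < a + r,
    cos tau = k / cos a & sin tau = sin r / cos a].
  have [/andP[tau0 taupi] ct st] : [/\ 0 <= acos (k / cos a) <= pi, cos (acos (k / cos a)) = k / cos a &
      sin (acos (k / cos a)) = sin r / cos a].
    apply: acos_cos_sin; first by rewrite divr_ge0 ?ltW.
    by rewrite !expr_div_n -mulrDl k2 subrK divff// expf_neq0// gt_eqF.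
  exists (acos (k / cos a)); split=> //.
  rewrite ltNge; apply/negP => h; have : cos (acos (k / cos a)) <= cos (a + r) by apply: cos_homo => //; lra.
  have ct0 : 0 <= cos (acos (k / cos a)) by rewrite ct divr_ge0 ?ltW.
  move=> le; have : sin (a + r) <= sin (acos (k / cos a)).
    rewrite -ler_sqr ?nnegrE; [|exact: ltW|by rewrite st divr_ge0 ?ltW].
    by rewrite !sin2cos2 lerD2l lerN2 ler_sqr ?nnegrE// ltW.
  by rewrite st ler_pdivlMr// mulrC leNgt lt1.
have [m [mtau ma mr]] : exists m, [/\ tau <= m, a <= m & m < a + r].
  by exists (Num.max tau a); rewrite !le_max !lexx orbT gt_max taur; split=> //; lra.
(* Two colatitudes [e2 < e1] strictly between [tau] and [a + r]: slices near the long axis will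
   exceed the cap of radius [e1], those near the short axis stay within that of [e2]. Being above
   [a] makes the distance of [e1] from the disk center less than [r]. *)
pose e2 := (m + (a + r)) / 2; pose e1 := (e2 + (a + r)) / 2.
have e2m : m < e2 by rewrite /e2; move: mr; clear; lra.
have e12 : e2 < e1 by rewrite /e1 /e2; move: mr; clear; lra.
have e1r : e1 < a + r by rewrite /e1 /e2; move: mr; clear; lra.
clearbody e2 e1.
have e20 : 0 < e2 < pi / 2.
  by move: e2m ma a0 e12 e1r ar; clear => *; apply/andP; split; lra.
have e10 : 0 < e1 < pi / 2.
  by move: e2m ma a0 e12 e1r ar; clear => *; apply/andP; split; lra.
have se2 : 0 < sin e2 by apply: sin_gt0_pihalf.
have se1 : 0 < sin e1 by apply: sin_gt0_pihalf.
have A1 : sin r * cos e2 / (k * sin e2) < 1.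
  have : 0 < sin (e2 - tau).
    apply: sin_gt0_pihalf; case/andP: e20 => _; move: e2m mtau tau0; clear => *.
    by apply/andP; split; lra.
  rewrite sinB ct st => h.
  rewrite ltr_pdivrMr ?mulr_gt0// mul1r -subr_gt0.
  have -> : k * sin e2 - sin r * cos e2 = cos a * (sin e2 * (k / cos a) - cos e2 * (sin r / cos a)).
    by field; rewrite gt_eqF.
  exact: mulr_gt0.
have B1 : (cos r - cos a * cos e1) / (sin a * sin e1) < 1.
  have : cos r < cos (e1 - a) by apply: cos_lt; move: e12 e2m ma e1r rh pi0; clear; lra.
  by rewrite ltr_pdivrMr ?mulr_gt0// mul1r cosB; clear; lra.
(* [A1] and [B1] are the two cap conditions at [d = 0] and are strict, so some positive [d]
   satisfies both. *)
have [d [d0 cd0 dA dB]] : exists d, [/\ 0 < d <= pi / 2, 0 <= cos d,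
    sin r * cos e2 / (k * sin e2) <= cos d &
    (cos r - cos a * cos e1) / (sin a * sin e1) <= cos d].
  move: A1 B1; move: (_ / (k * _)) (_ / (sin a * _)) => A B A1 B1.
  pose e := Num.max 0 (Num.max A B).
  have eA : A <= e by rewrite !le_max lexx !orbT.
  have eB : B <= e by rewrite !le_max lexx !orbT.
  have e0 : 0 <= e by rewrite le_max lexx.
  have e1' : e < 1 by rewrite !gt_max A1 B1 ltr01.
  have en : -1 <= e by rewrite (le_trans _ e0)// lerN10.
  have cd : cos (acos e) = e by rewrite acosK// in_itv/= en ltW.
  exists (acos e); rewrite cd; split=> //; rewrite acos_gt0 ?en//= leNgt; apply/negP => h.
  have : cos (acos e) < cos (pi / 2).
    by apply: cos_lt => //; [rewrite ltW// divr_gt0|rewrite acos_lepi// en ltW].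
  by rewrite cos_pihalf cd ltNge e0.
exists d => //.
have lo : 1 - cos e1 <= profile r a d.
  apply: profile_ge_cap => //; first by case/andP: e10 => -> /ltW ->.
  by move: dB; rewrite ler_pdivrMr ?mulr_gt0//; clear; lra.
have hi : profile r a (pi / 2 - d) <= 1 - cos e2.
  apply: (profile_le_cap rb (ltW a0) ar e20 (ltW k0)) => //.
  by move: dA; rewrite ler_pdivrMr ?mulr_gt0.
have : cos e1 < cos e2 by apply: cos_lt => //; move: e20 e10 pi0; clear => /andP[? ?] /andP[? ?] ?; lra.
by move: lo hi; clear; lra.
Qed.

End Extremal.

(** * The area bound and its equality case *)

Section Rigidity.
Context {R : realType}.
Implicit Types (u v c w z : 'rV[R]_3) (K S X : set 'rV[R]_3) (a b d e r t psi phi : R).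
Local Notation G r a := (profile_integral (profile r a) 0).

Variables (K : set 'rV[R]_3) (c : 'rV[R]_3) (r a : R).
Hypothesis Kcp : compact K.
Hypothesis Ks : K `<=` sphere.
Hypothesis Kc : cone_closed K.
Hypothesis c1 : dot c c = 1.
Hypothesis Kcc : K c.
Hypothesis rb : 0 < r < pi / 2.
Hypothesis a0 : 0 <= a.
Hypothesis ar : a + r < pi / 2.
Hypothesis touch : forall v, dot c v = 0 -> exists2 u, contact K c (a + r) u & dot v u <= 0.
Hypothesis roll : forall u, contact K c (a + r) u -> forall n, dual_cone K n ->
  sin r * nrm n <= dot n (ray_point c u a).

Local Ltac narrow := clear - K c r a Kcp Ks Kc c1 Kcc rb a0 ar touch roll.

Let cK : closed K. Proof. exact: compact_closed_rV. Qed.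

(** The contact direction making the largest angle with [u] on the side of [w]. *)
Let extreme_contact u w : contact K c (a + r) u -> dot w u = 0 ->
  exists2 z, contact K c (a + r) z /\ 0 <= dot w z &
    forall z', contact K c (a + r) z' -> 0 <= dot w z' -> dot u z <= dot u z'.
Proof.
move=> cu wu; pose B := contact K c (a + r) `&` [set z | 0 <= dot w z].
have Bcp : compact B.
  apply: compact_sub_sphere; first by move=> z [[]].
  by apply: closedI; [exact: closed_contact|exact: closed_halfspace].
have B0 : B !=set0 by exists u; split; rewrite //= wu.
have [z + zmin] := EVT_min_rV B0 Bcp (continuous_subspaceT (@dot_continuous _ u)).
rewrite inE => -[z1 z2]; exists z => // z' h1 h2; apply: zmin; rewrite inE; split=> //.
Qed.

(** From one contact direction [u], let [al2] and [al3] be the angles of the farthest contacts on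
    its two sides. The full turn splits into sectors of angles [al2], [2 * pi - al2 - al3] and
    [al3]; the middle one is at most pi because of the property [touch]. A sector of angle exactly
    pi has opposite contacts at its ends. *)
Lemma contact_sectors : exists b1 b2 b3,
  [/\ [/\ 0 <= b1 <= pi / 2, 0 <= b2 <= pi / 2 & 0 <= b3 <= pi / 2], b1 + b2 + b3 = pi,
    ((2 * (G r a b1 + G r a b2 + G r a b3))%:E <= area K)%E &
    b1 = pi / 2 \/ b2 = pi / 2 \/ b3 = pi / 2 ->
      exists w, contact K c (a + r) w /\ contact K c (a + r) (- w)].
Proof.
have pi0 := pi_gt0 R.
have [u cu_ _] := touch (dot0r c); have [u1 cu _] := cu_.
have [v F] := exists_frame c1 u1 cu; have [[_ _ v1] [_ cv uv]] := F.
have vu : dot v u = 0 by rewrite dotC.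
have vNu : dot (- v) u = 0 by rewrite dotNl vu oppr0.
have coord z : contact K c (a + r) z -> z = dot u z *: u + dot v z *: v /\ dot u z ^+ 2 + dot v z ^+ 2 = 1.
  move=> [z1 cz _]; split.
    by rewrite {1}(frame_expand z F) (dotC z c) cz scale0r addr0 !(dotC z).
  by rewrite -z1 (frame_dot z z F) (dotC z c) cz !(dotC z); ring.
have [z2 [cz2 vz2] min2] := extreme_contact cu_ vu.
have [z3 [cz3 vz3] min3] := extreme_contact cu_ vNu.
have [E2 n2] := coord _ cz2; have [E3 n3] := coord _ cz3.
rewrite dotNl in vz3.
have [/andP[al20 al2pi] ct2 st2] := acos_cos_sin vz2 n2.
have n3' : dot u z3 ^+ 2 + (- dot v z3) ^+ 2 = 1 by rewrite sqrrN.
have [/andP[al30 al3pi] ct3 st3] := acos_cos_sin vz3 n3'.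
move: (acos (dot u z2)) (acos (dot u z3)) al20 al2pi ct2 st2 al30 al3pi ct3 st3 => al2 al3 al20 al2pi ct2 st2 al30 al3pi ct3 st3.
have gap : pi <= al2 + al3.
  rewrite leNgt; apply/negP => lt.
  (* The middle of the arc holding all contacts: if the arc were shorter than pi, this direction
     would be positive on every contact. *)
  pose eta := (al2 - al3) / 2.
  have cw : dot c (cos eta *: u + sin eta *: v) = 0 by rewrite !dot_lin cu cv; ring.
  have [z cz] := touch cw; rewrite !dot_lin leNgt => /negP; apply.
  have [_ nz] := coord _ cz.
  have [vz|vz] := leP 0 (dot v z).
    have [/andP[t0 tpi] ct st] := acos_cos_sin vz nz.
    have := min2 z cz vz; rewrite -ct -st -ct2 => le.
    have tal : acos (dot u z) <= al2.
      by rewrite leNgt; apply/negP => h; have := cos_lt al20 h tpi; rewrite ltNge le.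
    by rewrite -cosB; apply: cos_gt0_pihalf; rewrite /eta; move: lt t0 tal al20 al30 pi0;
      narrow => *; apply/andP; split; lra.
  have vz' : 0 <= dot (- v) z by rewrite dotNl oppr_ge0 ltW.
  have nz' : dot u z ^+ 2 + (- dot v z) ^+ 2 = 1 by rewrite sqrrN.
  have vz0 : 0 <= - dot v z by rewrite -dotNl.
  have [/andP[t0 tpi] ct st] := acos_cos_sin vz0 nz'.
  have := min3 z cz vz'; rewrite -ct -ct3 => le.
  have tal : acos (dot u z) <= al3.
    by rewrite leNgt; apply/negP => h; have := cos_lt al30 h tpi; rewrite ltNge le.
  have -> : dot v z = - sin (acos (dot u z)) by rewrite st opprK.
  by rewrite mulrN -cosD; apply: cos_gt0_pihalf; rewrite /eta; move: lt t0 tal al20 al30 pi0;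
    narrow => *; apply/andP; split; lra.
have D2 : z2 = direction u v al2 by rewrite E2 -ct2 -st2.
have D3 : z3 = direction u v (2 * pi - al3).
  rewrite /direction (_ : 2 * pi - al3 = - al3 + pi *+ 2); last by rewrite mulr_natl addrC.
  by rewrite cosD2pi sinD2pi cosN sinN E3 -ct3 st3 opprK.
have D0 : u = direction u v 0 by rewrite /direction cos0 sin0 scale1r scale0r addr0.
have D1 : u = direction u v (2 * pi).
  by rewrite /direction -[2 * pi]add0r mulr_natl cosD2pi sinD2pi cos0 sin0 scale1r scale0r addr0.
pose b1 := al2 / 2; pose b2 := (2 * pi - al3 - al2) / 2; pose b3 := al3 / 2.
have h1 : 0 + 2 * b1 = al2 by rewrite /b1; field.
have h2 : al2 + 2 * b2 = 2 * pi - al3 by rewrite /b2; field.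
have h3 : 2 * pi - al3 + 2 * b3 = 2 * pi by rewrite /b3; field.
have [b10 b20 b30] : [/\ 0 <= b1 <= pi / 2, 0 <= b2 <= pi / 2 & 0 <= b3 <= pi / 2].
  rewrite /b1 /b2 /b3; move: al20 al2pi al30 al3pi gap; narrow => *.
  by split; apply/andP; split; lra.
exists b1, b2, b3; split=> //.
- by rewrite /b1 /b2 /b3; field.
- have sec := sector_area Kcp Ks Kc Kcc F rb a0 ar.
  have ms := measurable_slice_area u v c cK; have s0 := slice_area_ge0 u v c K.
  rewrite (area_frameE cK F) /area_frame.
  have [l1 l2 l3 l4] : [/\ 0 <= al2, al2 <= 2 * pi - al3, 0 <= 2 * pi - al3 & 2 * pi - al3 <= 2 * pi].
    by move: al20 al2pi al30 al3pi; narrow => *; split; lra.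
  rewrite (@integral_itv_split R _ 0 (2 * pi - al3) (2 * pi) ms s0)//.
  rewrite (@integral_itv_split R _ 0 al2 (2 * pi - al3) ms s0)//.
  rewrite (_ : 2 * (_ + _ + _) = 2 * G r a b1 + 2 * G r a b2 + 2 * G r a b3); last by ring.
  rewrite !EFinD; apply: leeD; first apply: leeD.
  + by have := sec 0 b1 b10; rewrite h1 -D0 -D2; apply; exact: roll.
  + by have := sec al2 b2 b20; rewrite h2 -D2 -D3; apply; exact: roll.
  + by have := sec (2 * pi - al3) b3 b30; rewrite h3 -D3 -D1; apply; exact: roll.
move=> [|[|]] e.
- exists u; split=> //; suff -> : - u = z2 by [].
  rewrite D2 (_ : al2 = pi); last by move: e; rewrite /b1; narrow; lra.
  by rewrite /direction cospi sinpi scaleN1r scale0r addr0.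
- exists z2; split=> //; suff -> : - z2 = z3 by [].
  rewrite D3 D2 (_ : 2 * pi - al3 = al2 + pi); last by move: e; rewrite /b2; narrow; lra.
  by rewrite /direction cosDpi sinDpi !scaleNr opprD.
- exists u; split=> //; suff -> : - u = z3 by [].
  rewrite D3 (_ : 2 * pi - al3 = pi); last by move: e; rewrite /b3; narrow; lra.
  by rewrite /direction cospi sinpi scaleN1r scale0r addr0.
Qed.

Let concave b : 0 <= b <= pi / 2 -> b * G r a (pi / 2) <= pi / 2 * G r a b.
Proof.
apply: (profile_concave (measurable_profile r a) (profile_ge0 r a) (profile_le r a)) => s t s0 st th.
exact: profile_mono.
Qed.

Let strictly_concave b : 0 < a -> 0 < b < pi / 2 -> b * G r a (pi / 2) < pi / 2 * G r a b.
Proof.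
move=> a0' hb; have [d /andP[d0 dh] gap] := profile_gap rb a0' ar.
apply: (profile_strictly_concave (measurable_profile r a) (profile_ge0 r a) (profile_le r a) _ hb d0 gap).
- by move=> s t s0 st th; exact: profile_mono.
- by move=> t /andP[t0 td]; exact: profile_mono.
- by move=> t /andP[t0 td]; apply: profile_mono => //; lra.
Qed.

Lemma area_ge_profile : ((4 * G r a (pi / 2))%:E <= area K)%E.
Proof.
have [b1 [b2 [b3 [[h1 h2 h3] hs le _]]]] := contact_sectors.
apply: le_trans le; rewrite lee_fin; have pi0 := pi_gt0 R.
have pih : 0 < pi / 2 :> R by lra.
have := concave h1; have := concave h2; have := concave h3.
have -> : b3 = pi - b1 - b2 by lra.
move: (G r a _) (G r a _) (G r a _) (G r a _) => g g1 g2 g3 k1 k2 k3.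
suff : pi / 2 * (4 * g3) <= pi / 2 * (2 * (g + g1 + g2)) by rewrite (ler_pM2l pih).
lra.
Qed.

(** For [a = 0], [K] lies in a disk of the same area. For [a > 0], equality leaves every half angle
    at 0 or pi/2, and they add up to pi, so one of them is pi/2; opposite contacts then put a
    sausage of the same area inside [K]. *)
Lemma extremal_std_sausage : area K = (4 * G r a (pi / 2))%:E -> sphere_interior K !=set0 ->
  (forall x, K x -> cos (a + r) <= dot c x) ->
  exists u v, orthonormal_frame c u v /\ K = std_sausage c u r a.
Proof.
move=> aK Kint Kball; have pi0 := pi_gt0 R; have pih : 0 < pi / 2 :> R by lra.
have [az|az] := eqVneq a 0.
  have [u [u1 cu _] _] := touch (dot0r c); have [v F] := exists_frame c1 u1 cu.
  have cS := closed_std_sausage (c := c) (u := u) (r := r) (a := a).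
  exists u, v; split=> //.
  have KS : K `<=` std_sausage c u r a.
    move=> x Kx; apply: (std_sausage_disk F rb); first exact: Ks.
    by have := Kball x Kx; rewrite az add0r /ray_point cos0 sin0 scale1r scale0r addr0.
  apply/seteqP; split=> //; apply: contrapT => nSK.
  have := lt_area cK cS (@std_sausage_sphere _ _ _ _ _) (@std_sausage_cone _ _ _ _ _)
    (std_sausage_interior F rb a) KS nSK.
  by rewrite aK (area_std_sausage _ _ F) ltxx.
have a0' : 0 < a by rewrite lt_def az.
have [b1 [b2 [b3 [[h1 h2 h3] hs le op]]]] := contact_sectors.
have [w [cw cNw]] : exists w, contact K c (a + r) w /\ contact K c (a + r) (- w).
  apply: op; apply: contrapT => /not_orP[n1 /not_orP[n2 n3]].
  have st b : 0 <= b <= pi / 2 -> b <> pi / 2 -> b = 0 \/ b * G r a (pi / 2) < pi / 2 * G r a b.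
    move=> /andP[b0 bh] bn; have [->|bz] := eqVneq b 0; [by left|right].
    by apply: strictly_concave => //; apply/andP; split; [rewrite lt_def bz|rewrite lt_neqAle bh andbT; apply/eqP].
  have k1 := concave h1; have k2 := concave h2; have k3 := concave h3.
  have s1 := st _ h1 n1; have s2 := st _ h2 n2; have s3 := st _ h3 n3.
  move: le; rewrite aK lee_fin; apply/negP; rewrite -ltNge.
  suff : pi / 2 * (4 * G r a (pi / 2)) < pi / 2 * (2 * (G r a b1 + G r a b2 + G r a b3)).
    by rewrite (ltr_pM2l pih).
  have tot : (b1 + b2 + b3) * G r a (pi / 2) = pi * G r a (pi / 2) by rewrite hs.
  move: (G r a _) (G r a _) (G r a _) (G r a _) k1 k2 k3 s1 s2 s3 tot => g1 g2 g3 g k1 k2 k3 s1 s2 s3 tot.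
  move: k1 k2 k3 s1 s2 s3 tot hs pi0; narrow => k1 k2 k3 s1 s2 s3 tot hs pi0.
  case: s1 => [z1|s1]; last lra.
  case: s2 => [z2|s2]; last lra.
  case: s3 => [z3|s3]; last lra.
  by move: hs pi0; rewrite z1 z2 z3; narrow; lra.
have [w1 cw0 _] := cw; have [v F] := exists_frame c1 w1 cw0.
have cS := closed_std_sausage (c := c) (u := w) (r := r) (a := a).
exists w, v; split=> //.
have SK : std_sausage c w r a `<=` K.
  move=> x [x1 Sx]; apply: contrapT => nKx.
  have [n [Kn nx]] := separation Kcp Ks Kc x1 nKx.
  suff : 0 <= dot n x by lra.
  by apply: Sx; exact: roll.
apply/seteqP; split=> //; apply: contrapT => nKS.
by have := lt_area cS cK Ks Kc Kint SK nKS; rewrite aK (area_std_sausage _ _ F) ltxx.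
Qed.

End Rigidity.

(** * Degenerate bodies: hemispheres and the whole sphere *)

Section Hemispheres.
Context {R : realType}.
Implicit Types (u v c n : 'rV[R]_3) (K : set 'rV[R]_3) (a r : R).

Lemma closed_hemisphere n : closed (hemisphere n).
Proof.
rewrite (_ : hemisphere n = sphere `&` [set x | 0 <= dot n x])//.
by apply: closedI; [exact: closed_sphere|exact: closed_halfspace].
Qed.

Lemma area_hemisphere n n' : dot n n = 1 -> dot n' n' = 1 ->
  area (hemisphere n) = area (hemisphere n').
Proof.
move=> n1 n'1.
have [u u1 [nu _]] := exists_perp n 0; have [v F] := exists_frame n1 u1 nu.
have [u' u'1 [nu' _]] := exists_perp n' 0; have [v' F'] := exists_frame n'1 u'1 nu'.
rewrite (area_frameE (@closed_hemisphere n) F) (area_frameE (@closed_hemisphere n') F').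
apply: eq_integral => t _; apply/le_anti/andP; split; apply: slice_area_mono;
  try exact: closed_hemisphere.
- move=> psi _ [_]; have [_ ->] := frame_pointE psi t F => h.
  by have [h1 h2] := frame_pointE psi t F'; split; rewrite ?h2.
- move=> psi _ [_]; have [_ ->] := frame_pointE psi t F' => h.
  by have [h1 h2] := frame_pointE psi t F; split; rewrite ?h2.
Qed.

Lemma std_sausage_area_hemisphere c u v r a : orthonormal_frame c u v -> 0 < r < pi / 2 ->
  0 <= a -> a + r < pi / 2 -> (area (std_sausage c u r a) < area (hemisphere c))%E.
Proof.
move=> F rb a0 ar; have [[c1 u1 _] [cu _ _]] := F; have /andP[r0 _] := rb.
have car : 0 < cos (a + r) by apply: cos_gt0_pihalf; apply/andP; split; lra.
apply: lt_area.
- exact: closed_std_sausage.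
- exact: closed_hemisphere.
- by move=> x [].
- move=> x y p q [_ x0] [_ y0] p0 q0 z0; split; first exact: unitv1.
  by rewrite dot_unitvr_ge0// !dot_lin addr_ge0// mulr_ge0.
- exists c; split=> //; have : nbhs c [set x | 0 < dot c x].
    by apply: open_nbhs_nbhs; split; [exact: open_dot_gt|rewrite /= c1].
  by apply: filterS => x /= h x1; split=> //; exact: ltW.
- move=> x Sx; split; first by case: Sx.
  by apply: le_trans (std_sausage_ge F rb a0 ar Sx); exact: ltW.
move=> /(_ u)[]; first by split; rewrite ?cu.
move=> u1' Su; have := std_sausage_ge F rb a0 ar (conj u1' Su).
by rewrite cu leNgt car.
Qed.

Lemma lt_area_sphere K : closed K -> K `<=` sphere -> ~ (sphere `<=` K) -> (area K < area sphere)%E.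
Proof.
move=> cK Ks nK; apply: lt_area => //; first exact: closed_sphere.
- by move=> x y p q _ _ _ _; exact: unitv1.
have [c c1 _] := exists_perp (0 : 'rV[R]_3) 0.
by exists c; split=> //; near=> x.
Unshelve. all: by end_near.
Qed.

End Hemispheres.

Theorem corollary1p1 (R : realType) (lambda : R) (K S : set 'rV[R]_3)
  (lambda_gt0 : 0 < lambda)
  (hK : lambda_concave lambda K)
  (hS : lambda_sausage lambda S)
  (hKS : area K = area S) :
  circumradius K <= circumradius S /\
  (circumradius K = circumradius S <-> lambda_sausage lambda K).
Proof.
have [r rb [circ Scase]] := sausageP lambda_gt0 hS.
have [[Kcp Kg Kint] _] := hK.
have Ks := Kg.1; have Kc := geodesically_convex_cone Kg; have cK := compact_closed_rV Kcp.
have [w w1 _] := exists_perp (0 : 'rV[R]_3) 0.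
have Kbar := lambda_concave_barrier (circ w w1) hK.
(* Both conclusions reduce to [b <= a] with rigidity at equality, except when [K] and [S] are the
   whole sphere. *)
suff [KS|[a [cS [uS [vS [FS a0 ar SE [le nKsph]]]]]]] : K = S \/ exists a c u v,
    [/\ orthonormal_frame c u v, 0 <= a, a + r < pi / 2, S = std_sausage c u r a &
      (exists b, [/\ 0 <= b, b <= a, circumradius K = b + r &
        b = a -> exists c' u' v', orthonormal_frame c' u' v' /\ K = std_sausage c' u' r a]) /\
      K <> sphere].
- by rewrite KS; split; [exact: lexx|split=> _; [exact: hS|exact: erefl]].
- case: le => b [b0 ba CK rigid].
  have CS : circumradius S = a + r by rewrite SE (circumradius_std_sausage FS).
  rewrite CK CS lerD2r; split; first exact: ba.
  split=> [/addIr ba'|sK].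
    have [c' [u' [v' [F' KE]]]] := rigid ba'.
    have [[c1 u1 _] [cu _ _]] := F'.
    have uN1 : dot (- u') (- u') = 1 by rewrite dotNl dotNr opprK.
    have cuN : dot c' (- u') = 0 by rewrite dotNr cu oppr0.
    split; first by case: hK.
    exists (ray_point c' u' a), (ray_point c' (- u') a), r, r; split.
    + by apply: circ; exact: ray_point1.
    + by apply: circ; exact: ray_point1.
    + by rewrite KE (hull_std_sausage F').
  have [r' rb' [circ' Kcase]] := sausageP lambda_gt0 sK.
  have rr := circle_of_curvature_radius (circ w w1) (circ' w w1); rewrite -{r'}rr in rb' circ' Kcase.
  case: Kcase => [KE|[c' [u' [v' [a' [F' a'0 a'r KE]]]]]]; first by case: (nKsph KE).
  have CK' : circumradius K = a' + r by rewrite KE (circumradius_std_sausage F').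
  rewrite -CK CK'; congr (_ + _).
  have same b' : area (std_sausage c' u' r b') = area (std_sausage cS uS r b').
    by rewrite (area_std_sausage _ _ F') (area_std_sausage _ _ FS).
  (* Two standard sausages of equal area have the same [a], since the area is strictly increasing in
     it. *)
  move: hKS; rewrite KE SE same; have [lt|lt|//] := ltgtP a' a.
    by have := std_sausage_area_lt FS rb a'0 lt ar => + e; rewrite e ltxx.
  by have := std_sausage_area_lt FS rb a0 lt a'r => + e; rewrite e ltxx.
have [KE|[n n1 Kn]] := full_or_supported Kcp Ks Kc.
  case: Scase => [SE|[c [u [v [a [F a0 ar SE]]]]]]; first by left; rewrite KE.
  have cS := closed_std_sausage (c := c) (u := u) (r := r) (a := a).
  have nS : ~ (sphere `<=` std_sausage c u r a).
    have [[c1 u1 _] [cu _ _]] := F.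
    have car : 0 < cos (a + r).
      by have /andP[r0 _] := rb; apply: cos_gt0_pihalf; apply/andP; split; lra.
    by move=> /(_ u u1)/(std_sausage_ge F rb a0 ar); rewrite cu leNgt car.
  have := lt_area_sphere cS (@std_sausage_sphere _ _ _ _ _) nS.
  by rewrite -SE -hKS KE ltxx.
have nK : ~ (sphere `<=` K).
  move=> /(_ (- n)) h; have /Kn : K (- n) by apply: h; rewrite /sphere/= dotNl dotNr opprK.
  by rewrite dotNr n1; lra.
case: Scase => [SE|[c [u [v [a [F a0 ar SE]]]]]].
  by have := lt_area_sphere cK Ks nK; rewrite hKS SE ltxx.
right; exists a, c, u, v; split; [exact: F|exact: a0|exact: ar|exact: SE|].
split; last by move=> KE; apply: nK; rewrite KE.
have [[q [Kq KNq]]|noanti] := pselect (exists q, K q /\ K (- q)).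
  (* Antipodal points make [K] a hemisphere, whose area is larger than that of [S]. *)
  have KE := antipodal_hemisphere Kcp Ks Kc Kbar rb n1 Kn Kq KNq.
  have [[c1 _ _] _] := F.
  have := std_sausage_area_hemisphere F rb a0 ar.
  by rewrite -SE -hKS KE (area_hemisphere n1 c1) ltxx.
have [m Km] := exists_strict_dual Ks Kcp Kc (fun x Kx KNx => noanti (ex_intro _ x (conj Kx KNx))).
have [d [b [d1 Kd [b0 br CK Kball [touch roll]]]]] := concave_structure Kcp Ks Kc Kint Kbar rb Km.
have low := area_ge_profile Kcp Ks Kc d1 Kd rb b0 br touch roll.
exists b; split; [exact: b0| |exact: CK|].
  (* If [b > a], the area of [K] would be at least that of the sausage with parameter [b], hence
     larger than that of [S]. *)
  rewrite leNgt; apply/negP => ab.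
  have := std_sausage_area_lt F rb a0 ab br; apply/negP; rewrite -leNgt.
  by rewrite -SE -hKS (area_std_sausage _ _ F).
move=> ba; rewrite -ba.
have aK : area K = (4 * profile_integral (profile r b) 0 (pi / 2))%:E.
  by rewrite hKS SE (area_std_sausage _ _ F) ba.
have [u' [v' [F' KE]]] := extremal_std_sausage Kcp Ks Kc d1 Kd rb b0 br touch roll aK Kint Kball.
by exists d, u', v'; split; [exact: F'|exact: KE].
Qed.
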